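(* Let $X\subset\mathbb{R}^d$ be measurable, $M>0$, $Y\subset[-M,M]$, and let $L(y,t)=(y-t)^2$ be the least-squares loss. Let $\mathbf{P}$ be a probability distribution on $X\times Y$ satisfying the dimension condition (DIM) with parameters $C_{\mathrm{dim}}>0$ and $\varrho>0$. Let $\alpha>0$ and assume $\|f_{L,\mathbf{P}}^*\|_{L_2(\mathbb{R}^d)}\le C_1$, $\|f_{L,\mathbf{P}}^*\|_{L_\infty(\mathbb{R}^d)}\le C_2$ and $|f_{L,\mathbf{P}}^*|_{B_{2,\infty}^\alpha(\mathbf{P}_X)}\le C_3$ for finite constants $C_1,C_2,C_3$. Choose $\gamma_n=n^{-1/(2\alpha+\varrho)}$ and $\lambda_n=n^{-b}$ for some $b\ge(2\alpha+d)/(2\alpha+\varrho)$. Then, for given $d,\alpha,\varrho,b$, there exists a constant $C>0$ only depending on $C_{\mathrm{dim}},C_1,C_2,C_3$ and $M$ such that for all $n>1$ and $\tau\ge1$ we have $$\mathcal{R}_{L,\mathbf{P}}(\hat f_{D,\lambda_n,\gamma_n})-\mathcal{R}_{L,\mathbf{P}}^*\le C\tau\,n^{-\frac{2\alpha}{2\alpha+\varrho}}\log^{d+1}n$$ with probability $\mathbf{P}^n$ (over $D$) not less than $1-e^{-\tau}$. If in addition $\operatorname{supp}\mathbf{P}_X$ is contained in a $\varrho$-dimensional, infinitely differentiable, compact (sub)manifold of $\mathbb{R}^d$, then the factor $\log^{d+1}n$ can be substituted by $\log^{\varrho+1}n$, where the constant $C$ then additionally depends on the curvature of the manifold.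
   Context: $\mathbf{P}_X$ is the marginal of $\mathbf{P}$ on $X$; $\operatorname{supp}\mathbf{P}_X$ is the complement of the largest open $\mathbf{P}_X$-null set. $\|\cdot\|$ is the Euclidean norm; $\ell_\infty^d$ is $\mathbb{R}^d$ with the maximum norm. $\mathcal{N}_E(A,\varepsilon)$ is the minimal number of closed $\varepsilon$-balls of the normed space $E$ (centers in $E$) needed to cover $A\subset E$. (DIM) with parameters $C_{\mathrm{dim}},\varrho>0$: $\mathcal{N}_{\ell_\infty^d}(\operatorname{supp}\mathbf{P}_X,\varepsilon)\le C_{\mathrm{dim}}\varepsilon^{-\varrho}$ for all $\varepsilon\in(0,1)$. Risks: $\mathcal{R}_{L,\mathbf{P}}(f)=\int L(y,f(x))\,d\mathbf{P}(x,y)$ and $\mathcal{R}_{L,\mathbf{P}}^*=\inf_f\mathcal{R}_{L,\mathbf{P}}(f)$ over measurable $f:X\to\mathbb{R}$. $f_{L,\mathbf{P}}^*$ is a Bayes decision function, i.e. $\mathcal{R}_{L,\mathbf{P}}(f_{L,\mathbf{P}}^* )=\mathcal{R}_{L,\mathbf{P}}^*$ (for least squares, $f_{L,\mathbf{P}}^*(x)=\mathbf{E}(Y|X=x)$); here it is regarded as a measurable function defined on all of $\mathbb{R}^d$ whose restriction to $X$ is a Bayes decision function. SVM: for $\gamma>0$, $H_\gamma(X)$ is the reproducing kernel Hilbert space of the Gaussian kernel $k_\gamma(x,y)=\exp(-\gamma^{-2}\|x-y\|^2)$ on $X$. For a sample $D=((x_1,y_1),\dots,(x_n,y_n))\sim\mathbf{P}^n$,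 $f_{D,\lambda,\gamma}=\arg\min_{f\in H_\gamma(X)}\lambda\|f\|_{H_\gamma(X)}^2+\frac1n\sum_{i=1}^nL(y_i,f(x_i))$. $\hat f_{D,\lambda,\gamma}$ is its pointwise clipping at $M$: $\hat f(x)=\max\{-M,\min\{M,f(x)\}\}$. Smoothness: for $f:\mathbb{R}^d\to\mathbb{R}$ and $h\in\mathbb{R}^d$, $\Delta_hf(x)=f(x+h)-f(x)$, and $\Delta_h^s$ is its $s$-fold application. For a measure $\mu$, $\omega_{s,L_2(\mu)}(f,t)=\sup_{\|h\|\le t}\|\Delta_h^sf\|_{L_2(\mu)}$. For $\alpha>0$ and $s=\lfloor\alpha\rfloor+1$, $|f|_{B_{2,\infty}^\alpha(\mu)}=\sup_{t>0}t^{-\alpha}\omega_{s,L_2(\mu)}(f,t)$. *)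

(* Defs.v *)
From HB Require Import structures.
From mathcomp Require Import all_boot all_order all_algebra.
From mathcomp Require Import all_classical all_reals all_analysis.

Set Implicit Arguments.
Unset Strict Implicit.
Unset Printing Implicit Defensive.

Import Order.TTheory GRing.Theory Num.Theory.
Import numFieldNormedType.Exports.

Local Open Scope classical_set_scope.
Local Open Scope ring_scope.

Section borel_row_vectors.
Context (R : realType) (d : nat).

Definition borel_display := sigma_display (@open 'rV[R]_d).

Let borel0 : <<s @open 'rV[R]_d >> set0.
Proof. exact: sigma_algebra0. Qed.

Let borelC (A : set 'rV[R]_d) :
  <<s @open 'rV[R]_d >> A -> <<s @open 'rV[R]_d >> (~` A).
Proof. exact: sigma_algebraC. Qed.

Let borel_bigcup (F : (set 'rV[R]_d)^nat) :
  (forall i, <<s @open 'rV[R]_d >> (F i)) ->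
  <<s @open 'rV[R]_d >> (\bigcup_i F i).
Proof. exact: sigma_algebra_bigcup. Qed.

HB.instance Definition _ := @isMeasurable.Build borel_display 'rV[R]_d
  <<s @open 'rV[R]_d >> borel0 borelC borel_bigcup.

End borel_row_vectors.

Section product_power.
Context d (T : measurableType d) (R : realType).
Local Open Scope ereal_scope.

Section cons_measure.
Variables (mu : {sigma_finite_measure set T -> \bar R}) (n : nat).
Variable nu : {sigma_finite_measure set (n.-tuple T) -> \bar R}.

Let tcons (z : T * n.-tuple T) : n.+1.-tuple T := [tuple of z.1 :: z.2].

Let tuncons (t : n.+1.-tuple T) : T * n.-tuple T :=
  (tnth t ord0, [tuple of behead t]).

Let tconsK : cancel tcons tuncons.
Proof.
by move=> [x t]; congr (_, _); apply/val_inj.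
Qed.

Let measurable_tcons : measurable_fun [set: T * n.-tuple T] tcons.
Proof. exact: measurable_cons. Qed.

Let measurable_tuncons : measurable_fun [set: n.+1.-tuple T] tuncons.
Proof.
apply/measurable_fun_pairP; split; first exact: measurable_tnth.
exact: measurable_behead.
Qed.

HB.instance Definition _ := isMeasurableFun.Build _ _ _ _ tcons measurable_tcons.

Definition cons_measure (A : set (n.+1.-tuple T)) : \bar R :=
  pushforward (mu \x nu) tcons A.

Let cons_measure0 : cons_measure set0 = 0.
Proof. exact: measure0. Qed.

Let cons_measure_ge0 A : 0 <= cons_measure A.
Proof. exact: measure_ge0. Qed.

Let cons_measure_sigma_additive : semi_sigma_additive cons_measure.
Proof. exact: measure_semi_sigma_additive. Qed.

HB.instance Definition _ := isMeasure.Build _ _ _ cons_measure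
  cons_measure0 cons_measure_ge0 cons_measure_sigma_additive.

Let cons_measure_sigma_finite : sigma_finite setT cons_measure.
Proof.
have /sigma_finiteP[F [UF ndF Foo]] := sigma_finiteT mu.
have /sigma_finiteP[G [UG ndG Goo]] := sigma_finiteT nu.
exists (fun k => tuncons @^-1` (F k `*` G k)).
  rewrite -preimage_bigcup; apply/esym/seteqP; split=> // t _ /=.
  have [k _ Fk] : (\bigcup_k F k) (tuncons t).1 by rewrite -UF.
  have [l _ Gl] : (\bigcup_k G k) (tuncons t).2 by rewrite -UG.
  exists (maxn k l) => //; split.
    by move: Fk; exact/subsetPset/ndF/leq_maxl.
  by move: Gl; exact/subsetPset/ndG/leq_maxr.
move=> k; have [mF muF] := Foo k; have [mG nuG] := Goo k; split.
  rewrite -[X in measurable X]setTI; apply: measurable_tuncons => //.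
  exact: measurableX.
rewrite /cons_measure /pushforward -comp_preimage.
rewrite (_ : tuncons \o tcons = id); last by apply/funext => z; exact: tconsK.
by rewrite preimage_id product_measure1E// lte_mul_pinfty// ge0_fin_numE.
Qed.

HB.instance Definition _ := Measure_isSigmaFinite.Build _ _ _ cons_measure
  cons_measure_sigma_finite.

End cons_measure.

Fixpoint product_power (mu : {sigma_finite_measure set T -> \bar R}) (n : nat) :
    {sigma_finite_measure set (n.-tuple T) -> \bar R} :=
  match n with
  | 0 => dirac [tuple]
  | m.+1 => cons_measure mu (product_power mu m)
  end.

End product_power.

Section lebesgue_row_vectors.
Context (R : realType) (d : nat).

Definition row_of_tuple (t : d.-tuple (measurableTypeR R)) : 'rV[R]_d :=
  \row_i tnth t i.

Let measurable_preimage_ball (x : 'rV[R]_d) (e : R) :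
  measurable (row_of_tuple @^-1` ball x e).
Proof.
have [e0|e0] := ltP 0 e; last first.
  rewrite (_ : _ @^-1` _ = set0)// -subset0 => t [/=].
  by rewrite ltNge e0.
rewrite (_ : _ @^-1` _ =
    \bigcap_(i in [set: 'I_d]) ((tnth (T:=_))^~ i @^-1` ball (x ord0 i) e)).
  apply: fin_bigcap_measurable => // i _.
  rewrite -[X in measurable X]setTI; apply: measurable_tnth => //.
  exact: measurable_realfun.measurable_ball.
apply/seteqP; split => [t [_ xt] i _|t xt].
  by have := xt ord0 i; rewrite mxE.
by split=> // i j; rewrite !ord1 mxE; exact: xt.
Qed.

Let row_of_tuple_measurable : measurable_fun [set: d.-tuple _] row_of_tuple.
Proof.
apply: (@measurability _ _ _ _ _ _ (@open 'rV[R]_d)) => // _ [U oU <-].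
rewrite setTI.
pose B (qk : 'rV[rat]_d * nat) := ball (map_mx ratr qk.1 : 'rV[R]_d) qk.2.+1%:R^-1.
pose I := [set qk | B qk `<=` U].
have -> : U = \bigcup_(qk in I) B qk.
  apply/seteqP; split=> [x Ux|x [qk Iqk]]; last exact: Iqk.
  have : nbhs x U by exact: open_nbhs_nbhs.
  move=> /nbhs_ballP[e /= e0 xeU].
  have [k] := ltr_add_invr (divr_gt0 e0 (ltr0Sn _ 1)).
  rewrite add0r => ke.
  have k0 : (0 : R) < k.+1%:R^-1 by rewrite invr_gt0 ltr0n.
  have qP i : {q | ball (x ord0 i) k.+1%:R^-1 (ratr q : R)}.
    apply: cid; have xk : x ord0 i < x ord0 i + k.+1%:R^-1 by rewrite ltrDl.
    have [q /=] := rat_in_itvoo xk.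
    rewrite in_itv/= => /andP[xq qx]; exists q.
    by rewrite -ball_normE/= distrC ger0_norm ?subr_ge0 1?ltW// ltrBlDl.
  pose q : 'rV[rat]_d := \row_i sval (qP i).
  have xq : ball (map_mx ratr q : 'rV[R]_d) k.+1%:R^-1 x.
    apply: ball_sym; split=> // i j; rewrite !ord1 !mxE.
    exact: svalP (qP j).
  exists (q, k) => // y qy; apply: xeU; rewrite (splitr e).
  have yq := le_ball (ltW ke) qy; have qx := le_ball (ltW ke) (ball_sym xq).
  exact: (ball_triangle qx yq).
rewrite preimage_bigcup bigcup_mkcond.
apply: countable_bigcupT_measurable; first exact: countableP.
by move=> qk; case: ifPn => _; [exact: measurable_preimage_ball|exact: measurable0].
Qed.

HB.instance Definition _ :=
  isMeasurableFun.Build _ _ _ _ row_of_tuple row_of_tuple_measurable.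

Definition lebesgue_row (A : set 'rV[R]_d) : \bar R :=
  pushforward (product_power (@lebesgue_measure R) d) row_of_tuple A.

Let lebesgue_row0 : lebesgue_row set0 = 0%E.
Proof. exact: measure0. Qed.

Let lebesgue_row_ge0 A : (0 <= lebesgue_row A)%E.
Proof. exact: measure_ge0. Qed.

Let lebesgue_row_sigma_additive : semi_sigma_additive lebesgue_row.
Proof. exact: measure_semi_sigma_additive. Qed.

HB.instance Definition _ := isMeasure.Build _ _ _ lebesgue_row
  lebesgue_row0 lebesgue_row_ge0 lebesgue_row_sigma_additive.

End lebesgue_row_vectors.

Section first_marginal.
Context d1 d2 (T1 : measurableType d1) (T2 : measurableType d2) (R : realType).
Variable P : probability (T1 * T2)%type R.

Definition first_marginal (A : set T1) : \bar R := pushforward P fst A.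

HB.instance Definition _ :=
  isMeasurableFun.Build _ _ _ _ (@fst T1 T2) measurable_fst.

Let first_marginal0 : first_marginal set0 = 0%E.
Proof. exact: measure0. Qed.

Let first_marginal_ge0 A : (0 <= first_marginal A)%E.
Proof. exact: measure_ge0. Qed.

Let first_marginal_sigma_additive : semi_sigma_additive first_marginal.
Proof. exact: measure_semi_sigma_additive. Qed.

HB.instance Definition _ := isMeasure.Build _ _ _ first_marginal
  first_marginal0 first_marginal_ge0 first_marginal_sigma_additive.

Let first_marginal_setT : first_marginal [set: T1] = 1%E.
Proof.
by rewrite /first_marginal /pushforward preimage_setT probability_setT.
Qed.

HB.instance Definition _ := Measure_isProbability.Build _ _ _
  first_marginal first_marginal_setT.

End first_marginal.

Section support_and_covering.
Context (R : realType) (d : nat).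
Local Open Scope ereal_scope.

Definition measure_support (mu : {measure set 'rV[R]_d -> \bar R}) : set 'rV[R]_d :=
  ~` \bigcup_(U in [set U | open U /\ mu U = 0]) U.

(* The library norm `| . | on 'rV[R]_d is the maximum norm, so this covering
   number is the one of \ell_\infty^d; it is +oo if there is no finite cover. *)
Definition covering_number (A : set 'rV[R]_d) (eps : R) : \bar R :=
  ereal_inf [set m%:R%:E | m in [set m : nat | exists c : 'I_m -> 'rV[R]_d,
    A `<=` \bigcup_i [set x | (`|x - c i| <= eps)%R]]].

Definition dimension_condition (mu : {measure set 'rV[R]_d -> \bar R})
    (Cdim rho : R) : Prop :=
  forall eps : R, (0 < eps < 1)%R ->
    covering_number (measure_support mu) eps <= (Cdim * eps `^ (- rho))%:E.

End support_and_covering.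

Section smoothness.
Context (R : realType) (d : nat).

Definition enorm (x : 'rV[R]_d) : R := Num.sqrt (\sum_i x ord0 i ^+ 2).

Definition difference (h : 'rV[R]_d) (f : 'rV[R]_d -> R) : 'rV[R]_d -> R :=
  fun x => f (x + h) - f x.

Local Open Scope ereal_scope.

Definition modulus_of_smoothness (mu : {measure set 'rV[R]_d -> \bar R})
    (s : nat) (f : 'rV[R]_d -> R) (t : R) : \bar R :=
  ereal_sup [set 'N[mu]_2%:E [EFin \o iter s (difference h) f] |
    h in [set h | (enorm h <= t)%R]].

Definition besov_seminorm (mu : {measure set 'rV[R]_d -> \bar R})
    (alpha : R) (f : 'rV[R]_d -> R) : \bar R :=
  ereal_sup [set (t `^ (- alpha))%:E *
      modulus_of_smoothness mu (Num.truncn alpha).+1 f t |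
    t in [set t : R | (0 < t)%R]].

End smoothness.

Definition gaussian_kernel (R : realType) (d : nat) (gamma : R)
  (x y : 'rV[R]_d) : R := expR (- gamma ^- 2 * enorm (x - y) ^+ 2).

(* The reproducing kernel Hilbert space of k on X. Functions on X are
   represented by their extension by zero to T, hence the restrictions \_ X. *)
Record rkhs (R : realType) (T : Type) (X : set T) (k : T -> T -> R) := Rkhs {
  rkhs_mem : set (T -> R);
  rkhs_inner : (T -> R) -> (T -> R) -> R;
  rkhs_off : forall f, rkhs_mem f -> forall x, ~ X x -> f x = 0;
  rkhs_zero : rkhs_mem (cst 0);
  rkhs_linear : forall (a : R) f g, rkhs_mem f -> rkhs_mem g ->
    rkhs_mem (fun x => a * f x + g x);
  rkhs_innerC : forall f g, rkhs_mem f -> rkhs_mem g ->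
    rkhs_inner f g = rkhs_inner g f;
  rkhs_innerDl : forall (a : R) f g h,
    rkhs_mem f -> rkhs_mem g -> rkhs_mem h ->
    rkhs_inner (fun x => a * f x + g x) h =
      a * rkhs_inner f h + rkhs_inner g h;
  rkhs_inner_ge0 : forall f, rkhs_mem f -> 0 <= rkhs_inner f f;
  rkhs_inner_eq0 : forall f, rkhs_mem f -> rkhs_inner f f = 0 -> f = cst 0;
  rkhs_complete : forall u : nat -> T -> R, (forall n, rkhs_mem (u n)) ->
    (forall eps : R, 0 < eps -> exists N, forall m n, (N <= m)%N -> (N <= n)%N ->
      rkhs_inner (u m \- u n) (u m \- u n) < eps) ->
    exists2 f, rkhs_mem f &
      rkhs_inner (u n \- f) (u n \- f) @[n --> \oo] --> (0 : R);
  rkhs_kernel : forall x, X x -> rkhs_mem (k x \_ X);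
  rkhs_reproducing : forall f x, rkhs_mem f -> X x ->
    rkhs_inner f (k x \_ X) = f x }.

Section learning.
Context (R : realType) (d : nat).
Local Notation E := 'rV[R]_d.
Local Notation Rm := (measurableTypeR R).
Implicit Types (L : R -> R -> R) (P : probability (E * Rm)%type R) (X : set E).

Definition least_squares (y t : R) : R := (y - t) ^+ 2.

Definition risk L P X (f : E -> R) : \bar R :=
  (\int[P]_(z in X `*` [set: Rm]) (L z.2 (f z.1))%:E)%E.

Definition bayes_risk L P X : \bar R :=
  ereal_inf [set risk L P X f | f in [set f : E -> R | measurable_fun X f]].

(* f is defined on all of R^d; only its restriction to X enters the risk. *)
Definition bayes_decision_function L P X (f : E -> R) : Prop :=
  measurable_fun [set: E] f /\ risk L P X f = bayes_risk L P X.

Definition svm_objective L X (k : E -> E -> R) (H : rkhs X k) (lambda : R)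
    (n : nat) (D : n.-tuple (E * Rm)) (f : E -> R) : R :=
  lambda * rkhs_inner H f f +
  n%:R^-1 * \sum_(i < n) L (tnth D i).2 (f (tnth D i).1).

Definition is_svm L X (k : E -> E -> R) (H : rkhs X k) (lambda : R)
    (n : nat) (D : n.-tuple (E * Rm)) (f : E -> R) : Prop :=
  rkhs_mem H f /\ forall g, rkhs_mem H g ->
    svm_objective L H lambda D f <= svm_objective L H lambda D g.

Definition clip (M : R) (f : E -> R) : E -> R :=
  fun x => Num.max (- M) (Num.min M (f x)).

(* Measurability in D of the risk of the SVM is not presupposed: the bound
   holds on a measurable event of probability at least p. *)
Definition svm_bound_with_probability L P X (M lambda gamma : R) (n : nat)
    (bound p : R) : Prop :=
  forall H : rkhs X (@gaussian_kernel R d gamma),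
  exists A : set (n.-tuple (E * Rm)),
    [/\ measurable A, (p%:E <= product_power P n A)%E &
      forall D f, A D -> is_svm L H lambda D f ->
        (risk L P X (clip M f) - bayes_risk L P X <= bound%:E)%E].

Record learning_problem (alpha rho Cdim C1 C2 C3 M : R)
    (X : set E) (Y : set Rm) P (fstar : E -> R) : Prop := LearningProblem {
  lp_measurable_X : measurable X;
  lp_measurable_Y : measurable Y;
  lp_bounded_Y : Y `<=` `[- M, M]%classic;
  lp_carrier : P (X `*` Y) = 1%E;
  lp_dim : dimension_condition (first_marginal P) Cdim rho;
  lp_bayes : bayes_decision_function least_squares P X fstar;
  lp_L2 : ('N[@lebesgue_row R d]_2%:E [EFin \o fstar] <= C1%:E)%E;
  lp_Loo : ('N[@lebesgue_row R d]_+oo [EFin \o fstar] <= C2%:E)%E;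
  lp_besov : (besov_seminorm (first_marginal P) alpha fstar <= C3%:E)%E }.

End learning.

Arguments least_squares {R}.

Section submanifolds.
Context (R : realType) (d : nat).
Local Notation E := 'rV[R]_d.

Fixpoint class_C (m : nat) (U : set E) (f : E -> E) : Prop :=
  match m with
  | 0 => forall x, U x -> {for x, continuous f}
  | m'.+1 => (forall x v, U x -> derivable f x v) /\
             (forall v, class_C m' U ('D_v f))
  end.

Definition smooth (U : set E) (f : E -> E) : Prop := forall m, class_C m U f.

(* N is a k-dimensional embedded C^infty submanifold (without boundary): near
   each of its points a smooth change of coordinates Phi of the ambient space
   maps N onto the coordinate subspace R^k x {0}. *)
Definition smooth_submanifold (k : nat) (N : set E) : Prop :=
  (k <= d)%N /\ forall p, N p -> exists (U V : set E) (Phi Psi : E -> E),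
    [/\ [/\ open U, open V & U p],
        smooth U Phi, smooth V Psi,
        (forall x, U x -> V (Phi x) /\ Psi (Phi x) = x) /\
        (forall y, V y -> U (Psi y) /\ Phi (Psi y) = y) &
        forall x, U x -> N x <-> forall i : 'I_d, (k <= i)%N -> Phi x ord0 i = 0].

Definition tangent_space (N : set E) (x : E) : set E :=
  [set v | exists c : R -> E, [/\ c 0 = x, \forall t \near 0, N (c t) &
     is_derive (0 : R) 1 c v]].

Definition distance_to (A : set E) (x : E) : R :=
  inf [set enorm (x - v) | v in A].

(* 2 dist(y - x, T_x N) / ||y - x||^2 is the curvature of the circle through y
   that is tangent to N at x; for y -> x it becomes the normal curvature of N
   at x. The supremum over all x, y in N (1 / reach(N), by Federer's formula)
   thus bounds the norm of the second fundamental form, and it is finite for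
   compact N. *)
Definition global_curvature (N : set E) : \bar R :=
  ereal_sup [set z | exists x y, [/\ N x, N y, x <> y &
    z = (2 * distance_to (tangent_space N x) (y - x)
         / enorm (y - x) ^+ 2)%:E]].

End submanifolds.

(* Main.v *)
From HB Require Import structures.
Require Import Defs.
From mathcomp Require Import all_boot all_order all_algebra.
From mathcomp Require Import all_classical all_reals all_analysis.
From mathcomp Require Import measurable_realfun ess_sup_inf.
From mathcomp Require Import zify ring lra.

Set Implicit Arguments.
Unset Strict Implicit.
Unset Printing Implicit Defensive.

Import Order.TTheory GRing.Theory Num.Theory.
Import numFieldNormedType.Exports.

Local Open Scope classical_set_scope.
Local Open Scope ring_scope.

(** Smoothing. With s = floor(alpha) + 1 and h a centred Gaussian vector of
    width gamma, let f0(x) be the mean of the linear combination of f*(x + h),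
    ..., f*(x + s h) for which f*(x) - f0(x) is, up to sign, the mean of the
    s-th difference of f* with step h. The Besov condition gives
    ||f* - f0||^2 = O(gamma^(2 alpha)) in L_2(P_X). The linear form
    a |-> sum_i a_i f0(x_i) is dominated by the Gram form of the Gaussian
    kernel up to a constant of order gamma^(-d), so for every sample some
    element of the RKHS of squared norm O(gamma^(-d)) takes the values f0(x_i)
    at the sample points; hence the SVM can be compared with f0 although f0 is
    not known to belong to the RKHS.

    Entropy. The SVM lies in a ball of radius M / sqrt(lambda) of the RKHS. On a
    set of diameter of order gamma, the Taylor expansion of
    exp(2 <x, y> / gamma^2) in suitable orthonormal coordinates approximates the
    kernel by one of finite rank: k coordinates need a degree of order log n,
    while the others, which are O(gamma^2) by the curvature bound (there are
    none for k = d), need bounded degree. As (DIM) allows us to cover the support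
    by O(gamma^(-rho)) such sets, the ball has an O(1/n)-net, uniformly on the
    support, of log-cardinality O(gamma^(-rho) log^(k+1) n). The exponential
    Markov inequality, the variance bound of the least-squares loss and a union
    bound over the net yield the oracle inequality.

    Geometry. By Federer's formula the curvature controls the distance of y - x
    to the tangent space at x, which in a chart is seen to be contained in a
    k-dimensional subspace. A compactness argument, based on a local
    second-order Taylor bound, shows that the curvature of a compact submanifold
    is finite, so that the constant may be chosen from the curvature alone. *)

(** * Reproducing kernels and interpolation *)

(** The RKHS is given only by its axioms and is accessed through values at finitely many points: a
    vector v is attained there by an element of squared norm at most B exactly when 2 <a, v> <= <a,
    K a> + B for all a, with K the Gram matrix. Thus the comparison with f0 and the finite-rank
    approximation both become statements about Gram matrices. For the same reason the net is a
    maximal packing: the distances within a finite packing are witnessed at finitely many points.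
    The net depends on lambda only through the logarithm of the radius of the ball, so lambda may
    decay at any polynomial rate; the lower bound on b makes lambda gamma^(-d) at most gamma^(2
    alpha). The width gamma_n balances gamma^(2 alpha) against the entropy term gamma^(-rho) / n.
    Concentration is applied only to the net elements and to f0, so the good event is measurable
    although the SVM is not known to depend measurably on D. *)

Lemma le_of_eq d (T : porderType d) (x y : T) : x = y -> (x <= y)%O.
Proof. by move->. Qed.

Lemma eq0_of_scaled_bound (R : realFieldType) (x B : R) :
  (forall t, t * x <= B) -> x = 0.
Proof.
move=> h; apply/eqP; apply: contraT => x0.
have := h ((`|B| + 1) / x).
by rewrite divfK// leNgt ltr_pwDr// ler_norm.
Qed.

(* Testing the hypothesis on the kernel of K forces f into the range of K. *)
Lemma psd_range (R : realFieldType) n (K : 'M[R]_n) (f : 'rV[R]_n) (B : R) :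
  K^T = K ->
  (forall a : 'rV_n, 2 * (f *m a^T) 0 0 <= (a *m K *m a^T) 0 0 + B) ->
  exists2 a : 'rV_n, a *m K = f & (a *m K *m a^T) 0 0 <= B.
Proof.
move=> symK h.
have /submxP[a fa] : (f <= K)%MS.
  rewrite submxE; apply/eqP/rowP => j; rewrite [RHS]mxE.
  pose v := (col j (cokermx K))^T.
  have vK : v *m K = 0.
    by rewrite -[K]symK -trmx_mul colE mulmxA mulmx_coker mul0mx trmx0.
  have -> : (f *m cokermx K) 0 j = (f *m v^T) 0 0.
    by rewrite trmxK [RHS]mxE [LHS]mxE; apply: eq_bigr => i _; rewrite [in RHS]mxE.
  apply: (@eq0_of_scaled_bound _ _ (B / 2)) => t.
  have := h (t *: v); rewrite -!scalemxAl vK mul0mx scaler0.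
  rewrite linearZ/= -scalemxAr mxE [X in _ <= X + _]mxE add0r.
  by rewrite ler_pdivlMr// mulrC.
exists a => //; have := h a; rewrite fa.
by rewrite mulrDl mul1r lerD2l.
Qed.

(** For [K > 0] the choice [t = b / K] is optimal; for [K = 0] a linear function of [t] that is
    bounded above must vanish. *)
Lemma discriminant_le (R : realFieldType) (K F b : R) : 0 <= K ->
  (forall t, 2 * (t * b) <= t ^+ 2 * K + F) -> b ^+ 2 <= K * F.
Proof.
rewrite le_eqVlt => /predU1P[<-|K0] h.
  rewrite (@eq0_of_scaled_bound _ b (F / 2)) ?expr0n ?mul0r// => t.
  by have := h t; rewrite mulr0 add0r ler_pdivlMr// mulrC.
have := h (b / K); rewrite -(ler_pM2r K0).
have -> : 2 * (b / K * b) * K = 2 * b ^+ 2 by field; rewrite gt_eqF.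
have -> : ((b / K) ^+ 2 * K + F) * K = b ^+ 2 + K * F by field; rewrite gt_eqF.
by rewrite mulrDl mul1r lerD2l.
Qed.

Section rkhs_theory.
Context (R : realType) (T : Type) (X : set T) (k : T -> T -> R) (H : rkhs X k).
Implicit Types f g h : T -> R.

Definition kernel_comb N (x : 'I_N -> T) (a : 'I_N -> R) : T -> R :=
  fun y => \sum_i a i * (k (x i) \_ X) y.

Lemma rkhs_innerDr a f g h : rkhs_mem H f -> rkhs_mem H g -> rkhs_mem H h ->
  rkhs_inner H h (fun x => a * f x + g x) =
    a * rkhs_inner H h f + rkhs_inner H h g.
Proof.
move=> Hf Hg Hh; rewrite rkhs_innerC//; last exact: rkhs_linear.
by rewrite rkhs_innerDl// (rkhs_innerC Hf Hh) (rkhs_innerC Hg Hh).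
Qed.

Lemma rkhs_inner0r f : rkhs_mem H f -> rkhs_inner H f (cst 0) = 0.
Proof.
move=> Hf; have H0 := rkhs_zero H.
have := rkhs_innerDr 1 H0 H0 Hf.
rewrite (_ : (fun _ => _) = cst 0); last by apply/funext => y/=; rewrite mul1r addr0.
by rewrite mul1r; set u := rkhs_inner _ _ _ => /eqP; rewrite -subr_eq subrr => /eqP.
Qed.

Lemma kernel_comb_recl N (x : 'I_N.+1 -> T) (a : 'I_N.+1 -> R) :
  kernel_comb x a = fun y => a ord0 * (k (x ord0) \_ X) y +
    kernel_comb (x \o lift ord0) (a \o lift ord0) y.
Proof. by apply/funext => y; rewrite /kernel_comb big_ord_recl. Qed.

Lemma kernel_comb0 (x : 'I_0 -> T) (a : 'I_0 -> R) : kernel_comb x a = cst 0.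
Proof. by apply/funext => y; rewrite /kernel_comb big_ord0. Qed.

Lemma rkhs_mem_comb N (x : 'I_N -> T) (a : 'I_N -> R) :
  (forall i, X (x i)) -> rkhs_mem H (kernel_comb x a).
Proof.
elim: N x a => [|N IH] x a Xx; first by rewrite kernel_comb0; exact: rkhs_zero.
rewrite kernel_comb_recl; apply: rkhs_linear; first exact: rkhs_kernel.
by apply: IH => i; exact: Xx.
Qed.

Lemma rkhs_inner_comb N (x : 'I_N -> T) (a : 'I_N -> R) f :
  (forall i, X (x i)) -> rkhs_mem H f ->
  rkhs_inner H f (kernel_comb x a) = \sum_i a i * f (x i).
Proof.
elim: N x a => [|N IH] x a Xx Hf.
  by rewrite kernel_comb0 big_ord0 rkhs_inner0r.
rewrite kernel_comb_recl rkhs_innerDr//.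
- by rewrite rkhs_reproducing// big_ord_recl IH//= => i; exact: Xx.
- exact: rkhs_kernel.
- by apply: rkhs_mem_comb => i; exact: Xx.
Qed.

Lemma rkhs_comb_norm N (x : 'I_N -> T) (a : 'I_N -> R) :
  (forall i, X (x i)) ->
  rkhs_inner H (kernel_comb x a) (kernel_comb x a) =
  \sum_i \sum_j a i * a j * k (x j) (x i).
Proof.
move=> Xx; rewrite rkhs_inner_comb//; last exact: rkhs_mem_comb.
apply: eq_bigr => i _; rewrite /kernel_comb mulr_sumr; apply: eq_bigr => j _.
by rewrite patchE mem_set//= mulrA.
Qed.

Lemma rkhs_inner_le f g : rkhs_mem H f -> rkhs_mem H g ->
  2 * rkhs_inner H f g <= rkhs_inner H f f + rkhs_inner H g g.
Proof.
move=> Hf Hg; have := rkhs_inner_ge0 (rkhs_linear (-1) Hg Hf).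
rewrite rkhs_innerDl//; last exact: rkhs_linear.
rewrite !rkhs_innerDr// (rkhs_innerC Hg Hf).
by move=> h; rewrite -subr_ge0; apply: le_trans h _; apply: le_of_eq; ring.
Qed.

(** Young's inequality for [f] and the kernel combination that represents the functional. It is the
    converse of [rkhs_interpolation]: together they describe the values of an RKHS ball on finitely
    many points. *)
Lemma rkhs_eval_quad N (x : 'I_N -> T) (a : 'I_N -> R) f :
  (forall i, X (x i)) -> rkhs_mem H f ->
  2 * \sum_i a i * f (x i) <=
  \sum_i \sum_j a i * a j * k (x j) (x i) + rkhs_inner H f f.
Proof.
move=> Xx Hf; rewrite -rkhs_comb_norm// -rkhs_inner_comb// addrC.
by apply: rkhs_inner_le => //; exact: rkhs_mem_comb.
Qed.

Hypothesis kC : forall x y, k x y = k y x.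

Lemma gram_range N (x : 'I_N -> T) (v : 'I_N -> R) (B : R) :
  (forall a : 'I_N -> R, 2 * \sum_i a i * v i <=
    \sum_i \sum_j a i * a j * k (x i) (x j) + B) ->
  exists2 a : 'I_N -> R, (forall i, v i = \sum_j a j * k (x j) (x i)) &
    \sum_i \sum_j a i * a j * k (x i) (x j) <= B.
Proof.
move=> hv; pose K := \matrix_(i, j) k (x i) (x j).
have quadE (a : 'rV_N) : (a *m K *m a^T) 0 0 =
    \sum_i \sum_j a 0 i * a 0 j * k (x i) (x j).
  rewrite mxE exchange_big/=; apply: eq_bigr => j _; rewrite !mxE mulr_suml.
  by apply: eq_bigr => i _; rewrite !mxE mulrAC.
have [|a|a aK aB] := @psd_range R N K (\row_i v i) B.
- by apply/matrixP => i j; rewrite !mxE.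
- rewrite quadE; apply: le_trans (hv (a 0)); rewrite mxE.
  by apply/eqP_le || (apply: le_of_eq; congr (_ * _);
    apply: eq_bigr => i _; rewrite !mxE mulrC).
- exists (a 0) => [i|]; last by rewrite -quadE.
  move/rowP: aK => /(_ i); rewrite !mxE => <-.
  by apply: eq_bigr => j _; rewrite mxE.
Qed.

Lemma rkhs_interpolation N (x : 'I_N -> T) (v : 'I_N -> R) (B : R) :
  (forall i, X (x i)) ->
  (forall a : 'I_N -> R, 2 * \sum_i a i * v i <=
    \sum_i \sum_j a i * a j * k (x i) (x j) + B) ->
  exists g, [/\ rkhs_mem H g, forall i, g (x i) = v i & rkhs_inner H g g <= B].
Proof.
move=> Xx /gram_range[a va aB]; exists (kernel_comb x a); split.
- exact: rkhs_mem_comb.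
- move=> i; rewrite va /kernel_comb; apply: eq_bigr => j _.
  by rewrite patchE mem_set.
- rewrite rkhs_comb_norm//; apply: le_trans aB.
  by under eq_bigr do under eq_bigr do rewrite kC.
Qed.

(** Cauchy-Schwarz for [f] and the difference of the kernel sections at [x] and [y], whose squared
    norm is the first factor. It gives the Lipschitz bound behind the measurability of RKHS
    functions. *)
Lemma rkhs_eval_diff f x y : rkhs_mem H f -> X x -> X y ->
  (f x - f y) ^+ 2 <= (k x x - 2 * k x y + k y y) * rkhs_inner H f f.
Proof.
move=> Hf Xx Xy; set F := rkhs_inner H f f; set K := (k x x - _ + _).
have F0 : 0 <= F by exact: rkhs_inner_ge0.
have h t : 2 * (t * (f x - f y)) <= t ^+ 2 * K + F.
  pose p (i : 'I_2) := if i == ord0 then x else y.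
  pose a (i : 'I_2) := if i == ord0 then t else - t.
  have := @rkhs_eval_quad 2 p a f _ Hf; rewrite !big_ord_recl !big_ord0 /p /a/=.
  rewrite !addr0 (kC y x) => hh.
  have -> : t * (f x - f y) = t * f x + - t * f y by ring.
  apply: le_trans (hh _) _; first by move=> i; case: ifP.
  rewrite -/F lerD2r; apply: le_of_eq; rewrite /K; ring.
apply: discriminant_le => //.
pose p (i : 'I_2) := if i == ord0 then x else y.
have Xp i : X (p i) by rewrite /p; case: ifP.
pose a (i : 'I_2) : R := if i == ord0 then 1 else -1.
have := rkhs_inner_ge0 (rkhs_mem_comb a Xp).
rewrite rkhs_comb_norm// !big_ord_recl !big_ord0 /p /a/= (kC y x) => h2.
by apply: le_trans h2 _; apply: le_of_eq; rewrite /K; ring.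
Qed.

End rkhs_theory.

(** * Entropy of Gaussian RKHS balls *)

Section gaussian_features.
Context (R : realType).
Implicit Types (t q : R).

Definition texp m t : R := \sum_(i < m) t ^+ i / i`!%:R.

Lemma texp_cvg t : texp m t @[m --> \oo] --> expR t.
Proof.
have -> : (fun m => texp m t) = series (exp_coeff t).
  by apply/funext => m; rewrite /texp /series/= big_mkord.
exact: is_cvg_series_exp_coeff.
Qed.

Lemma texp_le m n t : 0 <= t -> (m <= n)%N -> texp m t <= texp n t.
Proof.
move=> t0 mn; rewrite /texp -(subnKC mn) big_split_ord/= lerDl.
by apply: sumr_ge0 => i _; rewrite divr_ge0// exprn_ge0.
Qed.

Lemma texp_le_expR m t : 0 <= t -> texp m t <= expR t.
Proof.
move=> t0; rewrite -(cvg_lim (@Rhausdorff R) (@texp_cvg t))//.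
apply: limr_ge; first by apply/cvg_ex; exists (expR t); exact: texp_cvg.
by near=> n; apply: texp_le => //; near: n; exact: nbhs_infty_ge.
Unshelve. all: by end_near. Qed.

Lemma expR_texp_le m t q : 0 <= t <= q -> q <= 2^-1 ->
  expR t - texp m t <= 2 * q ^+ m.
Proof.
move=> /andP[t0 tq] q2; have q0 := le_trans t0 tq.
rewrite lerBlDr -(cvg_lim (@Rhausdorff R) (@texp_cvg t))//.
apply: limr_le; first by apply/cvg_ex; exists (expR t); exact: texp_cvg.
near=> n; have mn : (m <= n)%N by near: n; exact: nbhs_infty_ge.
rewrite /texp -(subnKC mn) big_split_ord/= addrC lerD2r.
set k := (n - m)%N.
(* A geometric tail with the factorials dropped. The factor [1 - q ^+ k] leaves room for the next
   term, because 2 (q^k - q^(k+1)) >= q^k for q <= 1/2. *)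
have : \sum_(i < k) t ^+ (m + i) / (m + i)`!%:R <= 2 * q ^+ m * (1 - q ^+ k).
  elim: k => [|k IH]; first by rewrite big_ord0 expr0 subrr mulr0.
  rewrite big_ord_recr/=; apply: le_trans (lerD IH _) _.
    apply: (@le_trans _ _ (q ^+ (m + k))) => //.
    rewrite ler_pdivrMr ?ltr0n ?fact_gt0//; apply: (@le_trans _ _ (q ^+ (m + k))).
      by rewrite lerXn2r// nnegrE.
    by rewrite ler_peMr ?exprn_ge0// ler1n fact_gt0.
  rewrite exprD exprS; have : 0 <= q ^+ m * q ^+ k by rewrite mulr_ge0 ?exprn_ge0.
  set u := q ^+ m; set w := q ^+ k => uw.
  rewrite -subr_ge0.
  have -> : 2 * u * (1 - q * w) - (2 * u * (1 - w) + u * w) = u * w * (1 - 2 * q).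
    by ring.
  by rewrite mulr_ge0// subr_ge0 -ler_pdivlMl// mulr1.
move=> /le_trans; apply.
by rewrite ler_piMr ?mulr_ge0 ?exprn_ge0// lerBlDr lerDl exprn_ge0.
Unshelve. all: by end_near. Qed.

Variable d : nat.
Implicit Types (xi eta : 'I_d -> R) (deg : 'I_d -> nat).

Definition gauss xi eta : R := expR (- \sum_l (xi l - eta l) ^+ 2).

(** The Gaussian factors as exp(-|xi|^2) exp(-|eta|^2) prod_l exp(2 xi_l eta_l). Truncating each
    exponential at its own degree allows tangential and normal coordinates to be treated
    differently. *)
Definition trunc_gauss deg xi eta : R :=
  expR (- \sum_l xi l ^+ 2) * expR (- \sum_l eta l ^+ 2) *
  \prod_l texp (deg l) (2 * (xi l * eta l)).

(** The monomial of multi-index [nu] in the expansion of the product; the square root shares the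
    coefficient 2^j / j! evenly between the two arguments. *)
Definition gauss_feature M (nu : {ffun 'I_d -> 'I_M}) xi : R :=
  expR (- \sum_l xi l ^+ 2) *
  \prod_l (xi l ^+ nu l * Num.sqrt (2 ^+ nu l / (nu l)`!%:R)).

(** The ambient bound [M] makes the multi-indices a finite type and is common to boxes of different
    degrees, so that their sums can be compared. *)
Definition degree_box M deg : pred {ffun 'I_d -> 'I_M} :=
  family (fun l => [pred j : 'I_M | (j < deg l)%N]).
Arguments degree_box : clear implicits.

Lemma card_degree_box M deg : (forall l, deg l <= M)%N ->
  #|degree_box M deg| = (\prod_l deg l)%N.
Proof.
move=> degM; rewrite card_family foldrE big_map big_enum/=; apply: eq_bigr => l _.
have injw : injective (widen_ord (degM l)).
  by move=> i j /(congr1 val)/= ij; exact/val_inj.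
rewrite -[RHS]card_ord -(fintype.card_image injw).
apply: eq_card => j; apply/idP/fintype.imageP => [jl|[i _ ->]].
  by exists (Ordinal jl) => //; exact/val_inj.
exact: (ltn_ord i).
Qed.

Lemma trunc_gaussE deg M xi eta : (forall l, deg l <= M)%N ->
  trunc_gauss deg xi eta =
  \sum_(nu in degree_box M deg) gauss_feature nu xi * gauss_feature nu eta.
Proof.
move=> degM; rewrite /trunc_gauss.
have -> : \prod_l texp (deg l) (2 * (xi l * eta l)) =
    \prod_l \sum_(j in [pred j : 'I_M | (j < deg l)%N])
      (2 * (xi l * eta l)) ^+ j / j`!%:R.
  apply: eq_bigr => l _; rewrite /texp (big_ord_widen M (fun j => _ ^+ j / j`!%:R))//.
rewrite bigA_distr_big_dep/= mulr_sumr; apply: eq_big => [nu|nu _] //.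
rewrite /gauss_feature mulrACA; congr (_ * _).
rewrite -big_split/=; apply: eq_bigr => l _.
have c0 : 0 <= (2 ^+ nu l / (nu l)`!%:R : R) by rewrite divr_ge0// exprn_ge0.
by rewrite mulrACA -expr2 sqr_sqrtr// !exprMn; ring.
Qed.

Lemma gaussE xi eta : gauss xi eta =
  expR (- \sum_l xi l ^+ 2) * expR (- \sum_l eta l ^+ 2) *
  \prod_l expR (2 * (xi l * eta l)).
Proof.
rewrite -expR_sum -!expRD; congr expR; rewrite -!sumrN -!big_split/=.
by apply: eq_bigr => l _; ring.
Qed.

Lemma trunc_gauss_cvg xi eta :
  trunc_gauss (fun=> m) xi eta @[m --> \oo] --> gauss xi eta.
Proof.
rewrite gaussE; apply: cvgM; first exact: cvg_cst.
apply: cvg_big => [|l _]; last exact: texp_cvg.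
exact: mul_continuous.
Qed.

Lemma trunc_gauss_quadE N M deg (xi : 'I_N -> 'I_d -> R) (a : 'I_N -> R) :
  (forall l, deg l <= M)%N ->
  \sum_i \sum_j a i * a j * trunc_gauss deg (xi i) (xi j) =
  \sum_(nu in degree_box M deg) (\sum_i a i * gauss_feature nu (xi i)) ^+ 2.
Proof.
move=> degM; under eq_bigr do under eq_bigr do rewrite (trunc_gaussE _ _ degM) mulr_sumr.
under eq_bigr do rewrite exchange_big/=.
rewrite exchange_big/=; apply: eq_bigr => nu _.
rewrite expr2 mulr_suml; apply: eq_bigr => i _.
by rewrite mulr_sumr; apply: eq_bigr => j _; rewrite mulrACA.
Qed.

(** The form of the truncated kernel is a sum of squares over the degree box. Larger boxes only add
    squares, and the full kernel is the limit of growing cubes. *)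
Lemma gauss_remainder_psd N deg (xi : 'I_N -> 'I_d -> R) (a : 'I_N -> R) :
  \sum_i \sum_j a i * a j * trunc_gauss deg (xi i) (xi j) <=
  \sum_i \sum_j a i * a j * gauss (xi i) (xi j).
Proof.
pose u M := \sum_i \sum_j a i * a j * trunc_gauss (fun=> M) (xi i) (xi j).
have uc : u M @[M --> \oo] --> \sum_i \sum_j a i * a j * gauss (xi i) (xi j).
  apply: cvg_big => [|i _]; first exact: add_continuous.
  apply: cvg_big => [|j _]; first exact: add_continuous.
  by apply: cvgM; [exact: cvg_cst|exact: trunc_gauss_cvg].
rewrite -(cvg_lim (@Rhausdorff R) uc).
apply: limr_ge; first by apply/cvg_ex; eexists; exact: uc.
near=> M; have degM l : (deg l <= M)%N.
  apply: (@leq_trans (\max_l deg l)); first exact: leq_bigmax.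
  by near: M; exact: nbhs_infty_ge.
rewrite /u !(@trunc_gauss_quadE _ M)//.
rewrite [X in _ <= X](bigID (mem (degree_box M deg)))/=.
have boxT nu : nu \in degree_box M (fun=> M).
  by apply/familyP => l; rewrite inE.
have -> : \sum_(i in degree_box M deg) (\sum_j a j * gauss_feature i (xi j)) ^+ 2 =
  \sum_(i in degree_box M (fun=> M) | i \in degree_box M deg)
    (\sum_j a j * gauss_feature i (xi j)) ^+ 2.
  by apply: eq_bigl => nu; rewrite boxT.
by rewrite lerDl; apply: sumr_ge0 => i _; exact: sqr_ge0.
Unshelve. all: by end_near. Qed.

Lemma gauss_diag xi : gauss xi xi = 1.
Proof. by rewrite /gauss big1 ?oppr0 ?expR0// => l _; rewrite subrr expr0n. Qed.

Lemma one_minus_prod_le (F : 'I_d -> R) (r : seq 'I_d) :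
  (forall l, 0 <= F l <= 1) ->
  1 - \prod_(l <- r) F l <= \sum_(l <- r) (1 - F l).
Proof.
move=> F01; elim: r => [|l r IH]; first by rewrite !big_nil subrr.
rewrite !big_cons; have /andP[l0 l1] := F01 l.
have p1 : \prod_(j <- r) F j <= 1 by apply: prodr_ile1 => j _; exact: F01.
move: p1 IH; set p := \prod_(_ <- _) _; set t := \sum_(_ <- _) _; nra.
Qed.

(** On the diagonal the full kernel is 1 and the truncated one a product over coordinates, so the
    defect is at most the sum of the coordinate defects, each a damped Taylor remainder at 2
    xi_l^2. *)
Lemma trunc_gauss_diag_ge deg (q : 'I_d -> R) xi :
  (forall l, 2 * xi l ^+ 2 <= q l <= 2^-1) ->
  1 - trunc_gauss deg xi xi <= \sum_l 2 * q l ^+ deg l.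
Proof.
move=> xiq.
have -> : trunc_gauss deg xi xi =
    \prod_l (expR (- (2 * xi l ^+ 2)) * texp (deg l) (2 * xi l ^+ 2)).
  rewrite big_split/= /trunc_gauss -expR_sum -expRD; congr (_ * _).
  by congr expR; rewrite -!sumrN -big_split/=; apply: eq_bigr => l _; ring.
have t0 l : 0 <= 2 * xi l ^+ 2 by rewrite mulr_ge0// sqr_ge0.
have texp0 l : 0 <= texp (deg l) (2 * xi l ^+ 2).
  by apply: sumr_ge0 => i _; rewrite divr_ge0// exprn_ge0.
apply: le_trans (one_minus_prod_le _ _) _ => [l|].
  rewrite mulr_ge0 ?expR_ge0//= expRN mulrC ler_pdivrMr ?expR_gt0// mul1r.
  exact: texp_le_expR.
apply: ler_sum => l _; have /andP[xq q2] := xiq l.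
have tq : 0 <= 2 * xi l ^+ 2 <= q l by rewrite t0.
apply: le_trans (expR_texp_le (deg l) tq q2).
set t := 2 * xi l ^+ 2.
have -> : 1 - expR (- t) * texp (deg l) t =
    expR (- t) * (expR t - texp (deg l) t).
  by rewrite mulrBr -expRD addNr expR0.
rewrite ler_piMl// ?subr_ge0 ?texp_le_expR ?t0 //.
by rewrite expR_le1 oppr_le0 t0.
Qed.

(** [gauss_remainder_psd] at a single point: the squares of the features add up to at most the
    diagonal value 1. *)
Lemma gauss_feature_le1 M deg nu xi : (forall l, deg l <= M)%N ->
  nu \in degree_box M deg -> `|gauss_feature nu xi| <= 1.
Proof.
move=> degM nuV; have := @gauss_remainder_psd 1 deg (fun=> xi) (fun=> 1).
rewrite (@trunc_gauss_quadE _ M)// !big_ord_recl !big_ord0 !addr0 gauss_diag !mulr1.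
move=> h; rewrite -(ler_pXn2r (_ : 0 < 2)%N) ?nnegrE// expr1n real_normK ?num_real//.
apply: le_trans h; rewrite (bigD1 nu)//= big_ord_recl big_ord0 addr0 mul1r lerDl.
by apply: sumr_ge0 => i _; exact: sqr_ge0.
Qed.

(* The Gram matrix splits into a finite-rank part and a PSD remainder E; with
   v = K a one has v - Phi b = E a for b = Phi^T a, and Cauchy-Schwarz for E
   bounds the error by the diagonal of E. *)
Lemma gauss_finite_rank N M deg (q : 'I_d -> R) (xi : 'I_N -> 'I_d -> R)
    (v : 'I_N -> R) (B : R) :
  (forall l, deg l <= M)%N ->
  (forall i l, 2 * xi i l ^+ 2 <= q l <= 2^-1) ->
  (forall a : 'I_N -> R, 2 * \sum_i a i * v i <=
    \sum_i \sum_j a i * a j * gauss (xi i) (xi j) + B) ->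
  exists b : {ffun 'I_d -> 'I_M} -> R,
    (forall nu, nu \in degree_box M deg -> b nu ^+ 2 <= B) /\
    forall i, (v i - \sum_(nu in degree_box M deg)
                b nu * gauss_feature nu (xi i)) ^+ 2
              <= (\sum_l 2 * q l ^+ deg l) * B.
Proof.
move=> degM xiq hv.
have gaussC x y : gauss x y = gauss y x.
  by rewrite /gauss; congr (expR (- _)); apply: eq_bigr => l _; ring.
pose k i j := gauss (xi i) (xi j).
have [a va aB] := @gram_range R 'I_N k (fun i j => gaussC (xi i) (xi j)) N id v B hv.
pose b (nu : {ffun 'I_d -> 'I_M}) := \sum_i a i * gauss_feature nu (xi i).
pose tr i j := trunc_gauss deg (xi i) (xi j).
have trC i j : tr i j = tr j i.
  by rewrite /tr !(trunc_gaussE _ _ degM); apply: eq_bigr => nu _; rewrite mulrC.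
pose E i j := k i j - tr i j.
have EC i j : E i j = E j i by rewrite /E trC /k gaussC.
have trq (c : 'I_N -> R) : \sum_i \sum_j c i * c j * tr i j =
    \sum_(nu in degree_box M deg) (\sum_i c i * gauss_feature nu (xi i)) ^+ 2.
  exact: trunc_gauss_quadE.
have Eq (c : 'I_N -> R) : \sum_i \sum_j c i * c j * E i j =
    \sum_i \sum_j c i * c j * k i j - \sum_i \sum_j c i * c j * tr i j.
  rewrite -sumrB; apply: eq_bigr => i _; rewrite -sumrB; apply: eq_bigr => j _.
  by rewrite mulrBr.
have E0 c : 0 <= \sum_i \sum_j c i * c j * E i j.
  by rewrite Eq subr_ge0; exact: gauss_remainder_psd.
exists b; split=> [nu nuV|i].
  have := le_trans (gauss_remainder_psd deg xi a) aB.
  rewrite (@trunc_gauss_quadE _ M)// (bigD1 nu)//= => /(le_trans _); apply.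
  by rewrite lerDl; apply: sumr_ge0 => j _; exact: sqr_ge0.
have -> : v i - \sum_(nu in degree_box M deg) b nu * gauss_feature nu (xi i) =
    \sum_j a j * E j i.
  rewrite va /E; under [RHS]eq_bigr do rewrite mulrBr.
  rewrite sumrB; congr (_ - _).
  under [RHS]eq_bigr do rewrite /tr (trunc_gaussE _ _ degM) mulr_sumr.
  rewrite exchange_big/=; apply: eq_bigr => nu _; rewrite /b mulr_suml.
  by apply: eq_bigr => j _; rewrite -mulrA.
have Ei : 0 <= E i i <= \sum_l 2 * q l ^+ deg l.
  rewrite /E /k gauss_diag subr_ge0 trunc_gauss_diag_ge ?andbT//.
  have := @gauss_remainder_psd 1 deg (fun=> xi i) (fun=> 1).
  by rewrite !big_ord_recl !big_ord0 !addr0 gauss_diag !mulr1 !mul1r.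
have /andP[Ei0 Eile] := Ei.
have aEa : \sum_i \sum_j a i * a j * E i j <= B.
  rewrite Eq; apply: le_trans aB; rewrite lerBlDr lerDl trq.
  by apply: sumr_ge0 => nu _; exact: sqr_ge0.
have B0 : 0 <= B := le_trans (E0 a) aEa.
apply: (@le_trans _ _ (E i i * B)); last by rewrite ler_wpM2r.
apply: discriminant_le => // t.
(* The form at [a] minus [t] times the i-th unit vector is the quadratic polynomial in [t] that
   Cauchy-Schwarz needs. *)
have := E0 (fun j => a j - t * (j == i)%:R).
have -> : \sum_j \sum_j0 (a j - t * (j == i)%:R) * (a j0 - t * (j0 == i)%:R) * E j j0
   = \sum_i \sum_j a i * a j * E i j - 2 * (t * \sum_j a j * E j i) + t ^+ 2 * E i i.
  have -> : \sum_j \sum_j0 (a j - t * (j == i)%:R) * (a j0 - t * (j0 == i)%:R) * E j j0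
    = \sum_j (\sum_j0 a j * a j0 * E j j0 - t * (a j * E j i)
        - (j == i)%:R * (t * \sum_j0 a j0 * E j j0) + (j == i)%:R * (t ^+ 2 * E j i)).
    apply: eq_bigr => j _.
    have sel (F : 'I_N -> R) : \sum_j0 (j0 == i)%:R * F j0 = F i.
      rewrite (bigD1 i)//= eqxx mul1r big1 ?addr0// => l /negbTE ->.
      by rewrite mul0r.
    have -> : a j * E j i = \sum_j0 (j0 == i)%:R * (a j * E j j0) by rewrite sel.
    have -> : E j i = \sum_j0 (j0 == i)%:R * E j j0 by rewrite sel.
    rewrite !mulr_sumr -!sumrB -big_split/=.
    by apply: eq_bigr => l _; ring.
  have sel (F : 'I_N -> R) : \sum_j0 (j0 == i)%:R * F j0 = F i.
    rewrite (bigD1 i)//= eqxx mul1r big1 ?addr0// => l /negbTE ->.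
    by rewrite mul0r.
  rewrite big_split/= !sumrB !sel -mulr_sumr.
  have -> : \sum_j a j * E i j = \sum_j a j * E j i.
    by apply: eq_bigr => j _; rewrite EC.
  ring.
move=> h; rewrite -subr_ge0; apply: (le_trans h).
rewrite -subr_ge0; have := aEa; rewrite -subr_ge0 => /le_trans; apply.
by apply: le_of_eq; ring.
Qed.

End gaussian_features.
Arguments degree_box {d} M deg.

(** A separated family of maximal size is a net. Bounding separated families is easier than building
    a net, since a separated family is finite and its separation can be tested at finitely many
    points. *)
Lemma maximal_packing (T : Type) (F : set T) (far : T -> T -> Prop) (K : nat) :
  (forall x y, far x y -> far y x) ->
  (forall N (f : 'I_N -> T), (forall i, F (f i)) ->
    (forall i j, i != j -> far (f i) (f j)) -> (N <= K)%N) ->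
  exists N (f : 'I_N -> T), [/\ (N <= K)%N, forall i, F (f i) &
    forall g, F g -> exists i, ~ far g (f i)].
Proof.
move=> farC bound.
pose pack N := `[< exists f : 'I_N -> T, (forall i, F (f i)) /\
    (forall i j, i != j -> far (f i) (f j)) >].
have pack0 : exists N, pack N.
  exists 0%N; apply/asboolP; exists (fun i : 'I_0 => False_rect T (notF (valP i))).
  by split=> [[]|[]].
have packK N : pack N -> (N <= K)%N.
  by move=> /asboolP[f [Ff fd]]; exact: (bound N f).
case: (ex_maxnP pack0 packK) => N /asboolP[f [Ff fd]] Nmax.
exists N, f; split=> //; first exact: (bound N f).
move=> g Fg; apply: contrapT => /forallNP ng.
have {}ng i : far g (f i) by apply: contrapT => /ng.
suff /Nmax : pack N.+1 by rewrite ltnn.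
apply/asboolP; exists (fun i => oapp f g (unlift ord_max i)); split.
  by move=> i; case: unliftP => [j|] _ /=.
move=> i j; case: unliftP => [i' ->|->]; case: unliftP => [j' ->|->]/= ij.
- by apply: fd; apply: contra_neq ij => ->.
- by apply: farC; exact: ng.
- exact: ng.
- by rewrite eqxx in ij.
Qed.

(** * Euclidean norms and the Gaussian kernel in rotated coordinates *)

Section euclid.
Context (R : realType) (d : nat).
Implicit Types (x y c : 'rV[R]_d) (O : 'M[R]_d).

Lemma enorm_ge0 x : 0 <= enorm x.
Proof. exact: sqrtr_ge0. Qed.

Lemma enorm_sqr x : enorm x ^+ 2 = \sum_i x ord0 i ^+ 2.
Proof. by rewrite sqr_sqrtr// sumr_ge0// => i _; exact: sqr_ge0. Qed.

Definition dotv x y : R := (x *m y^T) 0 0.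

Lemma dotvE x y : dotv x y = \sum_i x 0 i * y 0 i.
Proof. by rewrite /dotv mxE; apply: eq_bigr => i _; rewrite mxE. Qed.

Lemma enorm_dotv x : enorm x ^+ 2 = dotv x x.
Proof. by rewrite enorm_sqr dotvE; apply: eq_bigr => i _; rewrite expr2. Qed.

Lemma enorm_orthogonal O x : O *m O^T = 1%:M ->
  \sum_l (x *m O^T) 0 l ^+ 2 = enorm x ^+ 2.
Proof.
move=> OO; have OtO : O^T *m O = 1%:M by apply: mulmx1C.
transitivity (enorm (x *m O^T) ^+ 2); first by rewrite enorm_sqr.
by rewrite !enorm_dotv /dotv trmx_mul trmxK mulmxA -(mulmxA x) OtO mulmx1.
Qed.

Definition local_coord gamma c O x : 'I_d -> R :=
  fun l => ((x - c) *m O^T) 0 l / gamma.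

Lemma gaussian_kernelE gamma c O x y : 0 < gamma -> O *m O^T = 1%:M ->
  gaussian_kernel gamma x y =
  gauss (local_coord gamma c O x) (local_coord gamma c O y).
Proof.
move=> g0 OO; rewrite /gaussian_kernel /gauss -(enorm_orthogonal _ OO).
congr expR; rewrite mulNr; congr (- _); rewrite mulr_sumr; apply: eq_bigr => l _.
rewrite /local_coord -mulrBl expr_div_n mulrC; congr (_ ^+ 2 / _).
have -> : x - y = (x - c) - (y - c) by rewrite opprB addrA subrK.
by rewrite [in LHS]mulmxBl !mxE.
Qed.

Lemma gaussian_kernelC gamma x y :
  gaussian_kernel gamma x y = gaussian_kernel gamma y x.
Proof.
rewrite /gaussian_kernel !enorm_sqr; congr (expR (_ * _)).
by apply: eq_bigr => i _; rewrite !mxE; ring.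
Qed.

Lemma gaussian_kernel_diag gamma x : gaussian_kernel gamma x x = 1.
Proof.
rewrite /gaussian_kernel enorm_sqr big1 ?mulr0 ?expR0// => i _.
by rewrite !mxE subrr expr0n.
Qed.

End euclid.

(** * Uniform nets of RKHS balls over unions of flat pieces *)

Section net.
Context (R : realType) (d : nat) (gamma : R) (X : set 'rV[R]_d).
Variable H : rkhs X (@gaussian_kernel R d gamma).
Hypothesis gamma0 : 0 < gamma.
Variables (deg : 'I_d -> nat) (M : nat) (q : 'I_d -> R) (B : R).
Hypothesis degM : forall l, (deg l <= M)%N.

(** [q l] bounds the argument of the l-th exponential series on the piece; a small value means that
    the piece is thin, relative to [gamma], in the l-th direction. *)
Definition flat_piece c (O : 'M[R]_d) (A : set 'rV[R]_d) :=
  O *m O^T = 1%:M /\ forall x, A x ->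
    forall l, 2 * local_coord gamma c O x l ^+ 2 <= q l <= 2^-1.

(** Stated for a finite list of points because the coefficients [b] are extracted from the Gram
    matrix of that list. *)
Lemma rkhs_local_rank c O A (s : seq 'rV[R]_d) f :
  flat_piece c O A -> rkhs_mem H f -> rkhs_inner H f f <= B ->
  (forall x, x \in s -> X x /\ A x) ->
  exists b : {ffun 'I_d -> 'I_M} -> R,
    (forall nu, nu \in degree_box M deg -> b nu ^+ 2 <= B) /\
    forall x, x \in s -> (f x - \sum_(nu in degree_box M deg)
                b nu * gauss_feature nu (local_coord gamma c O x)) ^+ 2
              <= (\sum_l 2 * q l ^+ deg l) * B.
Proof.
move=> [OO Aq] Hf fB sXA.
pose x (i : 'I_(size s)) := nth 0 s i.
have xs i : x i \in s by rewrite mem_nth.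
have [|a|b [bB hb]] := @gauss_finite_rank R d _ M deg q
    (fun i => local_coord gamma c O (x i)) (fun i => f (x i)) B degM.
- by move=> i l; apply: Aq; exact: (sXA _ (xs i)).2.
- apply: le_trans (rkhs_eval_quad a (fun i => (sXA _ (xs i)).1) Hf) _.
  apply: lerD fB; apply: le_of_eq; apply: eq_bigr => i _; apply: eq_bigr => j _.
  by rewrite gaussian_kernelC (gaussian_kernelE c _ _ gamma0 OO).
exists b; split=> // y ys.
have ysz : (index y s < size s)%N by rewrite index_mem.
have := hb (Ordinal ysz).
by rewrite /x/= nth_index.
Qed.

Variables (m : nat) (c : 'I_m -> 'rV[R]_d) (O : 'I_m -> 'M[R]_d).
Variables (A : 'I_m -> set 'rV[R]_d) (S : set 'rV[R]_d).
Hypothesis pieceA : forall r, flat_piece (c r) (O r) (A r).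
Hypothesis SA : S `<=` \bigcup_r A r.
Hypothesis SX : S `<=` X.
Variables (L : nat) (eta delta eps : R).
Hypothesis eta0 : 0 < eta.
Hypothesis delta0 : 0 <= delta.
Hypothesis deltaP : (\sum_l 2 * q l ^+ deg l) * B <= delta ^+ 2.
Hypothesis BL : B <= (eta * L%:R) ^+ 2.
Hypothesis epsP : 2 * delta + (\prod_l deg l)%:R * eta <= eps.

Let ball := [set f | rkhs_mem H f /\ rkhs_inner H f f <= B].
Let far (f g : 'rV[R]_d -> R) := exists2 x, S x & eps < `|f x - g x|.

(** The grid cell of mesh [eta] containing [b]. By [BL] the floor lies between [- L] and [L] for the
    coefficients that occur, and the shift by [L] makes it a natural number. *)
Let quant (b : R) : 'I_(2 * L).+1 := inord `|(Num.floor (b / eta) + L%:Z)%R|%N.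

Let quant_inj b b' : b ^+ 2 <= B -> b' ^+ 2 <= B ->
  quant b = quant b' -> `|b - b'| <= eta.
Proof.
have floorL u : u ^+ 2 <= B -> (- L%:Z <= Num.floor (u / eta) <= L%:Z)%R.
  move=> /le_trans/(_ BL).
  rewrite -[u ^+ 2]real_normK ?num_real// ler_pXn2r// ?nnegrE ?mulr_ge0 ?(ltW eta0)//.
  rewrite ler_norml mulrC -mulNr => /andP[uL Lu].
  rewrite floor_ge_int rmorphN/= ler_pdivlMr// uL/=.
  rewrite -(@ler_int R); apply: le_trans (ge_floor _) _.
  by rewrite ler_pdivrMr.
move=> /floorL bL /floorL b'L /(congr1 (@nat_of_ord _)).
rewrite /quant => e.
have {}e : Num.floor (b / eta) = Num.floor (b' / eta).
  move: bL b'L e; move: (Num.floor _) (Num.floor _) => z z'; clear => zL z'L.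
  by rewrite !inordK; lia.
have := floor_itv (b / eta); have := floor_itv (b' / eta); rewrite e.
set z := (_%:~R : R); rewrite intrD -/z => /andP[z1 z2] /andP[z3 z4].
have e0 : eta != 0 by rewrite gt_eqF.
have -> : b - b' = (b / eta - b' / eta) * eta by field.
by rewrite normrM (gtr0_norm eta0) ler_piMl ?(ltW eta0)// ler_norml; lra.
Qed.

(** On the points that witness a separated family, each member is within [delta] of a finite-rank
    function on every piece. If two members have the same quantised coefficients, the finite-rank
    functions differ by at most the rank times [eta], since the features are bounded by 1; by [epsP]
    the members are then not separated. Hence the family is no larger than the set of quantised
    coefficient arrays. *)
Lemma rkhs_net : exists N (f : 'I_N -> 'rV[R]_d -> R),
  [/\ (N <= (2 * L).+1 ^ (m * \prod_l deg l))%N,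
      forall i, rkhs_mem H (f i) /\ rkhs_inner H (f i) (f i) <= B &
      forall g, rkhs_mem H g -> rkhs_inner H g g <= B ->
        exists i, forall x, S x -> `|g x - f i x| <= eps].
Proof.
have [|N f Ff ffar|N [f [NK Ff fnet]]] := @maximal_packing _ ball far
    ((2 * L).+1 ^ (m * \prod_l deg l)).
- by move=> f g [x Sx fg]; exists x => //; rewrite distrC.
(* One witness of separation for each pair of distinct members; only these points matter below. *)
- pose xx ij := xget 0 [set x | S x /\ eps < `|f ij.1 x - f ij.2 x|].
  have xxP i j : i != j -> S (xx (i, j)) /\ eps < `|f i (xx (i, j)) - f j (xx (i, j))|.
    move=> /ffar[x Sx fx]; rewrite /xx; case: xgetP => [y _ //|/(_ x)].
    by case.
  pose s r := [seq xx ij | ij <- enum {: 'I_N * 'I_N} &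
                 (ij.1 != ij.2) && `[< A r (xx ij) >]].
  have sXA r x : x \in s r -> X x /\ A r x.
    move=> /mapP[[i j]]; rewrite mem_filter => /andP[/andP[ij /asboolP Ax] _] ->.
    by split=> //; apply: SX; exact: (xxP _ _ ij).1.
  have /choice[b bP] (ir : 'I_N * 'I_m) : exists b : {ffun 'I_d -> 'I_M} -> R,
      (forall nu, nu \in degree_box M deg -> b nu ^+ 2 <= B) /\
      forall x, x \in s ir.2 -> (f ir.1 x - \sum_(nu in degree_box M deg)
        b nu * gauss_feature nu (local_coord gamma (c ir.2) (O ir.2) x)) ^+ 2
              <= delta ^+ 2.
    have [Hf fB] := Ff ir.1.
    have [b [bB bf]] := rkhs_local_rank (pieceA ir.2) Hf fB (sXA ir.2).
    by exists b; split=> // x /bf/le_trans; apply.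
  pose cell i : {ffun 'I_m * 'I_#|degree_box M deg| -> 'I_(2 * L).+1} :=
    [ffun rn => quant (b (i, rn.1) (enum_val rn.2))].
  have cell_inj : injective cell.
    move=> i j cij; apply/eqP/negPn/negP => ij.
    have [Sx fx] := xxP _ _ ij; set x := xx (i, j) in Sx fx.
    have [r _ Arx] := SA Sx.
    have xs : x \in s r.
      apply/mapP; exists (i, j) => //; rewrite mem_filter/= ij/= mem_enum andbT.
      exact/asboolP.
    have [bi fi] := bP (i, r); have [bj fj] := bP (j, r).
    have := fi _ xs; have := fj _ xs => /=.
    set P := fun i : 'I_N => \sum_(nu in degree_box M deg) b (i, r) nu *
      gauss_feature nu (local_coord gamma (c r) (O r) x).
    have absd u : u ^+ 2 <= delta ^+ 2 -> `|u| <= delta.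
      by move=> h; rewrite -(ler_pXn2r (_ : 0 < 2)%N)// ?nnegrE// real_normK// num_real.
    rewrite -/(P j) -/(P i) => /absd fj' /absd fi'.
    have PP : `|P i - P j| <= (\prod_l deg l)%:R * eta.
      rewrite /P -sumrB; apply: le_trans (ler_norm_sum _ _ _) _.
      apply: (@le_trans _ _ (\sum_(nu in degree_box M deg) eta)).
        apply: ler_sum => nu nuV; rewrite -mulrBl normrM.
        apply: (@le_trans _ _ (eta * 1)); last by rewrite mulr1.
        apply: ler_pM => //; last exact: gauss_feature_le1 degM nuV.
        apply: quant_inj; [exact: bi|exact: bj|].
        move/ffunP: cij => /(_ (r, enum_rank_in nuV nu)).
        by rewrite !ffunE/= enum_rankK_in.
      by rewrite sumr_const (card_degree_box degM) mulr_natl.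
    move: fx; rewrite ltNge => /negP; apply.
    have -> : f i x - f j x = (f i x - P i) - (f j x - P j) + (P i - P j) by ring.
    apply: le_trans epsP; rewrite mulr_natl mulr2n.
    apply: le_trans (ler_normD _ _) (lerD _ PP).
    by apply: le_trans (ler_normB _ _) (lerD _ _).
  have := leq_card cell cell_inj.
  by rewrite card_ffun card_prod !card_ord (card_degree_box degM).
- exists N, f; split=> // g Hg gB.
  have [|i nfar] := fnet g; first by split.
  exists i => x Sx; rewrite leNgt; apply/negP => h; apply: nfar.
  by exists x.
Qed.

End net.

(** * Product measures and concentration *)

Section product_power_theory.
Context d (T : measurableType d) (R : realType).
Variable mu : {sigma_finite_measure set T -> \bar R}.
Local Open Scope ereal_scope.

Lemma ge0_integral_product_powerS n (F : n.+1.-tuple T -> \bar R) :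
  measurable_fun [set: n.+1.-tuple T] F -> (forall t, 0 <= F t) ->
  \int[product_power mu n.+1]_t F t =
  \int[mu]_x \int[product_power mu n]_t F [tuple of x :: t].
Proof.
move=> mF F0.
pose tc (z : T * n.-tuple T) : n.+1.-tuple T := [tuple of z.1 :: z.2].
have mtc : measurable_fun setT tc by exact: measurable_cons.
pose tcf := HB.pack_for {mfun _ >-> _} tc (isMeasurableFun.Build _ _ _ _ tc mtc).
rewrite (_ : \int[_]_t F t = \int[pushforward (mu \x product_power mu n) tcf]_t F t);
  last exact: eq_measure_integral.
rewrite ge0_integral_pushforward//= preimage_setT.
rewrite fubini_tonelli1//.
by apply: measurableT_comp.
Qed.

Lemma ge0_integral_product_power0 (F : 0.-tuple T -> \bar R) :
  \int[product_power mu 0]_t F t = F [tuple].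
Proof.
rewrite /= (_ : F = cst (F [tuple])) ?integral_cst//= ?diracT ?mule1//.
by apply/funext => t /=; rewrite tuple0.
Qed.

Lemma measurable_prod_tnth n (phi : 'I_n -> T -> R) :
  (forall i, measurable_fun setT (phi i)) ->
  measurable_fun [set: n.-tuple T] (fun t => \prod_i phi i (tnth t i))%R.
Proof.
move=> mphi; apply: (@measurable_prod _ _ _ _ _ _ (fun i (t : n.-tuple T) => phi i (tnth t i))) => i _.
by apply: measurableT_comp => //; exact: measurable_tnth.
Qed.

(** Independence of the coordinates. Being valid for sigma-finite [mu], it serves both for samples
    and for Gaussian densities on R^d. *)
Lemma ge0_integral_prod_tnth n (phi : 'I_n -> T -> R) :
  (forall i, measurable_fun setT (phi i)) -> (forall i x, (0 <= phi i x)%R) ->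
  \int[product_power mu n]_t (\prod_i phi i (tnth t i))%:E =
  \prod_i \int[mu]_x (phi i x)%:E.
Proof.
elim: n phi => [|n IH] phi mphi phi0.
  by rewrite ge0_integral_product_power0 !big_ord0.
rewrite ge0_integral_product_powerS; last 2 first.
- by apply/measurable_EFinP; exact: measurable_prod_tnth.
- by move=> t; rewrite lee_fin prodr_ge0.
rewrite big_ord_recl.
under eq_integral => x _.
  under eq_integral => t _.
    rewrite big_ord_recl tnth0.
    under eq_bigr do rewrite tnthS.
    rewrite EFinM; over.
  rewrite ge0_integralZl ?lee_fin//; last 2 first.
  - by apply/measurable_EFinP; exact: (measurable_prod_tnth (fun i => mphi (lift ord0 i))).
  - by move=> t _; rewrite lee_fin prodr_ge0.
  rewrite (IH (fun i => phi (lift ord0 i)))//; over.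
rewrite /= ge0_integralZr//.
- by apply/measurable_EFinP.
- by move=> x _; rewrite lee_fin.
- by apply: prode_ge0 => i _; apply: integral_ge0 => x _; rewrite lee_fin.
Qed.

End product_power_theory.

Section product_power_probability.
Context d (T : measurableType d) (R : realType) (P : probability T R).
Local Open Scope ereal_scope.

Lemma measurable_forall_tnth n (A : set T) : measurable A ->
  measurable [set t : n.-tuple T | forall i, A (tnth t i)].
Proof.
move=> mA; rewrite (_ : mkset _ = \bigcap_(i in [set: 'I_n]) ((@tnth n T)^~ i @^-1` A)).
  apply: fin_bigcap_measurable => // i _.
  by rewrite -[X in measurable X]setTI; exact: measurable_tnth.
by apply/seteqP; split=> [t tA i _|t tA i]; exact: tA.
Qed.

Lemma product_power_forall n (A : set T) : measurable A -> P A = 1 ->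
  product_power P n [set t : n.-tuple T | forall i, A (tnth t i)] = 1.
Proof.
move=> mA PA; have mB := (@measurable_forall_tnth n _ mA); set B := mkset _ in mB *.
have := ge0_integral_prod_tnth P (phi := fun (i : 'I_n) => \1_A : T -> R) => /(_ _ _).
have -> : (fun t : n.-tuple T => (\prod_i (\1_A : T -> R) (tnth t i))%:E) = EFin \o \1_B.
  apply/funext => t /=; congr EFin; rewrite indicE.
  have [tB|tB] := boolP (t \in B).
    by rewrite big1// => i _; rewrite indicE mem_set//; move: tB; rewrite inE; exact.
  have [i nAi] : exists i, ~ A (tnth t i).
    by apply/existsNP => h; move/negP: tB; apply; rewrite inE.
  by apply/eqP/prodf_eq0; exists i => //; rewrite indicE memNset.
rewrite integral_indic// setIT => -> //.
- by rewrite big1// => i _; rewrite integral_indic// setIT.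
Qed.

Lemma exponential_markov n (h : T -> R) (theta c tau : R) :
  measurable_fun setT h ->
  \int[P]_x (expR (theta * h x))%:E <= (expR c)%:E ->
  product_power P n [set t : n.-tuple T |
    (tau <= theta * \sum_i h (tnth t i) - n%:R * c)%R] <= (expR (- tau))%:E.
Proof.
move=> mh hc.
pose phi (i : 'I_n) x := expR (theta * h x - c).
have mphi i : measurable_fun setT (phi i).
  apply: measurableT_comp => //; apply: measurable_funB => //.
  exact: measurable_funM.
have mprod := measurable_prod_tnth mphi.
have mset : measurable [set t : n.-tuple T |
    (tau <= theta * \sum_i h (tnth t i) - n%:R * c)%R].
  rewrite -[X in measurable X]setTI.
  apply: measurable_fun_le => //.
  apply: measurable_funB => //; apply: measurable_funM => //.
  apply: (@measurable_sum _ _ _ _ _ _ (fun i (t : n.-tuple T) => h (tnth t i))) => i.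
  by apply: measurableT_comp => //; exact: measurable_tnth.
have -> : product_power P n [set t : n.-tuple T |
    (tau <= theta * \sum_i h (tnth t i) - n%:R * c)%R] =
  \int[product_power P n]_t (\1_[set t : n.-tuple T |
    (tau <= theta * \sum_i h (tnth t i) - n%:R * c)%R] t)%:E.
  by rewrite integral_indic// setIT.
apply: (@le_trans _ _ (\int[product_power P n]_t
    ((expR (- tau))%:E * (\prod_i phi i (tnth t i))%:E))).
  apply: ge0_le_integral => //.
  - by apply/measurable_EFinP; exact: measurable_indic.
  - by apply: measurable_funeM; exact/measurable_EFinP.
  move=> t _; rewrite -EFinM lee_fin indicE.
  rewrite /phi -expR_sum -expRD sumrB -mulr_sumr sumr_const card_ord -(mulr_natl c).
  case: (boolP (t \in _)) => [|_]; last by rewrite expR_ge0.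
  rewrite inE/= => ht; have -> : true%:R = expR 0 :> R by rewrite expR0.
  by rewrite ler_expR addrC subr_ge0.
rewrite ge0_integralZl//; last 2 first.
- exact/measurable_EFinP.
- by move=> t _; rewrite lee_fin prodr_ge0// => i _; exact: expR_ge0.
rewrite ge0_integral_prod_tnth//; last by move=> i x; exact: expR_ge0.
have le1 : \int[P]_x (expR (theta * h x - c))%:E <= 1.
  under eq_integral do rewrite expRD EFinM.
  rewrite ge0_integralZr//.
  - apply: (@le_trans _ _ ((expR c)%:E * (expR (- c))%:E)).
      by apply: lee_wpmul2r => //; rewrite lee_fin expR_ge0.
    by rewrite -EFinM -expRD subrr expR0.
  - by apply/measurable_EFinP; apply: measurableT_comp => //; exact: measurable_funM.
have : 0 <= \prod_(i < n) \int[P]_x (phi i x)%:E <= 1.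
  apply: (@big_ind _ (fun x : \bar R => is_true (0 <= x <= 1))) 
    => [|x y /andP[x0 x1] /andP[y0 y1]|i _]; first by rewrite lee01 lexx.
    by rewrite mule_ge0//= -(mule1 1) lee_pmul.
  by rewrite integral_ge0//= => x _; rewrite lee_fin expR_ge0.
case/andP => p0 p1; rewrite -[leRHS]mule1.
by apply: lee_wpmul2l => //; rewrite lee_fin expR_ge0.
Qed.

End product_power_probability.

(** * Bounded random variables and Bernstein-type deviations *)

Section bounded_expectation.
Context d (T : measurableType d) (R : realType) (P : probability T R).
Implicit Types (f g h : T -> R).

Definition bounded_meas f := measurable_fun setT f /\ exists K, forall x, `|f x| <= K.

Lemma bounded_meas_cst (c : R) : bounded_meas (cst c).
Proof. by split; [exact: measurable_cst|exists `|c|]. Qed.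

Lemma bounded_measD f g : bounded_meas f -> bounded_meas g ->
  bounded_meas (fun x => f x + g x).
Proof.
move=> [mf [K fK]] [mg [L gL]]; split; first exact: measurable_funD.
by exists (K + L) => x; apply: le_trans (ler_normD _ _) (lerD _ _).
Qed.

Lemma bounded_measM f g : bounded_meas f -> bounded_meas g ->
  bounded_meas (fun x => f x * g x).
Proof.
move=> [mf [K fK]] [mg [L gL]]; split; first exact: measurable_funM.
by exists (K * L) => x; rewrite normrM ler_pM.
Qed.

Lemma bounded_measZ (c : R) f : bounded_meas f -> bounded_meas (fun x => c * f x).
Proof. by apply: bounded_measM; exact: bounded_meas_cst. Qed.

Lemma bounded_measB f g : bounded_meas f -> bounded_meas g ->
  bounded_meas (fun x => f x - g x).
Proof.
move=> bf /(bounded_measZ (-1)) bg; have := bounded_measD bf bg.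
by under eq_fun do rewrite mulN1r.
Qed.

Lemma bounded_measX f n : bounded_meas f -> bounded_meas (fun x => f x ^+ n).
Proof.
move=> bf; elim: n => [|n IH].
  by under eq_fun do rewrite expr0; exact: bounded_meas_cst.
by under eq_fun do rewrite exprS; exact: bounded_measM.
Qed.

Lemma bounded_meas_integrable f : bounded_meas f -> P.-integrable setT (EFin \o f).
Proof.
move=> [mf [K fK]]; apply: measurable_bounded_integrable => //.
  by rewrite (le_lt_trans (probability_le1 P _)) ?ltry.
exists K; split; first exact: num_real.
by move=> y Ky x _; exact: le_trans (fK x) (ltW Ky).
Qed.

Definition expect f : R := \int[P]_x f x.

Lemma EFin_expect f : bounded_meas f -> (\int[P]_x (f x)%:E)%E = (expect f)%:E.
Proof.
move=> bf; rewrite /expect /Rintegral fineK//.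
by apply: integrable_fin_num => //; exact: bounded_meas_integrable.
Qed.

Lemma expectD f g : bounded_meas f -> bounded_meas g ->
  expect (fun x => f x + g x) = expect f + expect g.
Proof. by move=> bf bg; apply: RintegralD => //; exact: bounded_meas_integrable. Qed.

Lemma expectZ c f : bounded_meas f -> expect (fun x => c * f x) = c * expect f.
Proof. by move=> bf; apply: RintegralZl => //; exact: bounded_meas_integrable. Qed.

Lemma expectB f g : bounded_meas f -> bounded_meas g ->
  expect (fun x => f x - g x) = expect f - expect g.
Proof. by move=> bf bg; apply: RintegralB => //; exact: bounded_meas_integrable. Qed.

Lemma expect_cst c : expect (cst c) = c.
Proof. by rewrite /expect Rintegral_cst//= probability_setT mulr1. Qed.

Lemma le_expect_on (A : set T) f g : measurable A -> P A = 1%E ->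
  bounded_meas f -> bounded_meas g -> (forall x, A x -> f x <= g x) ->
  expect f <= expect g.
Proof.
move=> mA PA bf bg fg; rewrite -subr_ge0 -expectB//.
have PA0 : P (~` A) = 0%E by rewrite probability_setC// PA subee.
have bh := bounded_measB bg bf; set h := (fun _ => _) in bh *.
rewrite /expect /Rintegral fine_ge0//.
(* [h] is nonnegative on [A] only; it equals its positive part almost everywhere. *)
have -> : (\int[P]_x (h x)%:E)%E = (\int[P]_x (Num.max 0 (h x))%:E)%E.
  have mh := bh.1.
  apply: ae_eq_integral => //; [exact/measurable_EFinP| |].
    by apply/measurable_EFinP; exact: measurable_maxr.
  exists (~` A); split=> //; first exact: measurableC.
  move=> x /= nx Ax; apply: nx => _; congr EFin.
  by rewrite (max_idPr _)// /h subr_ge0 fg.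
by apply: integral_ge0 => x _; rewrite lee_fin le_max lexx.
Qed.

Lemma le_expect f g : bounded_meas f -> bounded_meas g ->
  (forall x, f x <= g x) -> expect f <= expect g.
Proof.
move=> bf bg fg; apply: (@le_expect_on setT) => //; exact: probability_setT.
Qed.

(** From exp(-u) >= 1 - u, because (1 + u + 2 u^2)(1 - u) = 1 + u^2 (1 - 2 u) is at least 1. *)
Lemma expR_le_quadratic (u : R) : `|u| <= 2^-1 -> expR u <= 1 + u + 2 * u ^+ 2.
Proof.
rewrite ler_norml => /andP[u1 u2].
have h := expR_ge1Dx (- u).
have u0 : 0 < 1 - u by lra.
have : expR u <= (1 - u)^-1.
  rewrite -[u in leLHS]opprK expRN lef_pV2// posrE ?expR_gt0//.
move=> /le_trans; apply; rewrite -[_^-1]mul1r ler_pdivrMr//; nra.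
Qed.

(** The variance bound replaces the second-order term by a multiple of the mean, so the exponent is
    linear in [expect h]. This is what yields deviations of order 1/n instead of n^(-1/2). *)
Lemma expect_expR_le h (V theta : R) : 0 < V -> measurable_fun setT h ->
  (forall x, `|h x| <= V) -> expect (fun x => h x ^+ 2) <= V * expect h ->
  `|theta| * V <= 2^-1 ->
  (\int[P]_x (expR (theta * h x))%:E <=
   (expR ((theta + 2 * theta ^+ 2 * V) * expect h))%:E)%E.
Proof.
move=> V0 mh hV var tV.
have bh : bounded_meas h by split=> //; exists V.
have thV x : `|theta * h x| <= 2^-1.
  by apply: le_trans tV; rewrite normrM ler_wpM2l.
have bE : bounded_meas (fun x => expR (theta * h x)).
  split; first by apply: measurableT_comp => //; exact: measurable_funM.
  exists (expR 1) => x; rewrite ger0_norm ?expR_ge0// ler_expR.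
  have := thV x; rewrite ler_norml => /andP[_ /le_trans]; apply; lra.
rewrite EFin_expect// lee_fin.
have bq : bounded_meas (fun x => theta * h x + 2 * theta ^+ 2 * h x ^+ 2).
  by apply: bounded_measD; apply: bounded_measZ => //; exact: bounded_measX.
have bq1 := bounded_measD (bounded_meas_cst 1) bq.
apply: (le_trans (le_expect bE bq1 _)) => [x|].
  by apply: le_trans (expR_le_quadratic (thV x)) _; rewrite /=; apply: le_of_eq; ring.
rewrite (expectD (bounded_meas_cst 1) bq) expect_cst.
have -> : expect (fun x => theta * h x + 2 * theta ^+ 2 * h x ^+ 2) =
    theta * expect h + 2 * theta ^+ 2 * expect (fun x => h x ^+ 2).
  by rewrite expectD ?expectZ//; do ?[exact: bounded_measX|apply: bounded_measZ].
apply: le_trans (expR_ge1Dx _); rewrite lerD2l.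
have -> : (theta + 2 * theta ^+ 2 * V) * expect h =
  theta * expect h + 2 * theta ^+ 2 * (V * expect h) by ring.
by rewrite lerD2l ler_wpM2l// mulr_ge0// sqr_ge0.
Qed.

(** [theta] is -1/(4V) in the first bound and 1/(4V) in the second. The quadratic term contributes
    1/(8V), so the mean gets the factors -1/(8V) and 3/(8V); dividing by [theta] gives the constants
    1/2 and 3/2. *)
Lemma deviation n h (V tau : R) : 0 < V -> (0 < n)%N -> measurable_fun setT h ->
  (forall x, `|h x| <= V) -> expect (fun x => h x ^+ 2) <= V * expect h ->
  (product_power P n [set D | (8 * V * tau / n%:R <=
     expect h - 2 * (n%:R^-1 * \sum_i h (tnth D i)))%R] <= (expR (- tau))%:E)%E /\
  (product_power P n [set D | (4 * V * tau / n%:R <=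
     n%:R^-1 * (\sum_i h (tnth D i)) - 3 / 2 * expect h)%R] <= (expR (- tau))%:E)%E.
Proof.
move=> V0 n0 mh hV var.
have n0' : 0 < n%:R :> R by rewrite ltr0n.
have V4 : 0 < (4 * V)^-1 by rewrite invr_gt0 mulr_gt0.
have V4e : (4 * V)^-1 * V = 4^-1 by field; rewrite gt_eqF.
have tV : `|(4 * V)^-1| * V <= 2^-1 by rewrite gtr0_norm// V4e; lra.
have tVN : `|- (4 * V)^-1| * V <= 2^-1 by rewrite normrN.
have h1 := expect_expR_le V0 mh hV var tVN.
have h2 := expect_expR_le V0 mh hV var tV.
split.
- apply: le_trans (exponential_markov n tau mh h1).
  apply: le_of_eq; congr (product_power _ _ _); apply/seteqP.
  suff e (D : n.-tuple T) : (8 * V * tau / n%:R <= expect h - 2 * (n%:R^-1 * \sum_i h (tnth D i))) =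
    (tau <= - (4 * V)^-1 * \sum_i h (tnth D i) -
       n%:R * ((- (4 * V)^-1 + 2 * (- (4 * V)^-1) ^+ 2 * V) * expect h)).
    by split=> D; rewrite /= e.
  set S := \sum_i _; rewrite -[RHS](ler_pM2l (_ : 0 < 8 * V / n%:R)) ?divr_gt0 ?mulr_gt0//.
  congr (_ <= _); first by rewrite mulrAC.
  by field; rewrite !gt_eqF.
- apply: le_trans (exponential_markov n tau mh h2).
  apply: le_of_eq; congr (product_power _ _ _); apply/seteqP.
  suff e (D : n.-tuple T) : (4 * V * tau / n%:R <= n%:R^-1 * (\sum_i h (tnth D i)) - 3 / 2 * expect h) =
    (tau <= (4 * V)^-1 * \sum_i h (tnth D i) -
       n%:R * (((4 * V)^-1 + 2 * ((4 * V)^-1) ^+ 2 * V) * expect h)).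
    by split=> D; rewrite /= e.
  set S := \sum_i _; rewrite -[RHS](ler_pM2l (_ : 0 < 4 * V / n%:R)) ?divr_gt0 ?mulr_gt0//.
  congr (_ <= _); first by rewrite mulrAC.
  by field; rewrite !gt_eqF.
Qed.

End bounded_expectation.

(** * Least squares and the oracle inequality *)

Section clipping.
Context (R : realType) (M : R).
Hypothesis M0 : 0 <= M.

Definition clipr (r : R) : R := Num.max (- M) (Num.min M r).

Let clipr_cases r : [\/ r < - M /\ clipr r = - M, - M <= r <= M /\ clipr r = r |
  M < r /\ clipr r = M].
Proof.
have MM : - M <= M by rewrite ge0_cp.
rewrite /clipr; case: (leP M r) => Mr.
  rewrite (max_idPr MM).
  move: Mr; rewrite le_eqVlt => /predU1P[<-|Mr]; last by apply: Or33.
  by apply: Or32; rewrite lexx MM.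
case: (leP (- M) r) => Mr'; first by apply: Or32; rewrite (ltW Mr).
by apply: Or31.
Qed.

Lemma clipr_bound r : `|clipr r| <= M.
Proof. by rewrite ler_norml; case: (clipr_cases r) => -[h ->]; move: M0; lra. Qed.

Lemma clipr_id r : `|r| <= M -> clipr r = r.
Proof. by rewrite ler_norml => /andP[h1 h2]; case: (clipr_cases r) => -[h ->]; move: M0; lra. Qed.

(** The obtuse-angle property of the projection onto an interval. The additional square later forces
    the Bayes function to agree with its clipping almost everywhere. *)
Lemma clipr_closer y r : `|y| <= M ->
  (y - clipr r) ^+ 2 + (r - clipr r) ^+ 2 <= (y - r) ^+ 2.
Proof.
by rewrite ler_norml => /andP[h1 h2]; case: (clipr_cases r) => -[h ->]; move: M0; nra.
Qed.

Lemma clipr_lip a b : `|clipr a - clipr b| <= `|a - b|.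
Proof.
rewrite ler_norml.
have [h1 h2] : a - b <= `|a - b| /\ - (a - b) <= `|a - b|.
  by split; [exact: ler_norm|rewrite -normrN ler_norm].
by case: (clipr_cases a) => -[ha ->]; case: (clipr_cases b) => -[hb ->]; move: M0; lra.
Qed.

Lemma measurable_clipr : measurable_fun setT clipr.
Proof. by apply: measurable_maxr => //; exact: measurable_minr. Qed.

End clipping.

Section least_squares.
Context (R : realType) (d : nat).
Local Notation E := 'rV[R]_d.
Local Notation Rm := (measurableTypeR R).
Variables (P : probability (E * Rm)%type R) (X : set E) (Y : set Rm) (M : R).
Hypotheses (M0 : 0 < M) (mX : measurable X) (mY : measurable Y).
Hypotheses (YM : Y `<=` `[- M, M]%classic) (PXY : P (X `*` Y) = 1%E).
Implicit Types f g : E -> R.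

Let M0' : 0 <= M := ltW M0.

(** Responses lie in [Y] only almost surely. Clipping them bounds the loss everywhere and changes
    nothing on the carrier of [P]. *)
Definition cresp (z : E * Rm) : R := clipr M z.2.

Definition crisk f : R := expect P (fun z => (cresp z - f z.1) ^+ 2).

Definition bmeas f := measurable_fun setT f /\ exists K, forall x, `|f x| <= K.

Lemma bounded_meas_fst f : bmeas f -> bounded_meas (fun z : E * Rm => f z.1).
Proof.
move=> [mf [K fK]]; split; last by exists K.
by apply: measurableT_comp => //; exact: measurable_fst.
Qed.

Lemma bounded_meas_cresp : bounded_meas cresp.
Proof.
split; last by exists M => z; exact: clipr_bound.
apply: measurableT_comp; first exact: measurable_clipr.
exact: measurable_snd.
Qed.

Lemma bounded_meas_loss f : bmeas f ->
  bounded_meas (fun z : E * Rm => (cresp z - f z.1) ^+ 2).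
Proof.
move=> bf; apply: bounded_measX; apply: bounded_measB; first exact: bounded_meas_cresp.
exact: bounded_meas_fst.
Qed.

Lemma respE z : (X `*` Y) z -> cresp z = z.2 /\ `|z.2 : R| <= M.
Proof.
move=> [_ /YM]; rewrite /= in_itv/= => zM.
have zM' : `|z.2 : R| <= M by rewrite ler_norml.
by split=> //; exact: clipr_id.
Qed.

Let mXY : measurable (X `*` Y).
Proof. exact: measurableX. Qed.

Let PXYC : P (~` (X `*` Y)) = 0%E.
Proof. by rewrite probability_setC// PXY subee. Qed.

Lemma riskE f : measurable_fun setT f ->
  (risk least_squares P X f = \int[P]_z ((cresp z - f z.1) ^+ 2)%:E)%E.
Proof.
move=> mf; rewrite /risk integral_mkcond.
have mf1 : measurable_fun setT (fun z : E * Rm => f z.1).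
  by apply: measurableT_comp => //; exact: measurable_fst.
apply: ge0_ae_eq_integral => //.
- apply/(measurable_restrictT _ _).1; first exact: measurableX.
  apply: measurable_funTS; apply/measurable_EFinP.
  apply: measurable_funX; apply: measurable_funB => //; exact: measurable_snd.
- apply/measurable_EFinP; apply: measurable_funX; apply: measurable_funB => //.
  exact: (bounded_meas_cresp).1.
- by move=> z _; apply: erestrict_ge0 => y _; rewrite lee_fin sqr_ge0.
- by move=> z _; rewrite lee_fin sqr_ge0.
exists (~` (X `*` Y)); split; [exact: measurableC|exact: PXYC|].
move=> z /= nz XYz; apply: nz => _; have [-> _] := respE XYz.
by rewrite patchE mem_set//; split=> //; exact: XYz.1.
Qed.

Lemma risk_crisk f : bmeas f -> risk least_squares P X f = (crisk f)%:E.
Proof. by move=> bf; rewrite riskE ?EFin_expect//; [exact: bounded_meas_loss|exact: bf.1]. Qed.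

Variable fstar : E -> R.
Hypothesis bayes : bayes_decision_function least_squares P X fstar.

(** A Bayes function that is bounded by [M] everywhere; it is the reference for excess risks in
    place of [fstar]. *)
Definition regr : E -> R := clip M fstar.

Lemma bmeas_clip f : measurable_fun setT f -> bmeas (clip M f).
Proof.
move=> mf; split; last by exists M => x; exact: clipr_bound.
by apply: (measurableT_comp (measurable_clipr M)).
Qed.

Lemma bmeas_regr : bmeas regr.
Proof. exact: bmeas_clip bayes.1. Qed.

Lemma bayes_risk_le f : measurable_fun setT f ->
  (bayes_risk least_squares P X <= risk least_squares P X f)%E.
Proof.
by move=> mf; apply: ereal_inf_lbound; exists f => //; exact: measurable_funTS.
Qed.

(** [clipr_closer] integrated. As the Bayes risk is at most the risk of [regr], the additional
    integral must vanish, so [regr] is optimal and agrees with [fstar] almost everywhere. *)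
Lemma clip_gain :
  ((crisk regr)%:E + \int[P]_z ((fstar z.1 - regr z.1) ^+ 2)%:E <=
    bayes_risk least_squares P X)%E.
Proof.
have mfs : measurable_fun setT (fun z : E * Rm => fstar z.1).
  by apply: measurableT_comp => //; exact: bayes.1.
have mre := (bounded_meas_fst bmeas_regr).1.
have mcy := bounded_meas_cresp.1.
rewrite -bayes.2 riskE; last exact: bayes.1.
rewrite -(EFin_expect P (bounded_meas_loss bmeas_regr)) -ge0_integralD//; last 4 first.
- by move=> z _; rewrite lee_fin sqr_ge0.
- by apply/measurable_EFinP; apply: measurable_funX; apply: measurable_funB.
- by move=> z _; rewrite lee_fin sqr_ge0.
- by apply/measurable_EFinP; apply: measurable_funX; apply: measurable_funB.
apply: ge0_le_integral => //.
- by move=> z _; rewrite -EFinD lee_fin addr_ge0 ?sqr_ge0.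
- by apply: emeasurable_funD; apply/measurable_EFinP; apply: measurable_funX; apply: measurable_funB.
- by apply/measurable_EFinP; apply: measurable_funX; apply: measurable_funB.
move=> z _; rewrite -EFinD lee_fin; apply: clipr_closer => //; exact: clipr_bound.
Qed.

Lemma bayes_riskE : bayes_risk least_squares P X = (crisk regr)%:E.
Proof.
apply/eqP; rewrite eq_le; apply/andP; split.
  rewrite -(risk_crisk bmeas_regr); exact: bayes_risk_le bmeas_regr.1.
apply: le_trans clip_gain; rewrite leeDl// integral_ge0// => z _.
by rewrite lee_fin sqr_ge0.
Qed.

Lemma fstar_regr : (\int[P]_z ((fstar z.1 - regr z.1) ^+ 2)%:E = 0)%E.
Proof.
have := clip_gain; rewrite bayes_riskE -[leRHS]adde0 leeD2lE// => h.
apply/eqP; rewrite eq_le h/= integral_ge0// => z _.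
by rewrite lee_fin sqr_ge0.
Qed.

Lemma crisk_ge f : bmeas f -> crisk regr <= crisk f.
Proof.
by move=> bf; rewrite -lee_fin -bayes_riskE -risk_crisk//; exact: bayes_risk_le bf.1.
Qed.

Lemma bmeas_lin (a b : R) f g : bmeas f -> bmeas g -> bmeas (fun x => a * f x + b * g x).
Proof.
move=> [mf [K fK]] [mg [L gL]]; split.
  by apply: measurable_funD; exact: measurable_funM.
exists (`|a| * K + `|b| * L) => x; apply: le_trans (ler_normD _ _) _.
by rewrite !normrM lerD// ler_wpM2l.
Qed.

Definition excess f : E * Rm -> R :=
  fun z => (cresp z - f z.1) ^+ 2 - (cresp z - regr z.1) ^+ 2.

Lemma bounded_meas_excess f : bmeas f -> bounded_meas (excess f).
Proof.
by move=> bf; apply: bounded_measB; apply: bounded_meas_loss => //; exact: bmeas_regr.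
Qed.

Lemma expect_excess f : bmeas f -> expect P (excess f) = crisk f - crisk regr.
Proof.
by move=> bf; rewrite expectB//; apply: bounded_meas_loss => //; exact: bmeas_regr.
Qed.

Definition dist2 f : R := expect P (fun z => (f z.1 - regr z.1) ^+ 2).

Lemma bounded_meas_dist2 f : bmeas f ->
  bounded_meas (fun z : E * Rm => (f z.1 - regr z.1) ^+ 2).
Proof.
move=> bf; apply: bounded_measX; apply: bounded_measB; apply: bounded_meas_fst => //.
exact: bmeas_regr.
Qed.

(* Parallelogram law with midpoint (f + f* )/2, resp. with the reflection
   2 f* - f; minimality of the risk at f* does the rest. *)
Lemma dist2_le_excess f : bmeas f -> dist2 f <= 2 * expect P (excess f).
Proof.
move=> bf; have br := bmeas_regr.
pose g x := 2^-1 * f x + 2^-1 * regr x.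
have bg : bmeas g by exact: bmeas_lin.
have := crisk_ge bg; rewrite expect_excess//.
pose l f z := (cresp z - f z.1) ^+ 2; pose q (z : E * Rm) := (f z.1 - regr z.1) ^+ 2.
have bf' : bounded_meas (l f) by exact: bounded_meas_loss.
have br' : bounded_meas (l regr) by exact: bounded_meas_loss.
have bq : bounded_meas q by exact: bounded_meas_dist2.
have -> : crisk g = 2^-1 * crisk f + (2^-1 * crisk regr + (- 4^-1) * dist2 f).
  rewrite /crisk /dist2 -/(l f) -/(l regr) -/q.
  rewrite -(expectZ _ _ bf') -(expectZ _ _ br') -(expectZ _ _ bq).
  rewrite -(expectD _ (bounded_measZ _ br') (bounded_measZ _ bq)).
  rewrite -(expectD _ (bounded_measZ _ bf') (bounded_measD (bounded_measZ _ br') (bounded_measZ _ bq))).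
  by congr expect; apply/funext => z; rewrite /l /q /g; field.
by move=> h; lra.
Qed.

Lemma excess_le_dist2 f : bmeas f -> expect P (excess f) <= 2 * dist2 f.
Proof.
move=> bf; have br := bmeas_regr.
pose g x := 2 * regr x + (-1) * f x.
have bg : bmeas g by exact: bmeas_lin.
have := crisk_ge bg; rewrite expect_excess//.
pose l f z := (cresp z - f z.1) ^+ 2; pose q (z : E * Rm) := (f z.1 - regr z.1) ^+ 2.
have bf' : bounded_meas (l f) by exact: bounded_meas_loss.
have br' : bounded_meas (l regr) by exact: bounded_meas_loss.
have bq : bounded_meas q by exact: bounded_meas_dist2.
have -> : crisk g = (-1) * crisk f + (2 * crisk regr + 2 * dist2 f).
  rewrite /crisk /dist2 -/(l f) -/(l regr) -/q.
  rewrite -(expectZ _ _ bf') -(expectZ _ _ br') -(expectZ _ _ bq).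
  rewrite -(expectD _ (bounded_measZ _ br') (bounded_measZ _ bq)).
  rewrite -(expectD _ (bounded_measZ _ bf') (bounded_measD (bounded_measZ _ br') (bounded_measZ _ bq))).
  by congr expect; apply/funext => z; rewrite /l /q /g; ring.
by move=> h; lra.
Qed.

(** The excess loss is [f - regr] times [f + regr] minus twice the response, and the second factor
    is at most [F + 3 * M]. The 2 in [V] comes from [dist2_le_excess]. *)
Lemma excess_bounds (F : R) f : bmeas f -> (forall x, `|f x| <= F) ->
  let V := 2 * (F + 3 * M) ^+ 2 in
  (forall z, `|excess f z| <= V) /\
  expect P (fun z => excess f z ^+ 2) <= V * expect P (excess f).
Proof.
move=> bf fF V; have F0 : 0 <= F by apply: le_trans (fF 0).
have e z : excess f z = (f z.1 - regr z.1) * (f z.1 + regr z.1 - 2 * cresp z).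
  by rewrite /excess; ring.
have cM z : `|cresp z| <= M by exact: clipr_bound.
have rM x : `|regr x| <= M by exact: clipr_bound.
have s z : `|f z.1 + regr z.1 - 2 * cresp z| <= F + 3 * M.
  have := fF z.1; have := rM z.1; have := cM z; rewrite !ler_norml.
  by move=> /andP[? ?] /andP[? ?] /andP[? ?]; apply/andP; split; lra.
split=> [z|].
  rewrite e normrM; apply: (@le_trans _ _ ((F + M) * (F + 3 * M))).
    apply: ler_pM => //; apply: le_trans (ler_normB _ _) _.
    by apply: lerD.
  by rewrite /V; move: M0; nra.
apply: (@le_trans _ _ ((F + 3 * M) ^+ 2 * dist2 f)).
  rewrite /dist2 -(expectZ _ _ (bounded_meas_dist2 bf)); apply: le_expect.
  - by apply: bounded_measX; exact: bounded_meas_excess.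
  - by apply: bounded_measZ; exact: bounded_meas_dist2.
  move=> z; rewrite e exprMn mulrC ler_wpM2r ?sqr_ge0//.
  by rewrite -[leLHS]real_normK ?num_real// lerXn2r// nnegrE addr_ge0// mulr_ge0.
rewrite /V -mulrA mulrCA ler_wpM2l ?sqr_ge0//.
exact: dist2_le_excess.
Qed.

End least_squares.

Lemma probability_setI1 d (T : measurableType d) (R : realType) (P : probability T R)
    (A B : set T) : measurable A -> measurable B ->
  P A = 1%E -> P B = 1%E -> P (A `&` B) = 1%E.
Proof.
move=> mA mB PA PB.
have PAC : P (~` A) = 0%E by rewrite probability_setC// PA subee.
have PBC : P (~` B) = 0%E by rewrite probability_setC// PB subee.
have h : P (~` A `|` ~` B) = 0%E.
  apply/eqP; rewrite eq_le measure_ge0 andbT.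
  apply: le_trans (measureU2 _ (measurableC mA) (measurableC mB)) _.
  by apply: le_trans (leeD (le_of_eq PAC) (le_of_eq PBC)) _; rewrite adde0.
have -> : A `&` B = ~` (~` A `|` ~` B) by rewrite setCU !setCK.
have mU : measurable (~` A `|` ~` B) by apply: measurableU; exact: measurableC.
by rewrite probability_setC// h sube0.
Qed.

(** * Measurability of functions in the Gaussian RKHS *)

Section borel_facts.
Context (R : realType) (d : nat).
Local Notation E := 'rV[R]_d.

Lemma open_rV_measurable (U : set E) : open U -> measurable U.
Proof. by move=> oU; exact: sub_sigma_algebra. Qed.

Lemma coord_le_norm (x : E) i : `|x 0 i| <= `|x|.
Proof.
rewrite [leRHS]mx_normrE.
exact: (le_bigmax 0 (fun ij : 'I_1 * 'I_d => `|x ij.1 ij.2|) (0, i)).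
Qed.

Lemma enorm_le (x : E) : enorm x ^+ 2 <= d%:R * `|x| ^+ 2.
Proof.
rewrite enorm_sqr; apply: (@le_trans _ _ (\sum_(i < d) `|x| ^+ 2)).
  apply: ler_sum => i _; rewrite -[leLHS]real_normK ?num_real//.
  by rewrite lerXn2r// ?nnegrE//; exact: coord_le_norm.
by rewrite sumr_const card_ord mulr_natl.
Qed.

Lemma gaussian_kernel_ge (gamma : R) (x y : E) : 0 < gamma ->
  2 - 2 * gaussian_kernel gamma x y <= 2 * (d%:R / gamma ^+ 2) * `|x - y| ^+ 2.
Proof.
move=> g0; have := expR_ge1Dx (- gamma ^- 2 * enorm (x - y) ^+ 2).
rewrite -/(gaussian_kernel gamma x y) => h.
have e := enorm_le (x - y).
have : gamma ^- 2 * enorm (x - y) ^+ 2 <= gamma ^- 2 * (d%:R * `|x - y| ^+ 2).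
  by rewrite ler_wpM2l// invr_ge0 sqr_ge0.
have -> : 2 * (d%:R / gamma ^+ 2) * `|x - y| ^+ 2 =
  2 * (gamma ^- 2 * (d%:R * `|x - y| ^+ 2)) by ring.
by move: h; rewrite mulNr; lra.
Qed.

(** Such an [f] is Lipschitz on [X] and zero outside, so its superlevel sets are relatively open in
    [X], up to adding the complement of [X]. *)
Lemma rkhs_gaussian_measurable (gamma : R) (X : set E)
    (H : rkhs X (@gaussian_kernel R d gamma)) (f : E -> R) :
  0 < gamma -> measurable X -> rkhs_mem H f -> measurable_fun setT f.
Proof.
(* The summand 1 in [K] keeps the Lipschitz constant positive, as it becomes a divisor of radii. *)
move=> g0 mX Hf; pose F := rkhs_inner H f f.
have F0 : 0 <= F := rkhs_inner_ge0 Hf.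
pose K := 2 * (d%:R / gamma ^+ 2) * F + 1.
have K0 : 0 < K.
  by rewrite ltr_wpDl// mulr_ge0// mulr_ge0// divr_ge0// sqr_ge0.
have fK x y : X x -> X y -> (f x - f y) ^+ 2 <= K * `|x - y| ^+ 2.
  move=> Xx Xy; apply: le_trans (rkhs_eval_diff (@gaussian_kernelC R d gamma) Hf Xx Xy) _.
  rewrite !gaussian_kernel_diag; have := gaussian_kernel_ge x y g0.
  rewrite -/F => h; have := ler_wpM2r F0 h; rewrite /K.
  have := sqr_ge0 `|x - y|; set N := `|x - y| ^+ 2; set k := gaussian_kernel _ _ _; nra.
apply: (measurability (@RGenOInfty.G R) (RGenOInfty.measurableE R)).
move=> _ [_ [c ->] <-]; rewrite setTI.
pose V := \bigcup_(x in [set x | X x /\ c < f x]) ball x ((f x - c) / Num.sqrt K).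
have oV : open V.
  by apply: bigcup_open => x _; exact: ball_open.
have -> : f @^-1` `]c, +oo[%classic =
    (X `&` V) `|` ((~` X) `&` [set _ | c < 0]).
  apply/seteqP; split=> [x|x].
    rewrite /= in_itv/= andbT => cf.
    have [Xx|nXx] := pselect (X x); last first.
      by right; split=> //=; rewrite -(rkhs_off Hf nXx).
    left; split=> //; exists x => //; apply: ballxx.
    by rewrite divr_gt0 ?subr_gt0 ?sqrtr_gt0.
  case=> [[Xx [y [Xy cy]]]|[nXx /= c0]]; rewrite /= in_itv/= andbT; last first.
    by rewrite (rkhs_off Hf nXx).
  rewrite -ball_normE/= ltr_pdivlMr ?sqrtr_gt0// => xy.
  have := fK _ _ Xy Xx.
  rewrite -[K]sqr_sqrtr ?(ltW K0)// -exprMn -[leLHS]real_normK ?num_real//.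
  rewrite ler_pXn2r// ?nnegrE ?mulr_ge0 ?sqrtr_ge0// mulrC => h.
  have := le_lt_trans h xy; have := ler_norm (f y - f x); lra.
apply: measurableU; apply: measurableI => //.
- exact: open_rV_measurable.
- exact: measurableC.
- have [c0|c0] := boolP (c < 0).
    by rewrite (_ : [set _ | _] = setT)//; apply/seteqP; split.
  by rewrite (_ : [set _ | _] = set0)//; apply/seteqP; split.
Qed.

End borel_facts.

Lemma measure_finite_union_le d (T : measurableType d) (R : realType)
    (mu : {measure set T -> \bar R}) N (B : 'I_N -> set T) (c : R) :
  (forall j, measurable (B j)) -> (forall j, mu (B j) <= c%:E)%E ->
  measurable [set x | exists j, B j x] /\
  (mu [set x | exists j, B j x] <= (N%:R * c)%:E)%E.
Proof.
elim: N B => [|N IH] B mB Bc.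
  rewrite (_ : [set x | _] = set0); last by apply/seteqP; split=> // x [[]].
  by rewrite measure0 mul0r.
rewrite (_ : [set x | _] = B ord0 `|` [set x | exists j, B (lift ord0 j) x]).
  have [m1 le1] := IH (fun j => B (lift ord0 j)) (fun j => mB _) (fun j => Bc _).
  split; first exact: measurableU.
  apply: le_trans (measureU2 _ _ _) _ => //.
  by rewrite -nat1r mulrDl mul1r EFinD; apply: leeD; [exact: Bc|exact: le1].
apply/seteqP; split=> x.
  by move=> [j]; case: (unliftP ord0 j) => [i|] -> Bj; [right; exists i|left].
by case=> [B0|[i Bi]]; [exists ord0|exists (lift ord0 i)].
Qed.

Section oracle.
Context (R : realType) (d : nat).
Local Notation E := 'rV[R]_d.
Local Notation Rm := (measurableTypeR R).
Variables (P : probability (E * Rm)%type R) (X : set E) (Y : set Rm) (M : R).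
Hypotheses (M0 : 0 < M) (mX : measurable X) (mY : measurable Y).
Hypotheses (YM : Y `<=` `[- M, M]%classic) (PXY : P (X `*` Y) = 1%E).
Variable fstar : E -> R.
Hypothesis bayes : bayes_decision_function least_squares P X fstar.
Variables (gamma lambda : R) (n : nat).
Hypotheses (gamma0 : 0 < gamma) (lambda0 : 0 < lambda) (n0 : (0 < n)%N).
Variable H : rkhs X (@gaussian_kernel R d gamma).
Variable S : set E.
Hypotheses (mS : measurable S) (SX : S `<=` X) (PS : first_marginal P S = 1%E).
Variables (N : nat) (f : 'I_N -> E -> R) (eps : R).
Hypothesis Hf : forall j, rkhs_mem H (f j).
Hypothesis netf : forall g, rkhs_mem H g -> rkhs_inner H g g <= M ^+ 2 / lambda ->
  exists j, forall x, S x -> `|g x - f j x| <= eps.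
Variables (f0 : E -> R) (F0 B0 : R).
Hypotheses (bf0 : bmeas f0) (f0F : forall x, `|f0 x| <= F0).
Hypothesis f0B : forall m (x : 'I_m -> E) (a : 'I_m -> R), (forall i, X (x i)) ->
  2 * \sum_i a i * f0 (x i) <=
  \sum_i \sum_j a i * a j * gaussian_kernel gamma (x i) (x j) + B0.

Let V := 2 * (M + 3 * M) ^+ 2.
Let V0 := 2 * (F0 + 3 * M) ^+ 2.
Let exc := @excess R d M fstar.
Let emp (h : E * Rm -> R) (D : n.-tuple (E * Rm)) := n%:R^-1 * \sum_i h (tnth D i).

Let n0' : 0 < n%:R :> R. Proof. by rewrite ltr0n. Qed.

Let mf g : rkhs_mem H g -> measurable_fun setT g.
Proof. exact: rkhs_gaussian_measurable. Qed.

Let bclip g : rkhs_mem H g -> bmeas (clip M g).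
Proof. by move=> Hg; apply: bmeas_clip => //; exact: mf. Qed.

Let clipM (g : E -> R) x : `|clip M g x| <= M.
Proof. by apply: clipr_bound; exact: ltW. Qed.

Let PSY : P (S `*` Y) = 1%E.
Proof.
have PST : P (S `*` [set: Rm]) = 1%E.
  rewrite -PS /first_marginal /pushforward; congr (P _).
  by apply/seteqP; split=> [z []|z].
have -> : S `*` Y = (S `*` [set: Rm]) `&` (X `*` Y).
  apply/seteqP; split=> [z [Sz Yz]|z [[Sz _] [_ Yz]]]; split=> //=.
  by split=> //; exact: SX.
by apply: probability_setI1 => //; exact: measurableX.
Qed.

(** The SVM is compared with two competitors: the zero function bounds its norm, and an element
    interpolating [f0] at the sample bounds its empirical risk. The interpolant depends on the
    sample, but only its norm and its sample values enter. *)
Lemma svm_deterministic D g : (forall i, (S `*` Y) (tnth D i)) ->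
  is_svm least_squares H lambda D g ->
  rkhs_inner H g g <= M ^+ 2 / lambda /\
  emp (exc (clip M g)) D <= lambda * B0 + emp (exc f0) D.
Proof.
move=> SD [Hg gmin].
have XY i : (X `*` Y) (tnth D i) by have [h1 h2] := SD i; split=> //; exact: SX.
have yM i : `|(tnth D i).2 : R| <= M by have [] := respE M0 YM (XY i).
have ye i : cresp M (tnth D i) = (tnth D i).2 by have [] := respE M0 YM (XY i).
have loss0 (h : E -> R) : 0 <= n%:R^-1 * \sum_(i < n) least_squares (tnth D i).2 (h (tnth D i).1) :> R.
  by rewrite mulr_ge0 ?invr_ge0// sumr_ge0// => i _; exact: sqr_ge0.
have gg0 := rkhs_inner_ge0 Hg.
split.
  rewrite ler_pdivlMr// mulrC.
  have := gmin _ (rkhs_zero H); rewrite /svm_objective rkhs_inner0r; last exact: rkhs_zero.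
  rewrite mulr0 add0r => h; have := loss0 g.
  have : n%:R^-1 * \sum_(i < n) least_squares (tnth D i).2 (cst 0 (tnth D i).1) <= M ^+ 2 :> R.
    rewrite ler_pdivrMl//; apply: (@le_trans _ _ (\sum_(i < n) M ^+ 2)).
      apply: ler_sum => i _; rewrite /least_squares/= subr0.
      by rewrite -[leLHS]real_normK ?num_real// lerXn2r// nnegrE ltW.
    by rewrite sumr_const card_ord mulr_natl.
  lra.
have [u [Hu ux uB]] := @rkhs_interpolation _ _ _ _ H (@gaussian_kernelC R d gamma) n
  (fun i => (tnth D i).1) (fun i => f0 (tnth D i).1) B0
  (fun i => (XY i).1) (fun a => f0B a (fun i => (XY i).1)).
have := gmin _ Hu; rewrite /svm_objective.
under [in X in _ <= X -> _]eq_bigr do rewrite ux.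
move=> h; rewrite /emp /exc /excess !sumrB.
under [\sum_(i < n) (cresp M (tnth D i) - clip M g _) ^+ 2]eq_bigr do rewrite ye.
under [\sum_(i < n) (cresp M (tnth D i) - f0 _) ^+ 2]eq_bigr do rewrite ye.
rewrite !mulrBr addrA lerB//.
have hc : n%:R^-1 * \sum_(i < n) ((tnth D i).2 - clip M g (tnth D i).1) ^+ 2 <=
    n%:R^-1 * \sum_(i < n) least_squares (tnth D i).2 (g (tnth D i).1) :> R.
  rewrite ler_pM2l ?invr_gt0//; apply: ler_sum => i _.
  have := clipr_closer (ltW M0) (g (tnth D i).1) (yM i).
  by rewrite /least_squares; apply: le_trans; rewrite lerDl sqr_ge0.
have lg : 0 <= lambda * rkhs_inner H g g by rewrite mulr_ge0// ltW.
have lu : lambda * rkhs_inner H u u <= lambda * B0 by rewrite ler_pM2l.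
move: h; rewrite /least_squares in hc *; lra.
Qed.

(** There is one bad event for each net element and one for [f0], hence [N.+1]. Passing from the SVM
    to its net element costs 4 M eps in the mean and twice 4 M eps in the doubled empirical mean,
    hence 12; doubling the deviation bound of [f0] gives the factors 3 and 8. *)
Lemma oracle_inequality (t : R) : exists A : set (n.-tuple (E * Rm)),
  [/\ measurable A,
      ((1 - N.+1%:R * expR (- t))%:E <= product_power P n A)%E &
      forall D g, A D -> is_svm least_squares H lambda D g ->
      (risk least_squares P X (clip M g) - bayes_risk least_squares P X <=
       (2 * (lambda * B0) + 3 * expect P (exc f0) + 8 * V0 * t / n%:R +
        8 * V * t / n%:R + 12 * M * eps)%:E)%E].
Proof.
have br := bmeas_regr M0 bayes.
pose bad (j : 'I_N) := [set D : n.-tuple (E * Rm) | (8 * V * t / n%:R <=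
     expect P (exc (clip M (f j))) - 2 * emp (exc (clip M (f j))) D)%R].
pose bad0 := [set D : n.-tuple (E * Rm) | (4 * V0 * t / n%:R <=
     emp (exc f0) D - 3 / 2 * expect P (exc f0))%R].
have F00 : 0 <= F0 by apply: le_trans (f0F 0).
have V_gt0 : 0 < V by rewrite mulr_gt0// exprn_gt0//; move: M0; lra.
have V0_gt0 : 0 < V0 by rewrite mulr_gt0// exprn_gt0//; move: M0 F00; lra.
have memp h : measurable_fun setT h -> measurable_fun setT (emp h).
  move=> mh; apply: measurable_funM => //.
  apply: (@measurable_sum _ _ _ _ _ _ (fun i (t : n.-tuple (E * Rm)) => h (tnth t i))) => i.
  by apply: measurableT_comp => //; exact: measurable_tnth.
have mexc g : bmeas g -> measurable_fun setT (exc g).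
  by move=> bg; have [] := bounded_meas_excess M0 bayes bg.
have mbad j : measurable (bad j).
  rewrite -[X in measurable X]setTI; apply: measurable_fun_le => //.
  apply: measurable_funB => //; apply: measurable_funM => //.
  by apply: memp; apply: mexc; exact: bclip.
have mbad0 : measurable bad0.
  rewrite -[X in measurable X]setTI; apply: measurable_fun_le => //.
  apply: measurable_funB => //; apply: memp; exact: mexc.
have Pbad j : (product_power P n (bad j) <= (expR (- t))%:E)%E.
  have [h1 h2] := excess_bounds M0 mX mY YM PXY bayes (bclip (Hf j)) (clipM (f j)).
  by have [] := deviation t V_gt0 n0 (mexc _ (bclip (Hf j))) h1 h2.
have Pbad0 : (product_power P n bad0 <= (expR (- t))%:E)%E.
  have [h1 h2] := excess_bounds M0 mX mY YM PXY bayes bf0 f0F.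
  by have [] := deviation t V0_gt0 n0 (mexc _ bf0) h1 h2.
have [mU PU] := measure_finite_union_le mbad Pbad.
set U := [set x | exists j, bad j x] in mU PU.
pose good := [set D : n.-tuple (E * Rm) | forall i, (S `*` Y) (tnth D i)].
have mSY : measurable (S `*` Y) by exact: measurableX.
have mgood : measurable good by exact: measurable_forall_tnth.
have Pgood : product_power P n good = 1%E by exact: product_power_forall.
exists (good `\` (U `|` bad0)); split.
- by apply: measurableD => //; exact: measurableU.
- have mUb : measurable (U `|` bad0) by exact: measurableU.
  have hb : (product_power P n (U `|` bad0) <= (N.+1%:R * expR (- t))%:E)%E.
    apply: le_trans (measureU2 _ _ _) _ => //.
    by rewrite -natr1 mulrDl mul1r EFinD; exact: leeD.
  have hs : (1 <= product_power P n (good `\` (U `|` bad0)) + product_power P n (U `|` bad0))%E.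
    rewrite -Pgood; apply: le_trans (measureU2 _ _ _); [|exact: measurableD|exact: mUb].
    apply: le_measure; rewrite ?inE//; first by apply: measurableU => //; exact: measurableD.
    move=> D gD; have [UD|nUD] := pselect ((U `|` bad0) D); first by right.
    by left.
  rewrite EFinB leeBlDr//; apply: le_trans hs _.
  by rewrite leeD2l.
- move=> D g [gD /not_orP[nU nb0]] svmg.
  have [gB gemp] := svm_deterministic gD svmg.
  have Hg : rkhs_mem H g by case: svmg.
  have [j gj] := netf Hg gB.
  have bg := bclip Hg; have bfj := bclip (Hf j).
  rewrite (bayes_riskE M0 mX mY YM PXY bayes) (risk_crisk M0 mX mY YM PXY bg) -EFinB lee_fin.
  rewrite -(expect_excess M0 bayes bg).
  (* The difference of the excess losses factors; one factor is at most [eps] by the net property,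
     the other at most 4 M by clipping. *)
  have ptw (z : E * Rm) : S z.1 -> `|exc (clip M g) z - exc (clip M (f j)) z| <= 4 * M * eps.
    move=> Sz; have := gj _ Sz => h.
    have e : exc (clip M g) z - exc (clip M (f j)) z =
      (clip M (f j) z.1 - clip M g z.1) * (2 * cresp M z - clip M g z.1 - clip M (f j) z.1).
      by rewrite /exc /excess; ring.
    have h1 : `|clip M (f j) z.1 - clip M g z.1| <= eps.
      by rewrite distrC; apply: le_trans h; apply: clipr_lip; exact: ltW.
    have h2 : `|2 * cresp M z - clip M g z.1 - clip M (f j) z.1| <= 4 * M.
      have := clipM g z.1; have := clipM (f j) z.1.
      have := clipr_bound (ltW M0) z.2; rewrite -/(cresp M z) !ler_norml.
      by move=> /andP[? ?] /andP[? ?] /andP[? ?]; apply/andP; split; lra.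
    by rewrite e normrM mulrC; apply: ler_pM.
  have ef : expect P (exc (clip M g)) <= expect P (exc (clip M (f j))) + 4 * M * eps.
    have be := bounded_meas_excess M0 bayes bfj.
    rewrite -[4 * M * eps](expect_cst P) -(expectD _ be (bounded_meas_cst _ _)).
    apply: (@le_expect_on _ _ _ _ (S `*` Y)) => //.
    + exact: (bounded_meas_excess M0 bayes bg).
    + by apply: bounded_measD => //; exact: bounded_meas_cst.
    move=> z [Sz _]; have := ptw z Sz; rewrite ler_norml => /andP[_].
    by rewrite lerBlDl.
  have ee : emp (exc (clip M (f j))) D <= emp (exc (clip M g)) D + 4 * M * eps.
    have -> : 4 * M * eps = n%:R^-1 * \sum_(i < n) 4 * M * eps.
      rewrite sumr_const card_ord -[(4 * M * eps) *+ n]mulr_natl mulKf//.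
      by rewrite gt_eqF.
    rewrite -mulrDr ler_pM2l ?invr_gt0// -big_split/=; apply: ler_sum => i _.
    have [Sz _] := gD i.
    by have := ptw _ Sz; rewrite distrC ler_norml => /andP[_]; rewrite lerBlDl.
  have h1 : expect P (exc (clip M (f j))) - 2 * emp (exc (clip M (f j))) D <= 8 * V * t / n%:R.
    by rewrite leNgt; apply/negP => /ltW h; apply: nU; exists j.
  have h2 : emp (exc f0) D - 3 / 2 * expect P (exc f0) <= 4 * V0 * t / n%:R.
    by rewrite leNgt; apply/negP => /ltW h; exact: nb0.
  have e8 : 8 * V0 * t / n%:R = 2 * (4 * V0 * t / n%:R) by ring.
  have e12 : 12 * M * eps = 3 * (4 * M * eps) by ring.
  by move: ef ee h1 h2 gemp; rewrite e8 e12; lra.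
Qed.

End oracle.

(** * Gaussian smoothing *)

Section affine_change.
Context (R : realType).
Local Notation mu := (@lebesgue_measure R).
Local Open Scope ereal_scope.

(** The scaled image of Lebesgue measure agrees with Lebesgue measure on half-open intervals, hence
    on all Borel sets. *)
Lemma ge0_integral_affine (a b : R) (f : R -> \bar R) : (0 < a)%R ->
  measurable_fun setT f -> (forall r, 0 <= f r) ->
  \int[mu]_s f (a * s + b)%R = (a^-1)%:E * \int[mu]_s f s.
Proof.
move=> a0 mf f0.
pose phi (s : measurableTypeR R) : measurableTypeR R := (a * s + b)%R.
have mphi : measurable_fun setT phi.
  by apply: measurable_funD => //; exact: measurable_funM.
pose phif := HB.pack_for {mfun _ >-> _} phi (isMeasurableFun.Build _ _ _ _ phi mphi).
have am0 : (0 <= a^-1)%R by rewrite invr_ge0 ltW.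
pose an : {nonneg R} := NngNum am0.
pose aa : {nonneg R} := NngNum (ltW a0).
have e A : measurable A -> mu A = mscale aa (pushforward mu phif) A.
  apply: lebesgue_measure_unique => _ [[x y]] _ <-.
  change (mscale aa (pushforward mu phif) `]x, y]) with (a%:E * mu (phi @^-1` `]x, y])).
  rewrite [X in _ = _ * mu X](_ : _ = `]((x - b) / a)%R, ((y - b) / a)%R]%classic); last first.
    apply/seteqP; split=> s; rewrite /= !in_itv/= /phi.
      by rewrite ltr_pdivrMr// ler_pdivlMr// ltrBlDr lerBrDr (mulrC a).
    by rewrite ltr_pdivrMr// ler_pdivlMr// ltrBlDr lerBrDr (mulrC a).
  rewrite !lebesgue_measure_itv/= !lte_fin ltr_pM2r ?invr_gt0// ltrD2r.
  case: ifPn => _; last by rewrite mule0.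
  rewrite -!EFinB -EFinM; congr EFin; field; exact: lt0r_neq0.
rewrite [in RHS](eq_measure_integral (mscale aa (pushforward mu phif))) => [|A mA _];
  last exact: e.
rewrite ge0_integral_mscale//= ge0_integral_pushforward//= preimage_setT.
by rewrite muleA -EFinM mulVf ?mul1e// gt_eqF.
Qed.

Lemma ge0_integral_affine_tuple d (a : R) (b : 'I_d -> R)
    (f : d.-tuple (measurableTypeR R) -> \bar R) : (0 < a)%R ->
  measurable_fun setT f -> (forall t, 0 <= f t) ->
  \int[product_power mu d]_t f [tuple (a * tnth t i + b i)%R | i < d] =
  (a^-1 ^+ d)%:E * \int[product_power mu d]_t f t.
Proof.
move=> a0; elim: d b f => [|d IH] b f mf f0.
  by rewrite !ge0_integral_product_power0 expr0 mul1e; congr f; rewrite [LHS]tuple0.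
have maff n (c : 'I_n -> R) : measurable_fun [set: n.-tuple (measurableTypeR R)]
    (fun t : n.-tuple (measurableTypeR R) => [tuple (a * tnth t i + c i)%R | i < n]).
  apply/measurable_fun_tnthP => i; rewrite /comp/=.
  under eq_fun do rewrite tnth_mktuple.
  by apply: measurable_funD => //; apply: measurable_funM => //; exact: measurable_tnth.
have am : (0 <= a^-1)%R by rewrite invr_ge0 ltW.
rewrite !ge0_integral_product_powerS//; last by apply: measurableT_comp; [exact: mf|exact: maff].
have mcons s : measurable_fun setT (fun t : d.-tuple (measurableTypeR R) => f [tuple of s :: t]).
  apply: measurableT_comp; first exact: mf.
  by apply: measurable_cons => //; exact: measurable_cst.
under eq_integral => s _.
  rewrite (_ : \int[_]_t _ = \int[product_power mu d]_t
     f [tuple of (a * s + b ord0)%R :: [tuple (a * tnth t i + b (lift ord0 i))%R | i < d]]);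
    last first.
    apply: eq_integral => t _; congr f; apply: eq_from_tnth => i.
    rewrite tnth_mktuple; case: (unliftP ord0 i) => [j|] ->.
      by rewrite !tnthS tnth_mktuple.
    by rewrite !tnth0.
  rewrite (IH (fun i => b (lift ord0 i)) (fun t => f [tuple of (a * s + b ord0)%R :: t]))//; over.
rewrite /=.
rewrite (@ge0_integral_affine a (b ord0) (fun s => (a^-1 ^+ d)%:E *
  \int[product_power mu d]_t f [tuple of s :: t])%E); first last.
- by move=> s; rewrite mule_ge0 ?lee_fin ?exprn_ge0// integral_ge0.
- apply: measurable_funeM.
  have := @measurable_fun_fubini_tonelli_F _ _ _ _ R (product_power mu d)
    (fun z : measurableTypeR R * d.-tuple (measurableTypeR R) => f [tuple of z.1 :: z.2]).
  apply => //; apply: measurableT_comp; first exact: mf.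
  exact: measurable_cons.
- exact: a0.
rewrite ge0_integralZl//.
- by rewrite muleA -EFinM exprS.
- have := @measurable_fun_fubini_tonelli_F _ _ _ _ R (product_power mu d)
    (fun z : measurableTypeR R * d.-tuple (measurableTypeR R) => f [tuple of z.1 :: z.2]).
  apply => //; apply: measurableT_comp; first exact: mf.
  exact: measurable_cons.
- by move=> s _; rewrite integral_ge0.
- by rewrite lee_fin exprn_ge0.
Qed.

End affine_change.

Section row_measurability.
Context (R : realType) (d : nat).
Local Notation E := 'rV[R]_d.
Local Notation Rm := (measurableTypeR R).
Local Notation row := (@row_of_tuple R d).

Lemma measurable_coord (i : 'I_d) : measurable_fun [set: E] (fun x : E => x 0 i).
Proof.
apply: (measurability (@RGenOInfty.G R) (RGenOInfty.measurableE R)).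
move=> _ [_ [c ->] <-]; rewrite setTI; apply: open_rV_measurable.
apply: (@open_comp _ _ (fun x : E => x 0 i)); last exact: interval_open.
by move=> x _; exact: coord_continuous.
Qed.

Lemma measurable_row : measurable_fun [set: d.-tuple Rm] row.
Proof. exact: measurable_funPT. Qed.

Lemma measurable_to_row dT (T : measurableType dT) (F : T -> E) :
  (forall i, measurable_fun [set: T] (fun t => F t 0 i)) -> measurable_fun [set: T] F.
Proof.
move=> mF.
rewrite (_ : F = row \o (fun t => [tuple (F t 0 i : Rm) | i < d])); last first.
  by apply/funext => t; apply/rowP => i; rewrite /row_of_tuple/= mxE tnth_mktuple.
apply: measurableT_comp; first exact: measurable_row.
apply/measurable_fun_tnthP => i; rewrite /comp/=.
by under eq_fun do rewrite tnth_mktuple; exact: mF.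
Qed.

Lemma measurable_row_affine (a : R) :
  measurable_fun [set: E * d.-tuple Rm] (fun z => z.1 + a *: row z.2).
Proof.
apply: measurable_to_row => i; under eq_fun do rewrite !mxE.
apply: measurable_funD.
  by apply: (measurableT_comp (measurable_coord i)); exact: measurable_fst.
apply: measurable_funM => //.
by apply: (measurableT_comp (measurable_tnth i)); exact: measurable_snd.
Qed.

Lemma measurable_row_affine2 (a : R) (x : E) :
  measurable_fun [set: d.-tuple Rm] (fun t => x + a *: row t).
Proof.
apply: measurable_to_row => i; under eq_fun do rewrite !mxE.
by apply: measurable_funD => //; apply: measurable_funM => //; exact: measurable_tnth.
Qed.

End row_measurability.

(** * Gaussian densities and their convolutions *)

Section gaussian_density.
Context (R : realType).
Local Notation leb := (@lebesgue_measure R).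
Local Notation Rm := (measurableTypeR R).

(** The centred normal density of variance 1/(2 beta). Under convolution the inverses of the
    parameters [beta] add. *)
Definition gdens1 (beta s : R) : R := Num.sqrt (beta / pi) * expR (- (beta * s ^+ 2)).

Lemma gdens1_ge0 beta s : 0 <= gdens1 beta s.
Proof. by rewrite mulr_ge0 ?sqrtr_ge0 ?expR_ge0. Qed.

Lemma measurable_gdens1 beta (m c : R) :
  measurable_fun [set: R] (fun s => gdens1 beta (m * s + c)).
Proof.
apply: measurable_funM => //; apply: measurableT_comp => //.
apply: measurableT_comp => //; apply: measurable_funM => //.
by apply: measurable_funX; apply: measurable_funD => //; exact: measurable_funM.
Qed.

Lemma integral_gdens1 beta m : 0 < beta ->
  (\int[leb]_s (gdens1 beta (s - m))%:E = 1)%E.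
Proof.
move=> b0; pose sg := Num.sqrt (2 * beta)^-1.
have sg0 : sg != 0 by rewrite gt_eqF// sqrtr_gt0 invr_gt0 mulr_gt0.
rewrite -(integral_normal_pdf m sg); apply: eq_integral => s _; congr EFin.
have sg2 : sg ^+ 2 *+ 2 = beta^-1.
  by rewrite sqr_sqrtr ?invr_ge0 ?mulr_ge0 ?(ltW b0)// -mulr_natr; field; rewrite gt_eqF.
rewrite normal_pdfE// /gdens1 /normal_peak /normal_fun; congr (_ * _).
  by rewrite -mulrnAl sg2 -sqrtrV ?mulr_ge0 ?invr_ge0 ?pi_ge0 ?(ltW b0)// invfM invrK mulrC.
by congr expR; rewrite sg2 invrK mulNr mulrC.
Qed.

(** Completing the square: in [u] the integrand is the claimed value times a density with parameter
    [b1 + b2] centred at the weighted mean [m]. *)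
Lemma gdens1_conv b1 b2 (x y : R) : 0 < b1 -> 0 < b2 ->
  (\int[leb]_u (gdens1 b1 (u - x) * gdens1 b2 (y - u))%:E =
   (gdens1 (b1 * b2 / (b1 + b2)) (y - x))%:E)%E.
Proof.
move=> b10 b20; have b120 : 0 < b1 + b2 by rewrite addr_gt0.
pose m := (b1 * x + b2 * y) / (b1 + b2).
pose c := gdens1 (b1 * b2 / (b1 + b2)) (y - x).
have -> : (\int[leb]_u (gdens1 b1 (u - x) * gdens1 b2 (y - u))%:E =
    \int[leb]_u ((c)%:E * (gdens1 (b1 + b2) (u - m))%:E))%E.
  apply: eq_integral => u _; rewrite -EFinM; congr EFin.
  rewrite /c /gdens1 mulrACA [RHS]mulrACA -!expRD; congr (_ * expR _).
    rewrite -!sqrtrM ?mulr_ge0 ?invr_ge0 ?pi_ge0 ?(ltW b10) ?(ltW b120) ?(ltW b20)//.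
    congr Num.sqrt; have := @pi_gt0 R; move: pi => p p0.
    by field; rewrite !gt_eqF.
  by rewrite /m; field; rewrite gt_eqF.
rewrite ge0_integralZl//.
- by rewrite integral_gdens1// mule1.
- apply/measurable_EFinP; have := measurable_gdens1 (b1 + b2) 1 (- m).
  by under eq_fun do rewrite mul1r.
- by move=> u _; rewrite lee_fin gdens1_ge0.
- by rewrite lee_fin gdens1_ge0.
Qed.

Variable d : nat.
Local Notation E := 'rV[R]_d.
Local Notation row := (@row_of_tuple R d).
Local Notation mu := (product_power leb d).

Definition gdens (beta : R) (z : E) : R := \prod_i gdens1 beta (z 0 i).

Lemma gdens_ge0 beta z : 0 <= gdens beta z.
Proof. by apply: prodr_ge0 => i _; exact: gdens1_ge0. Qed.

Lemma gdensE beta z :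
  gdens beta z = Num.sqrt (beta / pi) ^+ d * expR (- (beta * enorm z ^+ 2)).
Proof.
rewrite /gdens /gdens1 big_split/= prodr_const card_ord; congr (_ * _).
by rewrite -expR_sum sumrN enorm_sqr mulr_sumr.
Qed.

Lemma gdensN beta z : gdens beta (- z) = gdens beta z.
Proof. by rewrite !gdensE !enorm_sqr; under eq_bigr do rewrite mxE sqrrN. Qed.

Lemma measurable_gdens beta : measurable_fun [set: E] (gdens beta).
Proof.
apply: (@measurable_prod _ _ _ _ _ _ (fun i (z : E) => gdens1 beta (z 0 i))) => i _.
apply: (measurableT_comp _ (@measurable_coord R d i)).
have := measurable_gdens1 beta 1 0; under eq_fun do rewrite mul1r addr0.
exact.
Qed.

Lemma gdens_conv b1 b2 (x y : E) : 0 < b1 -> 0 < b2 ->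
  (\int[mu]_t (gdens b1 (row t - x) * gdens b2 (y - row t))%:E =
   (gdens (b1 * b2 / (b1 + b2)) (y - x))%:E)%E.
Proof.
move=> b10 b20.
pose phi (i : 'I_d) (u : Rm) : R := gdens1 b1 (u - x 0 i) * gdens1 b2 (y 0 i - u).
have mphi i : measurable_fun [set: Rm] (phi i).
  apply: measurable_funM.
    have := measurable_gdens1 b1 1 (- x 0 i); under eq_fun do rewrite mul1r.
    exact.
  have := measurable_gdens1 b2 (-1) (y 0 i); under eq_fun do rewrite mulN1r addrC.
  exact.
have phi0 i u : 0 <= phi i u by rewrite mulr_ge0 ?gdens1_ge0.
transitivity (\int[mu]_t (\prod_i phi i (tnth t i))%:E)%E.
  apply: eq_integral => t _; congr EFin; rewrite /gdens -big_split/=.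
  by apply: eq_bigr => i _; rewrite !mxE.
have := ge0_integral_prod_tnth leb mphi phi0 => /= ->.
rewrite /gdens -prodEFin; apply: eq_bigr => i _.
by rewrite gdens1_conv// !mxE.
Qed.

Lemma integral_gdens beta (x : E) : 0 < beta ->
  (\int[mu]_t (gdens beta (row t - x))%:E = 1)%E.
Proof.
move=> b0.
pose phi (i : 'I_d) (u : Rm) : R := gdens1 beta (u - x 0 i).
have mphi i : measurable_fun [set: Rm] (phi i).
  have := measurable_gdens1 beta 1 (- x 0 i); under eq_fun do rewrite mul1r.
  exact.
have phi0 i u : 0 <= phi i u by exact: gdens1_ge0.
transitivity (\int[mu]_t (\prod_i phi i (tnth t i))%:E)%E.
  apply: eq_integral => t _; congr EFin; rewrite /gdens.
  by apply: eq_bigr => i _; rewrite !mxE.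
have := ge0_integral_prod_tnth leb mphi phi0 => /= ->.
by rewrite big1// => i _; rewrite integral_gdens1.
Qed.

Lemma ge0_integral_row_affine (a : R) (x : E) (F : E -> \bar R) : 0 < a ->
  measurable_fun [set: E] F -> (forall z, 0 <= F z)%E ->
  (\int[mu]_t F (x + a *: row t)%R = (a^-1 ^+ d)%:E * \int[mu]_t F (row t))%E.
Proof.
move=> a0 mF F0.
have := @ge0_integral_affine_tuple R d a (fun i => x 0 i) (F \o row) a0 _ _.
rewrite /comp => <-//; last exact: (measurableT_comp mF (@measurable_row R d)).
apply: eq_integral => t _; congr F; apply/rowP => i.
by rewrite !mxE tnth_mktuple addrC.
Qed.

(** The substitution z = x + j h turns a mean over steps j h into a convolution at [x] with a
    Gaussian that is [j] times wider. *)
Lemma gdens_dilate (beta j : R) (x : E) (F : E -> \bar R) : 0 < j ->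
  measurable_fun [set: E] F -> (forall z, 0 <= F z)%E ->
  (\int[mu]_t ((gdens beta (row t))%:E * F (x + j *: row t)%R) =
   \int[mu]_t ((gdens (beta / j ^+ 2) (row t - x)%R)%:E * F (row t)))%E.
Proof.
move=> j0 mF F0.
pose Fx (z : E) := ((gdens beta (j^-1 *: (z - x))%R)%:E * F z)%E.
transitivity (\int[mu]_t Fx (x + j *: row t)%R)%E.
  apply: eq_integral => t _; rewrite /Fx; congr (_%:E * _)%E.
  by rewrite addrAC subrr add0r scalerA mulVf ?scale1r// gt_eqF.
have e z : (gdens beta (j^-1 *: (z - x)) = j ^+ d * gdens (beta / j ^+ 2) (z - x)).
  rewrite !gdensE [RHS]mulrA; congr (_ * expR (- _)).
    rewrite -exprMn; congr (_ ^+ d).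
    rewrite -[X in _ = X * _](ger0_norm (ltW j0)) -sqrtr_sqr -sqrtrM ?sqr_ge0//.
    congr Num.sqrt; have := @pi_gt0 R; move: pi => p p0.
    by field; rewrite !gt_eqF.
  rewrite !enorm_sqr !mulr_sumr; apply: eq_bigr => i _; rewrite !mxE.
  by field; rewrite gt_eqF.
have mg : measurable_fun [set: E] (fun z => (gdens beta (j^-1 *: (z - x)))%:E).
  apply/measurable_EFinP; under eq_fun do rewrite e.
  apply: measurable_funM => //; apply: (measurableT_comp (measurable_gdens _)).
  apply: measurable_to_row => i; under eq_fun do rewrite !mxE.
  by apply: measurable_funB => //; exact: measurable_coord.
have mFx : measurable_fun [set: E] Fx by exact: emeasurable_funM.
have Fx0 z : (0 <= Fx z)%E by rewrite mule_ge0// lee_fin gdens_ge0.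
rewrite ge0_integral_row_affine// -ge0_integralZl//; first last.
- by rewrite lee_fin exprn_ge0// invr_ge0 ltW.
- by apply: (measurableT_comp mFx); exact: measurable_row.
apply: eq_integral => t _; rewrite /Fx muleA; congr (_ * _)%E.
rewrite -EFinM; congr EFin; rewrite e mulrA -exprMn mulVf ?gt_eqF// expr1n mul1r//.
Qed.

End gaussian_density.

Section has_integral.
Context dT (T : measurableType dT) (R : realType) (mu : {measure set T -> \bar R}).
Implicit Types f g : T -> R.

(** Integrability together with the value, so that linearity and monotonicity carry no finiteness
    conditions. *)
Definition has_integral f (v : R) :=
  mu.-integrable setT (EFin \o f) /\ (\int[mu]_x (f x)%:E = v%:E)%E.

Lemma has_integralD f g v w : has_integral f v -> has_integral g w ->
  has_integral (fun x => f x + g x) (v + w).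
Proof.
move=> [If fv] [Ig gw]; split; first by have := integrableD measurableT If Ig.
by have := integralD_EFin measurableT If Ig; rewrite fv gw -EFinD.
Qed.

Lemma has_integralZ c f v : has_integral f v -> has_integral (fun x => c * f x) (c * v).
Proof.
move=> [If fv]; split; first by have := integrableZl measurableT c If.
by have := integralZl measurableT If c; rewrite fv -EFinM.
Qed.

Lemma has_integral_sum (I : Type) (r : seq I) (f : I -> T -> R) (v : I -> R) :
  (forall i, has_integral (f i) (v i)) ->
  has_integral (fun x => \sum_(i <- r) f i x) (\sum_(i <- r) v i).
Proof.
move=> h; elim: r => [|i r IH].
  under eq_fun do rewrite big_nil; rewrite big_nil; split.
    by have := integrable0 mu setT; rewrite /cst.
  exact: integral0.
by under eq_fun do rewrite big_cons; rewrite big_cons; exact: has_integralD.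
Qed.

Lemma has_integral_le f g v w : has_integral f v -> has_integral g w ->
  (forall x, f x <= g x) -> v <= w.
Proof.
move=> [If fv] [Ig gw] fg; rewrite -lee_fin -fv -gw.
by apply: le_integral => // x _; rewrite lee_fin.
Qed.

Lemma has_integral_ge0 f v : measurable_fun setT f -> (forall x, 0 <= f x) ->
  (\int[mu]_x (f x)%:E = v%:E)%E -> has_integral f v.
Proof.
move=> mf f0 fv; split=> //; apply/integrableP; split; first exact/measurable_EFinP.
under eq_integral do rewrite gee0_abs ?lee_fin//.
by rewrite fv ltry.
Qed.

Lemma has_integral_dom f g w : measurable_fun setT f -> has_integral g w ->
  (forall x, `|f x| <= g x) -> exists v, has_integral f v.
Proof.
move=> mf [Ig gw] fg.
have If : mu.-integrable setT (EFin \o f).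
  apply: le_integrable Ig => //; first exact/measurable_EFinP.
  by move=> x _; rewrite lee_fin (le_trans (fg x))// ler_norm.
exists (fine (\int[mu]_x (f x)%:E)); split=> //.
by rewrite fineK//; exact: integrable_fin_num.
Qed.

Lemma has_integral_unique f v w : has_integral f v -> has_integral f w -> v = w.
Proof. by move=> [_ fv] [_]; rewrite fv => -[]. Qed.

Section weighted.
Variable w : T -> R.
Hypothesis w0 : forall x, 0 <= w x.
Hypothesis w1 : has_integral w 1.

Definition wmean f : R := fine (\int[mu]_x (w x * f x)%:E).

Let mw : measurable_fun setT w.
Proof. by have [/measurable_int/measurable_EFinP] := w1. Qed.

Lemma has_integral_wmean f : bounded_meas f ->
  has_integral (fun x => w x * f x) (wmean f).
Proof.
move=> [mf [K fK]].
have mwf : measurable_fun setT (fun x => w x * f x) by exact: measurable_funM.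
have [x|v [Iv e]] := has_integral_dom mwf (has_integralZ K w1).
  by rewrite normrM ger0_norm// mulrC ler_wpM2r.
by split=> //; rewrite /wmean e.
Qed.

Lemma wmeanD f g : bounded_meas f -> bounded_meas g ->
  wmean (fun x => f x + g x) = wmean f + wmean g.
Proof.
move=> bf bg; apply: has_integral_unique (has_integral_wmean (bounded_measD bf bg)) _.
by have := has_integralD (has_integral_wmean bf) (has_integral_wmean bg);
  under eq_fun do rewrite -mulrDr.
Qed.

Lemma wmeanZ c f : bounded_meas f -> wmean (fun x => c * f x) = c * wmean f.
Proof.
move=> bf; apply: has_integral_unique (has_integral_wmean (bounded_measZ c bf)) _.
by have := has_integralZ c (has_integral_wmean bf); under eq_fun do rewrite mulrCA.
Qed.

Lemma wmean_cst c : wmean (cst c) = c.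
Proof.
apply: has_integral_unique (has_integral_wmean (bounded_meas_cst _ c)) _.
by have := has_integralZ c w1; rewrite mulr1; under eq_fun do rewrite mulrC.
Qed.

Lemma bounded_meas_sum (I : Type) (r : seq I) (f : I -> T -> R) :
  (forall i, bounded_meas (f i)) -> bounded_meas (fun x => \sum_(i <- r) f i x).
Proof.
move=> bf; elim: r => [|i r IH].
  by under eq_fun do rewrite big_nil; exact: bounded_meas_cst.
by under eq_fun do rewrite big_cons; exact: bounded_measD.
Qed.

Lemma wmean_sum (I : Type) (r : seq I) (f : I -> T -> R) :
  (forall i, bounded_meas (f i)) ->
  wmean (fun x => \sum_(i <- r) f i x) = \sum_(i <- r) wmean (f i).
Proof.
move=> bf; elim: r => [|i r IH].
  by under eq_fun do rewrite big_nil; rewrite big_nil; exact: wmean_cst.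
under eq_fun do rewrite big_cons; rewrite big_cons wmeanD ?IH//.
exact: bounded_meas_sum.
Qed.

Lemma wmean_le f g : bounded_meas f -> bounded_meas g -> (forall x, f x <= g x) ->
  wmean f <= wmean g.
Proof.
move=> bf bg fg; apply: has_integral_le (has_integral_wmean bf) (has_integral_wmean bg) _.
by move=> x; rewrite ler_wpM2l.
Qed.

Lemma wmean_norm f K : bounded_meas f -> (forall x, `|f x| <= K) -> `|wmean f| <= K.
Proof.
move=> bf fK; have fK' x : - K <= f x <= K by rewrite -ler_norml.
have hl := wmean_le (bounded_meas_cst _ (- K)) bf (fun x => (andP (fK' x)).1).
have hr := wmean_le bf (bounded_meas_cst _ K) (fun x => (andP (fK' x)).2).
by move: hl hr; rewrite !wmean_cst ler_norml => -> ->.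
Qed.

(** Jensen's inequality, obtained by averaging 2 c f <= c^2 + f^2 with [c] the mean. *)
Lemma wmean_sqr f : bounded_meas f -> wmean f ^+ 2 <= wmean (fun x => f x ^+ 2).
Proof.
move=> bf; set c := wmean f.
have bf2 := bounded_measX 2 bf.
have : wmean (fun x => (2 * c) * f x) <= wmean (fun x => c ^+ 2 + f x ^+ 2).
  apply: wmean_le => [||x]; first exact: bounded_measZ.
    by apply: bounded_measD => //; exact: bounded_meas_cst.
  by rewrite -subr_ge0; have := sqr_ge0 (f x - c); rewrite sqrrB; lra.
rewrite wmeanZ// (wmeanD (bounded_meas_cst _ (c ^+ 2)) bf2) wmean_cst -/c; lra.
Qed.

End weighted.
End has_integral.

Section difference_expansion.
Context (R : realType) (d : nat).
Implicit Types (f : 'rV[R]_d -> R) (x h : 'rV[R]_d).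

(** The r-th difference up to the sign (-1)^r, normalised so that the term [j = 0] is [f x]. *)
Definition alt_diff r h f x : R :=
  \sum_(j < r.+1) (-1) ^+ j * 'C(r, j)%:R * f (x + j%:R *: h).

Lemma alt_diffS r h f x : alt_diff r.+1 h f x = alt_diff r h f x - alt_diff r h f (x + h).
Proof.
rewrite {1}/alt_diff big_ord_recl/= ?bin0.
have -> : \sum_(i < r.+1) (-1) ^+ bump 0 i * 'C(r.+1, bump 0 i)%:R * f (x + (bump 0 i)%:R *: h) =
  \sum_(i < r.+1) ((-1) ^+ i.+1 * 'C(r, i.+1)%:R * f (x + i.+1%:R *: h) -
     (-1) ^+ i * 'C(r, i)%:R * f (x + h + i%:R *: h)).
  apply: eq_bigr => i _; rewrite /bump/= add1n binS natrD.
  have -> : x + h + i%:R *: h = x + i.+1%:R *: h by rewrite -addrA -nat1r scalerDl scale1r.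
  by rewrite exprS; ring.
rewrite sumrB addrA; congr (_ - _).
rewrite /alt_diff [RHS]big_ord_recl/= ?bin0; congr (_ + _).
rewrite big_ord_recr/= bin_small// mulr0 mul0r addr0.
by apply: eq_bigr => i _.
Qed.

Lemma iter_differenceE r h f x :
  iter r (difference h) f x = (-1) ^+ r * alt_diff r h f x.
Proof.
elim: r x => [|r IH] x.
  by rewrite /alt_diff big_ord_recl big_ord0/= expr0 bin0 !mul1r addr0 scale0r addr0.
by rewrite iterS/= {1}/difference !IH alt_diffS exprS; ring.
Qed.

End difference_expansion.

(** * Gaussian quadratic forms as squared norms in L_2 *)

Section gaussian_quadratic.
Context (R : realType) (d : nat).
Local Notation E := 'rV[R]_d.
Local Notation row := (@row_of_tuple R d).
Local Notation mu := (product_power (@lebesgue_measure R) d).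
Local Notation Tt := (d.-tuple (measurableTypeR R)).

Lemma measurable_gdens_row (beta c : R) (x : E) :
  measurable_fun [set: Tt] (fun t => gdens beta (c *: row t - x)).
Proof.
apply: (measurableT_comp (@measurable_gdens R d beta)).
by under eq_fun do rewrite addrC; exact: measurable_row_affine2.
Qed.

Lemma measurable_gdens_row1 (beta : R) (x : E) :
  measurable_fun [set: Tt] (fun t => gdens beta (row t - x)).
Proof. by have := measurable_gdens_row beta 1 x; under eq_fun do rewrite scale1r. Qed.

Lemma has_integral_gdens beta (x : E) : 0 < beta ->
  has_integral mu (fun t => gdens beta (row t - x)) 1.
Proof.
move=> b0; apply: has_integral_ge0; first exact: measurable_gdens_row1.
  by move=> t; exact: gdens_ge0.
exact: integral_gdens.
Qed.

Definition gquad (b : R) N (x : 'I_N -> E) (a : 'I_N -> R) : R :=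
  \sum_i \sum_k a i * a k * gdens b (x i - x k).

(** Two densities with parameter [beta] convolve to one with parameter [beta / 2], so the form at
    [beta / 2] is the squared L_2 norm of a combination of densities with parameter [beta]. *)
Lemma gquad_has_integral beta N (x : 'I_N -> E) (a : 'I_N -> R) : 0 < beta ->
  has_integral mu (fun t => (\sum_i a i * gdens beta (row t - x i)) ^+ 2)
    (gquad (beta / 2) x a).
Proof.
move=> b0.
have hik i k : has_integral mu (fun t => gdens beta (row t - x i) * gdens beta (row t - x k))
    (gdens (beta / 2) (x i - x k)).
  apply: has_integral_ge0.
  - by apply: measurable_funM; exact: measurable_gdens_row1.
  - by move=> t; rewrite mulr_ge0 ?gdens_ge0.
  have -> : gdens (beta / 2) (x i - x k) = gdens (beta * beta / (beta + beta)) (x k - x i).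
    by rewrite -gdensN opprB; congr gdens; field; rewrite gt_eqF ?addr_gt0.
  rewrite -(gdens_conv (x i) (x k) b0 b0); apply: eq_integral => t _.
  by rewrite -[X in _ * X]gdensN opprB.
have := has_integral_sum (index_enum 'I_N) (fun i => has_integral_sum (index_enum 'I_N)
  (fun k => has_integralZ (a i * a k) (hik i k))).
congr (has_integral _ _ _); apply/funext => t; rewrite expr2 mulr_suml.
by apply: eq_bigr => i _; rewrite mulr_sumr; apply: eq_bigr => k _; rewrite mulrACA.
Qed.

Lemma gquad_shift b N (x : 'I_N -> E) (v : E) (a : 'I_N -> R) :
  gquad b (fun i => x i + v) a = gquad b x a.
Proof.
apply: eq_bigr => i _; apply: eq_bigr => k _.
by rewrite opprD addrACA subrr addr0.
Qed.

Lemma gdens_le beta (z : E) : 0 <= beta -> gdens beta z <= Num.sqrt (beta / pi) ^+ d.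
Proof.
move=> b0; rewrite gdensE ler_piMr ?exprn_ge0 ?sqrtr_ge0//.
by rewrite expR_le1 oppr_le0 mulr_ge0 ?sqr_ge0.
Qed.

(* The wider Gaussian is the narrower one convolved with a third Gaussian, so
   Jensen and translation invariance compare the squared L2 norms. *)
Lemma gquad_mono b beta N (x : 'I_N -> E) (a : 'I_N -> R) : 0 < b < beta ->
  gquad (b / 2) x a <= gquad (beta / 2) x a.
Proof.
move=> /andP[b0 bb]; have beta0 : 0 < beta by exact: lt_trans bb.
(* Solves 1/q + 1/beta = 1/b, so that the density for [b] is the one for [beta] convolved with the
   one for [q]. *)
pose q := b * beta / (beta - b).
have q0 : 0 < q by rewrite divr_gt0 ?mulr_gt0// subr_gt0.
have qb : q * beta / (q + beta) = b.
  rewrite /q; field.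
  have bb' : beta - b != 0 by rewrite gt_eqF// subr_gt0.
  rewrite bb'/=; have -> : b * beta + beta * (beta - b) = beta ^+ 2 by ring.
  by rewrite expf_neq0// gt_eqF.
pose A (z : E) := \sum_i a i * gdens beta (z - x i).
have mA : measurable_fun [set: E] A.
  apply: (@measurable_sum _ _ _ _ _ _ (fun i (z : E) => a i * gdens beta (z - x i))) => i.
  apply: measurable_funM => //; apply: (measurableT_comp (@measurable_gdens R d beta)).
  apply: measurable_to_row => l; under eq_fun do rewrite !mxE.
  by apply: measurable_funB => //; exact: measurable_coord.
have bA : exists K, forall z, `|A z| <= K.
  exists (\sum_i `|a i| * Num.sqrt (beta / pi) ^+ d) => z.
  apply: le_trans (ler_norm_sum _ _ _) _; apply: ler_sum => i _.
  by rewrite normrM ler_wpM2l// ger0_norm ?gdens_ge0 ?gdens_le ?(ltW beta0).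
have w1 := has_integral_gdens (0 : E) q0.
pose w (t : Tt) := gdens q (row t - 0).
have w0 t : 0 <= w t by exact: gdens_ge0.
have mzt (z : E) : measurable_fun [set: Tt] (fun t => z - row t).
  have := measurable_row_affine2 (-1) z.
  by under eq_fun do rewrite scaleN1r.
have bAz (z : E) : bounded_meas (fun t : Tt => A (z - row t)).
  split; first exact: (measurableT_comp mA (mzt z)).
  by have [K AK] := bA; exists K => t; exact: AK.
have SE (z : E) : \sum_i a i * gdens b (z - x i) = wmean mu w (fun t => A (z - row t)).
  apply: has_integral_unique (has_integral_wmean w0 w1 (bAz z)).
  have hi i : has_integral mu (fun t => w t * gdens beta (z - row t - x i)) (gdens b (z - x i)).
    apply: has_integral_ge0.
    - apply: measurable_funM; first exact: measurable_gdens_row1.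
      apply: (measurableT_comp (@measurable_gdens R d beta)).
      have := measurable_row_affine2 (-1) (z - x i).
      by under eq_fun do rewrite scaleN1r addrAC.
    - by move=> t; rewrite mulr_ge0 ?gdens_ge0.
    have := gdens_conv 0 (z - x i) q0 beta0; rewrite qb subr0 => <-.
    by apply: eq_integral => t _; rewrite /w addrAC.
  have := has_integral_sum (index_enum 'I_N) (fun i => has_integralZ (a i) (hi i)).
  congr (has_integral _ _ _); apply/funext => t; rewrite /A mulr_sumr.
  by apply: eq_bigr => i _; rewrite mulrCA.
have hb := (gquad_has_integral x a b0).2.
rewrite -lee_fin -hb.
apply: (@le_trans _ _ (\int[mu]_s \int[mu]_t (w t * A (row s - row t) ^+ 2)%:E)%E).
  have mAst : measurable_fun [set: Tt * Tt] (fun z => (w z.2 * A (row z.1 - row z.2) ^+ 2)%:E).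
    apply/measurable_EFinP; apply: measurable_funM.
      by apply: (measurableT_comp (measurable_gdens_row1 q 0)); exact: measurable_snd.
    apply: measurable_funX; apply: (measurableT_comp mA).
    apply: measurable_to_row => l; under eq_fun do rewrite !mxE.
    apply: measurable_funB.
      by apply: (measurableT_comp (measurable_tnth l)); exact: measurable_fst.
    by apply: (measurableT_comp (measurable_tnth l)); exact: measurable_snd.
  apply: ge0_le_integral => //.
  - by move=> s _; rewrite lee_fin sqr_ge0.
  - have [/integrableP[mI _] _] := gquad_has_integral x a b0.
    exact: mI.
  - have := @measurable_fun_fubini_tonelli_F _ _ _ _ R mu
      (fun z : Tt * Tt => (w z.2 * A (row z.1 - row z.2) ^+ 2)%:E).
    apply => // z; by rewrite lee_fin mulr_ge0 ?sqr_ge0.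
  move=> s _; rewrite SE; apply: (@le_trans _ _ (wmean mu w (fun t => A (row s - row t) ^+ 2))%:E).
    by rewrite lee_fin; exact: wmean_sqr.
  by rewrite (has_integral_wmean w0 w1 (bounded_measX 2 (bAz (row s)))).2.
have mA2 : measurable_fun [set: Tt * Tt] (fun z => (w z.2 * A (row z.1 - row z.2) ^+ 2)%:E).
  apply/measurable_EFinP; apply: measurable_funM.
    by apply: (measurableT_comp (measurable_gdens_row1 q 0)); exact: measurable_snd.
  apply: measurable_funX; apply: (measurableT_comp mA).
  apply: measurable_to_row => l; under eq_fun do rewrite !mxE.
  apply: measurable_funB.
    by apply: (measurableT_comp (measurable_tnth l)); exact: measurable_fst.
  by apply: (measurableT_comp (measurable_tnth l)); exact: measurable_snd.
rewrite (fubini_tonelli (fun z => (w z.2 * A (row z.1 - row z.2) ^+ 2)%:E) mA2); last first.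
  by move=> z; rewrite lee_fin mulr_ge0 ?sqr_ge0.
rewrite /=.
under eq_integral => t _.
  under eq_integral do rewrite EFinM.
  rewrite ge0_integralZl ?lee_fin//; first last.
  - by move=> s _; rewrite lee_fin sqr_ge0.
  - apply/measurable_EFinP; apply: measurable_funX; apply: (measurableT_comp mA).
    apply: measurable_to_row => l; under eq_fun do rewrite !mxE.
    by apply: measurable_funB => //; exact: measurable_tnth.
  (* Moving all centres by [row t] shows that the inner integral is the same for every [t]. *)
  have -> : (\int[mu]_s (A (row s - row t) ^+ 2)%:E = (gquad (beta / 2) x a)%:E)%E.
    rewrite -(gquad_shift _ x (row t)) -(gquad_has_integral _ a beta0).2.
    apply: eq_integral => s _; rewrite /A; congr ((_ ^+ 2)%:E).
    by apply: eq_bigr => i _; congr (_ * gdens _ _); rewrite opprD addrA [RHS]addrAC.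
  rewrite -EFinM mulrC; over.
by rewrite /= (has_integralZ _ w1).2 mulr1.
Qed.

End gaussian_quadratic.

(** * The smoothed comparison function *)

Section smoothing.
Context (R : realType) (d : nat).
Local Notation E := 'rV[R]_d.
Local Notation row := (@row_of_tuple R d).
Local Notation mu := (product_power (@lebesgue_measure R) d).
Local Notation Tt := (d.-tuple (measurableTypeR R)).
Variables (f : E -> R) (C1 C2 : R).
Hypotheses (mf : measurable_fun [set: E] f) (C20 : 0 <= C2).
Hypothesis f_L2 : (\int[mu]_t (f (row t) ^+ 2)%:E <= (C1 ^+ 2)%:E)%E.
Hypothesis f_Loo : (\int[mu]_t (\1_[set z | (C2 < `|f z|)%R] (row t) : R)%:E = 0)%E.

(* [f] is bounded only almost everywhere; clipping makes it bounded. *)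
Let ft (z : E) : R := clipr C2 (f z).

Let mft : measurable_fun [set: E] ft.
Proof. by apply: (measurableT_comp (measurable_clipr C2)). Qed.

Let ftC z : `|ft z| <= C2.
Proof. exact: clipr_bound. Qed.

Let m1 (x : E) (j : R) : measurable_fun [set: Tt] (fun t => x + j *: row t).
Proof. exact: measurable_row_affine2. Qed.

Let bft (x : E) j : bounded_meas (fun t : Tt => ft (x + j *: row t)).
Proof. by split; [exact: (measurableT_comp mft (m1 x j))|exists C2 => t; exact: ftC]. Qed.

Let bft0 : bounded_meas (fun t : Tt => ft (row t)).
Proof.
by split; [exact: (measurableT_comp mft (@measurable_row R d))|exists C2 => t; exact: ftC].
Qed.

Definition smooth_at beta (x : E) : R :=
  wmean mu (fun t => gdens beta (row t - x)) (fun t => ft (row t)).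

Lemma smooth_at_dilate beta (j : R) (x : E) : 0 < beta -> 0 < j ->
  smooth_at (beta / j ^+ 2) x =
  wmean mu (fun t => gdens beta (row t)) (fun t => ft (x + j *: row t)).
Proof.
move=> b0 j0; have bj0 : 0 < beta / j ^+ 2 by rewrite divr_gt0 ?exprn_gt0.
have w0 b (y : E) (t : Tt) : 0 <= gdens b (row t - y) by exact: gdens_ge0.
have w0' (t : Tt) : 0 <= gdens beta (row t) by exact: gdens_ge0.
have w1 := has_integral_gdens x bj0.
have w1' : has_integral mu (fun t => gdens beta (row t)) 1.
  by have := has_integral_gdens (0 : E) b0; under eq_fun do rewrite subr0.
have bc g : bounded_meas g -> bounded_meas (fun t : Tt => g t + C2).
  by move=> bg; apply: bounded_measD => //; exact: bounded_meas_cst.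
(* Adding [C2] makes the integrands nonnegative, as [gdens_dilate] demands. *)
apply: (addIr C2); rewrite /smooth_at.
rewrite -[X in _ + X = _](wmean_cst (w0 _ x) w1) -[X in _ = _ + X](wmean_cst w0' w1').
rewrite -(wmeanD (w0 _ x) w1 bft0 (bounded_meas_cst _ C2)).
rewrite -(wmeanD w0' w1' (bft x j) (bounded_meas_cst _ C2)).
apply: EFin_inj.
rewrite -(has_integral_wmean (w0 _ x) w1 (bc _ bft0)).2.
rewrite -(has_integral_wmean w0' w1' (bc _ (bft x j))).2.
have := gdens_dilate beta x j0 (F := fun z => (ft z + C2)%:E) _ _.
move=> h; under eq_integral do rewrite EFinM.
under [in RHS]eq_integral do rewrite EFinM.
rewrite h// => [|z].
  by apply/measurable_EFinP; apply: measurable_funD.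
by rewrite lee_fin; have := ftC z; rewrite ler_norml => /andP[]; lra.
Qed.

(** Young's inequality with weight [eta] under the integral: the sum on the left is the integral of
    a combination of densities times the clipped [f], whose squared norms are [gquad] and at most
    [C1 ^+ 2]. *)
Lemma smooth_at_quad beta N (x : 'I_N -> E) (a : 'I_N -> R) (u eta : R) :
  0 < beta -> 0 < eta ->
  2 * (u * \sum_i a i * smooth_at beta (x i)) <=
  eta * gquad (beta / 2) x a + u ^+ 2 / eta * C1 ^+ 2.
Proof.
move=> b0 eta0.
have hA i := has_integral_wmean (fun t => gdens_ge0 beta (row t - x i))
  (has_integral_gdens (x i) b0) bft0.
have hS := has_integralZ (2 * u) (has_integral_sum (index_enum 'I_N)
  (fun i => has_integralZ (a i) (hA i))).
have hq := has_integralZ eta (gquad_has_integral x a b0).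
have mft2 : measurable_fun [set: Tt] (fun t => ft (row t) ^+ 2).
  by apply: measurable_funX; have [] := bft0.
have mf2 : measurable_fun [set: Tt] (fun t => f (row t) ^+ 2).
  by apply: measurable_funX; exact: (measurableT_comp mf (@measurable_row R d)).
have le1 : (\int[mu]_t (ft (row t) ^+ 2)%:E <= (C1 ^+ 2)%:E)%E.
  apply: le_trans f_L2; apply: ge0_le_integral => //.
  - by move=> t _; rewrite lee_fin sqr_ge0.
  - exact/measurable_EFinP.
  - exact/measurable_EFinP.
  move=> t _; rewrite lee_fin.
  have := clipr_closer C20 (f (row t)) (y := 0); rewrite normr0 => /(_ C20).
  by rewrite !sub0r !sqrrN; apply: le_trans; rewrite lerDl sqr_ge0.
have [v hv] : exists v, has_integral mu (fun t => ft (row t) ^+ 2) v.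
  exists (fine (\int[mu]_t (ft (row t) ^+ 2)%:E)); apply: has_integral_ge0 => //.
    by move=> t; exact: sqr_ge0.
  rewrite fineK// ge0_fin_numE ?(le_lt_trans le1) ?ltry//.
  by apply: integral_ge0 => t _; rewrite lee_fin sqr_ge0.
have vC : v <= C1 ^+ 2 by rewrite -lee_fin -hv.2.
have hr := has_integralD hq (has_integralZ (u ^+ 2 / eta) hv).
have := has_integral_le hS hr _; rewrite -mulrA => h.
apply: (@le_trans _ _ (eta * gquad (beta / 2) x a + u ^+ 2 / eta * v)); last first.
  by rewrite lerD2l ler_wpM2l// divr_ge0 ?sqr_ge0 ?ltW.
apply: h => t.
have -> : \sum_(i <- index_enum 'I_N) a i * (gdens beta (row t - x i) * ft (row t)) =
   (\sum_i a i * gdens beta (row t - x i)) * ft (row t).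
  by rewrite mulr_suml; apply: eq_bigr => i _; rewrite mulrA.
set S := \sum_i _; set F := ft _.
have e0 : eta != 0 by rewrite gt_eqF.
rewrite -subr_ge0.
have -> : eta * S ^+ 2 + u ^+ 2 / eta * F ^+ 2 - 2 * u * (S * F) =
   eta * (S - u / eta * F) ^+ 2 by field.
by rewrite mulr_ge0 ?sqr_ge0// ltW.
Qed.

Variables (r : nat) (gamma : R).
Hypotheses (r0 : (0 < r)%N) (gamma0 : 0 < gamma).

(** With this parameter [gdens] is a multiple of the Gaussian kernel of width [gamma], and [gquad] a
    multiple of its Gram form. *)
Let beta0 : R := (gamma ^+ 2)^-1.
Let beta0_gt0 : 0 < beta0. Proof. by rewrite invr_gt0 exprn_gt0. Qed.

(** The index [j] stands for the multiple [j + 1] of the step; with these signs, [f x] minus the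
    combination is [alt_diff]. *)
Definition smooth_coef (j : 'I_r) : R := (-1) ^+ j * 'C(r, j.+1)%:R.

Definition smoothed (x : E) : R :=
  \sum_(j < r) smooth_coef j * smooth_at (beta0 / j.+1%:R ^+ 2) x.

Let w (t : Tt) : R := gdens beta0 (row t).
Let w0 t : 0 <= w t. Proof. exact: gdens_ge0. Qed.
Let w1 : has_integral mu w 1.
Proof. by have := has_integral_gdens (0 : E) beta0_gt0; under eq_fun do rewrite subr0. Qed.

Lemma smoothedE x : smoothed x =
  wmean mu w (fun t => \sum_(j < r) smooth_coef j * ft (x + j.+1%:R *: row t)).
Proof.
rewrite wmean_sum//; last by move=> j; exact: bounded_measZ.
apply: eq_bigr => j _; rewrite (wmeanZ w0 w1 _ (bft x j.+1%:R)).
by rewrite smooth_at_dilate.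
Qed.

Definition smooth_const : R := \sum_(j < r) `|smooth_coef j|.

Let sum_bound x t :
  `|\sum_(j < r) smooth_coef j * ft (x + j.+1%:R *: row t)| <= smooth_const * C2.
Proof.
apply: le_trans (ler_norm_sum _ _ _) _; rewrite /smooth_const mulr_suml.
by apply: ler_sum => j _; rewrite normrM ler_wpM2l.
Qed.

Let bsum x : bounded_meas (fun t => \sum_(j < r) smooth_coef j * ft (x + j.+1%:R *: row t)).
Proof. by apply: bounded_meas_sum => j; exact: bounded_measZ. Qed.

Lemma smoothed_bound x : `|smoothed x| <= smooth_const * C2.
Proof. by rewrite smoothedE; apply: wmean_norm => // t; exact: sum_bound. Qed.

Lemma measurable_smoothed : measurable_fun [set: E] smoothed.
Proof.
(* The constant makes the integrand nonnegative, so that Tonelli yields measurability; it is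
   subtracted again afterwards. *)
pose F (z : E * Tt) : R := w z.2 *
  (\sum_(j < r) smooth_coef j * ft (z.1 + j.+1%:R *: row z.2) + smooth_const * C2).
have mw : measurable_fun [set: Tt] w.
  have := measurable_gdens_row1 beta0 (0 : E); by under eq_fun do rewrite subr0.
have mF : measurable_fun [set: E * Tt] (fun z => (F z)%:E).
  apply/measurable_EFinP; apply: measurable_funM.
    by apply: (measurableT_comp mw); exact: measurable_snd.
  apply: measurable_funD => //.
  apply: (@measurable_sum _ _ _ _ _ _ (fun (j : 'I_r) (z : E * Tt) =>
    smooth_coef j * ft (z.1 + j.+1%:R *: row z.2))) => j.
  apply: measurable_funM => //; apply: (measurableT_comp mft).
  exact: measurable_row_affine.
have F0 z : (0 <= (F z)%:E)%E.
  rewrite lee_fin mulr_ge0//; have := sum_bound z.1 z.2.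
  by rewrite ler_norml => /andP[]; lra.
have e x : smoothed x = fine (\int[mu]_t (F (x, t))%:E)%E - smooth_const * C2.
  apply/eqP; rewrite -subr_eq opprK; apply/eqP.
  rewrite smoothedE -[X in _ + X](wmean_cst w0 w1) -(wmeanD w0 w1 (bsum x) (bounded_meas_cst _ _)).
  by [].
rewrite (_ : smoothed = fun x => fine (\int[mu]_t (F (x, t))%:E)%E - smooth_const * C2);
  last exact/funext.
apply: measurable_funB => //; apply: measurableT_comp => //.
by have := @measurable_fun_fubini_tonelli_F _ _ _ _ R mu (fun z => (F z)%:E); apply.
Qed.

Lemma bmeas_smoothed : bmeas smoothed.
Proof.
by split; [exact: measurable_smoothed|exists (smooth_const * C2) => x; exact: smoothed_bound].
Qed.

Lemma gquad_gram N (x : 'I_N -> E) (a : 'I_N -> R) :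
  gquad beta0 x a = Num.sqrt (beta0 / pi) ^+ d *
    \sum_i \sum_k a i * a k * gaussian_kernel gamma (x i) (x k).
Proof.
rewrite mulr_sumr; apply: eq_bigr => i _; rewrite mulr_sumr; apply: eq_bigr => k _.
rewrite gdensE mulrCA; congr (_ * (_ * expR _)).
by rewrite /gaussian_kernel mulNr.
Qed.

Lemma smoothed_quad N (x : 'I_N -> E) (a : 'I_N -> R) :
  2 * \sum_i a i * smoothed (x i) <=
  \sum_i \sum_k a i * a k * gaussian_kernel gamma (x i) (x k) +
  Num.sqrt (beta0 / pi) ^+ d * r%:R * (\sum_(j < r) smooth_coef j ^+ 2) * C1 ^+ 2.
Proof.
set kap := Num.sqrt _ ^+ d; set K := \sum_i \sum_k _.
have kap0 : 0 < kap by rewrite exprn_gt0// sqrtr_gt0 divr_gt0// pi_gt0.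
have r0' : 0 < r%:R :> R by rewrite ltr0n.
(* With this weight the [r] contributions of the Gram form, each of size [kap * K] times the weight,
   add up to [K]. *)
have eta0 : 0 < (r%:R * kap)^-1 by rewrite invr_gt0 mulr_gt0.
have -> : \sum_i a i * smoothed (x i) =
    \sum_(j < r) smooth_coef j * \sum_i a i * smooth_at (beta0 / j.+1%:R ^+ 2) (x i).
  rewrite /smoothed; under eq_bigr do rewrite mulr_sumr.
  rewrite exchange_big/=; apply: eq_bigr => j _; rewrite mulr_sumr.
  by apply: eq_bigr => i _; rewrite mulrCA.
rewrite mulr_sumr; apply: (@le_trans _ _ (\sum_(j < r)
    ((r%:R * kap)^-1 * (kap * K) + smooth_coef j ^+ 2 / (r%:R * kap)^-1 * C1 ^+ 2))).
  apply: ler_sum => j _.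
  have j0 : 0 < j.+1%:R :> R by rewrite ltr0n.
  have bj0 : 0 < beta0 / j.+1%:R ^+ 2 by rewrite divr_gt0 ?exprn_gt0.
  apply: le_trans (smooth_at_quad x a (smooth_coef j) bj0 eta0) _.
  rewrite lerD2r ler_pM2l// -gquad_gram.
  (* The parameter [2 * beta0] is the one whose half is [beta0], so [gquad_mono] leads to the Gram
     form of the kernel itself. *)
  have lt2 : 0 < beta0 / j.+1%:R ^+ 2 < 2 * beta0.
    rewrite bj0/= ltr_pdivrMr ?exprn_gt0//.
    apply: (@lt_le_trans _ _ (2 * beta0)); first by rewrite ltr_pMl// ltr1n.
    by rewrite ler_peMr ?mulr_ge0 ?(ltW beta0_gt0)// -natrX ler1n expn_gt0.
  have := gquad_mono x a lt2.
  by have -> : 2 * beta0 / 2 = beta0 by field.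
rewrite big_split/= sumr_const card_ord -mulr_suml -mulr_suml invrK.
apply: le_of_eq; congr (_ + _); last by ring.
by rewrite -mulr_natl; field; rewrite !gt_eqF.
Qed.

(** Jensen's inequality, followed by replacing the clipped values by those of [f]. The estimate
    holds at every [x]: the term [f x] was never clipped, and the shifted points avoid the
    exceptional null set for almost every step. *)
Lemma smoothed_error (x : E) : (((f x - smoothed x) ^+ 2)%:E <=
  \int[mu]_t (gdens beta0 (row t) * alt_diff r (row t) f x ^+ 2)%:E)%E.
Proof.
pose D t := (\sum_(j < r) smooth_coef j * ft (x + j.+1%:R *: row t)) + (- f x).
have bD : bounded_meas D by apply: bounded_measD => //; exact: bounded_meas_cst.
have -> : (f x - smoothed x) ^+ 2 = wmean mu w D ^+ 2.
  rewrite (wmeanD w0 w1 (bsum x) (bounded_meas_cst _ (- f x))) wmean_cst// -smoothedE.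
  by ring.
apply: (@le_trans _ _ (wmean mu w (fun t => D t ^+ 2))%:E).
  by rewrite lee_fin; exact: wmean_sqr.
rewrite -(has_integral_wmean w0 w1 (bounded_measX 2 bD)).2.
have mw : measurable_fun [set: Tt] w.
  have := measurable_gdens_row1 beta0 (0 : E); by under eq_fun do rewrite subr0.
pose Z := [set z : E | (C2 < `|f z|)%R].
have mZ : measurable Z.
  rewrite -[Z]setTI (_ : Z = (fun z => `|f z|) @^-1` `]C2, +oo[).
    by apply: (measurableT_comp (@normr_measurable R setT) mf).
  by apply/seteqP; split=> z; rewrite /Z/= in_itv/= andbT.
pose B (j : 'I_r) := [set t : Tt | Z (x + j.+1%:R *: row t)].
have mB j : measurable (B j).
  by rewrite -[B j]setTI; exact: (m1 x j.+1%:R measurableT mZ).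
have B0 j : (mu (B j) <= 0%:E)%E.
  have -> : mu (B j) = (\int[mu]_t (\1_Z (x + j.+1%:R *: row t) : R)%:E)%E.
    by rewrite -[B j]setIT -(integral_indic mu measurableT (mB j)).
  have j0 : 0 < j.+1%:R :> R by rewrite ltr0n.
  have := ge0_integral_row_affine x j0 (F := fun z => (\1_Z z : R)%:E) _ _.
  rewrite f_Loo mule0 => ->//.
  by apply/measurable_EFinP; exact: measurable_indic.
have [mU U0] := measure_finite_union_le mB B0.
apply: le_of_eq; apply: ge0_ae_eq_integral => //.
- by apply/measurable_EFinP; apply: measurable_funM => //; apply: measurable_funX; exact: bD.1.
- apply/measurable_EFinP; apply: measurable_funM => //; apply: measurable_funX.
  apply: (@measurable_sum _ _ _ _ _ _ (fun (j : 'I_r.+1) (t : Tt) =>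
    (-1) ^+ j * 'C(r, j)%:R * f (x + j%:R *: row t))) => j.
  by apply: measurable_funM => //; apply: (measurableT_comp mf); exact: m1.
- by move=> t _; rewrite lee_fin mulr_ge0 ?sqr_ge0 ?gdens_ge0.
- by move=> t _; rewrite lee_fin mulr_ge0 ?sqr_ge0 ?gdens_ge0.
exists [set t | exists j, B j t]; split=> //.
  by apply/eqP; rewrite eq_le measure_ge0 andbT; move: U0; rewrite mulr0.
move=> t /= nt; apply: contrapT => /forallNP nB; apply: nt => _.
congr (_ * _)%:E; rewrite /alt_diff big_ord_recl/= bin0 scale0r addr0 expr0 !mul1r.
have -> : D t = - (f x + \sum_(i < r) (-1) ^+ bump 0 i * 'C(r, bump 0 i)%:R *
    f (x + (bump 0 i)%:R *: row t)); last by rewrite sqrrN.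
rewrite /D opprD addrC; congr (_ + _); rewrite -sumrN; apply: eq_bigr => j _.
rewrite /bump/= add1n /smooth_coef exprS mulN1r !mulNr opprK; congr (_ * _).
apply: clipr_id => //; rewrite leNgt; apply/negP => h; exact: (nB j).
Qed.

Variables (Q : probability E R) (alpha C3 Ca : R).
Hypothesis alpha0 : 0 < alpha.
Hypothesis f_besov : forall h : E, (\int[Q]_x (alt_diff r h f x ^+ 2)%:E <=
  (C3 ^+ 2 * enorm h `^ (2 * alpha))%:E)%E.
Hypothesis CaP : forall u : R, 0 <= u -> u `^ (2 * alpha) <= Ca * expR (u ^+ 2 / 2).

(** After Tonelli the Besov bound applies for each fixed step. Half of the Gaussian exponent absorbs
    the factor |h|^(2 alpha), via [CaP] at u = |h| / gamma; the other half is a density with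
    parameter [beta0 / 2], and the change of normalisation gives sqrt(2)^d. *)
Lemma smoothed_L2_error :
  (\int[Q]_x ((f x - smoothed x) ^+ 2)%:E <=
   (C3 ^+ 2 * Ca * Num.sqrt 2 ^+ d * gamma `^ (2 * alpha))%:E)%E.
Proof.
pose G (z : E * Tt) : \bar R := (gdens beta0 (row z.2) * alt_diff r (row z.2) f z.1 ^+ 2)%:E.
have mw : measurable_fun [set: Tt] w.
  have := measurable_gdens_row1 beta0 (0 : E); by under eq_fun do rewrite subr0.
have mG : measurable_fun [set: E * Tt] G.
  apply/measurable_EFinP; apply: measurable_funM.
    by apply: (measurableT_comp mw); exact: measurable_snd.
  apply: measurable_funX; apply: (@measurable_sum _ _ _ _ _ _ (fun (j : 'I_r.+1) (z : E * Tt) =>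
    (-1) ^+ j * 'C(r, j)%:R * f (z.1 + j%:R *: row z.2))) => j.
  apply: measurable_funM => //; apply: (measurableT_comp mf).
  exact: measurable_row_affine.
have G0 z : (0 <= G z)%E by rewrite lee_fin mulr_ge0 ?sqr_ge0 ?gdens_ge0.
apply: (@le_trans _ _ (\int[Q]_x \int[mu]_t G (x, t))%E).
  apply: ge0_le_integral => //.
  - by move=> x _; rewrite lee_fin sqr_ge0.
  - apply/measurable_EFinP; apply: measurable_funX; apply: measurable_funB => //.
    exact: measurable_smoothed.
  - by have := @measurable_fun_fubini_tonelli_F _ _ _ _ R mu G; apply.
  by move=> x _; exact: smoothed_error.
rewrite (fubini_tonelli G mG G0).
have mfx (h : E) : measurable_fun [set: E] (fun x => (alt_diff r h f x ^+ 2)%:E).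
  apply/measurable_EFinP; apply: measurable_funX.
  apply: (@measurable_sum _ _ _ _ _ _ (fun (j : 'I_r.+1) (x : E) =>
    (-1) ^+ j * 'C(r, j)%:R * f (x + j%:R *: h))) => j.
  apply: measurable_funM => //; apply: (measurableT_comp mf).
  apply: measurable_to_row => i; under eq_fun do rewrite !mxE.
  by apply: measurable_funD => //; exact: measurable_coord.
pose c := C3 ^+ 2 * gamma `^ (2 * alpha) * Ca * Num.sqrt 2 ^+ d.
have b2 : 0 < beta0 / 2 by rewrite divr_gt0.
apply: (@le_trans _ _ (\int[mu]_t (c%:E * (gdens (beta0 / 2) (row t - 0))%:E))%E).
  apply: ge0_le_integral => //.
  - by move=> t _; apply: integral_ge0.
  - by have := @measurable_fun_fubini_tonelli_G _ _ _ _ R Q G; apply.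
  - by apply: measurable_funeM; apply/measurable_EFinP; exact: measurable_gdens_row1.
  move=> t _; rewrite /G/=.
  under eq_integral do rewrite EFinM.
  rewrite ge0_integralZl ?lee_fin ?gdens_ge0//; last by move=> x _; rewrite lee_fin sqr_ge0.
  apply: (@le_trans _ _ ((gdens beta0 (row t))%:E *
      (C3 ^+ 2 * enorm (row t) `^ (2 * alpha))%:E)%E).
    by apply: lee_wpmul2l => //; rewrite lee_fin gdens_ge0.
  rewrite -!EFinM lee_fin subr0.
  have h1 : enorm (row t) `^ (2 * alpha) <=
      gamma `^ (2 * alpha) * (Ca * expR (beta0 / 2 * enorm (row t) ^+ 2)).
    have u0 : 0 <= enorm (row t) / gamma by rewrite divr_ge0 ?enorm_ge0 ?ltW.
    have := CaP u0; rewrite expr_div_n.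
    have -> : enorm (row t) ^+ 2 / gamma ^+ 2 / 2 = beta0 / 2 * enorm (row t) ^+ 2.
      by rewrite /beta0; ring.
    move=> h; rewrite -[X in X `^ _](divfK (lt0r_neq0 gamma0)) powRM ?(ltW gamma0)//.
    by rewrite [leLHS]mulrC ler_wpM2l ?powR_ge0.
  apply: (@le_trans _ _ (gdens beta0 (row t) * (C3 ^+ 2 *
      (gamma `^ (2 * alpha) * (Ca * expR (beta0 / 2 * enorm (row t) ^+ 2)))))).
    by rewrite ler_wpM2l ?gdens_ge0// ler_wpM2l ?sqr_ge0.
  apply: le_of_eq; rewrite /c !gdensE.
  have -> : Num.sqrt (beta0 / pi) = Num.sqrt 2 * Num.sqrt (beta0 / 2 / pi).
    by rewrite -sqrtrM//; congr Num.sqrt; rewrite [RHS]mulrA; congr (_ / _); field.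
  rewrite exprMn.
  have -> : expR (- (beta0 * enorm (row t) ^+ 2)) = expR (- (beta0 / 2 * enorm (row t) ^+ 2)) *
      expR (- (beta0 / 2 * enorm (row t) ^+ 2)).
    by rewrite -expRD; congr expR; field.
  have : expR (- (beta0 / 2 * enorm (row t) ^+ 2)) * expR (beta0 / 2 * enorm (row t) ^+ 2) = 1.
    by rewrite -expRD addNr expR0.
  set e1 := expR (- _); set e2 := expR _ => e12.
  rewrite [LHS](_ : _ = C3 ^+ 2 * gamma `^ (2 * alpha) * Ca * Num.sqrt 2 ^+ d *
    (Num.sqrt (beta0 / 2 / pi) ^+ d * e1) * (e1 * e2)); last by ring.
  by rewrite e12 mulr1.
have := (has_integralZ c (has_integral_gdens (0 : E) b2)).2.
under eq_integral do rewrite EFinM.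
move=> ->; rewrite mulr1 lee_fin; apply: le_of_eq; rewrite /c; ring.
Qed.

End smoothing.

(** * The learning rate *)

Section Lnorm_bounds.
Context dT (T : measurableType dT) (R : realType) (mu : {measure set T -> \bar R}).
Local Open Scope ereal_scope.

Lemma Lnorm2_le (f : T -> R) (c : R) : 'N[mu]_2%:E [EFin \o f] <= c%:E ->
  \int[mu]_x (f x ^+ 2)%:E <= (c ^+ 2)%:E.
Proof.
move=> h; have n0 : 0 <= 'N[mu]_2%:E [EFin \o f] by exact: Lnorm_ge0.
have /fineK nE : 'N[mu]_2%:E [EFin \o f] \is a fin_num.
  by rewrite ge0_fin_numE// (le_lt_trans h)// ltry.
have -> : \int[mu]_x (f x ^+ 2)%:E = 'N[mu]_2%:E [EFin \o f] `^ 2.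
  rewrite powR_Lnorm//; apply: eq_integral => x _ /=.
  by rewrite powR_mulrn// real_normK ?num_real.
rewrite -nE poweR_EFin lee_fin powR_mulrn ?fine_ge0//.
by rewrite lerXn2r// ?nnegrE ?fine_ge0// -?lee_fin ?nE// (le_trans n0).
Qed.

Lemma measurable_norm_gt (f : T -> R) (c : R) : measurable_fun setT f ->
  measurable [set x | (c < `|f x|)%R].
Proof.
move=> mf; rewrite -[X in measurable X]setTI.
rewrite (_ : [set x | _] = (fun x => `|f x|)%R @^-1` `]c, +oo[%classic).
  by apply: (measurableT_comp (@normr_measurable R setT) mf).
by apply/seteqP; split=> z; rewrite /= in_itv/= andbT.
Qed.

Lemma Lnormoo_le (f : T -> R) (c : R) : measurable_fun setT f ->
  'N[mu]_+oo [EFin \o f] <= c%:E ->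
  mu [set x | (c < `|f x|)%R] = 0.
Proof.
move=> mf; rewrite unlock /=; case: ifPn => [mu0 /ess_supP[N [mN N0 fN]]|mu0 _].
  apply/eqP; rewrite eq_le measure_ge0 andbT -N0; apply: le_measure; rewrite ?inE//.
    exact: measurable_norm_gt.
  by move=> x /= cx; apply: fN => /=; rewrite lee_fin; apply/negP; rewrite -ltNge.
(* If [mu] vanishes, the norm carries no information, but every set is null. *)
apply/eqP; rewrite eq_le measure_ge0 andbT.
apply: le_trans (_ : mu setT <= 0); last by rewrite leNgt.
apply: le_measure; rewrite ?inE//.
exact: measurable_norm_gt.
Qed.

End Lnorm_bounds.

Section problem_facts.
Context (R : realType) (d : nat).
Local Notation E := 'rV[R]_d.
Local Notation Rm := (measurableTypeR R).
Local Notation row := (@row_of_tuple R d).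
Local Notation mu := (product_power (@lebesgue_measure R) d).

Lemma ge0_integral_lebesgue_row (F : E -> \bar R) :
  measurable_fun [set: E] F -> (forall z, 0 <= F z)%E ->
  (\int[@lebesgue_row R d]_z F z = \int[mu]_t F (row t))%E.
Proof.
move=> mF F0.
rewrite (eq_measure_integral (pushforward mu row))//.
rewrite ge0_integral_pushforward//.
Qed.

Lemma besov_difference (mu0 : {measure set E -> \bar R}) (alpha C3 : R) (f : E -> R) (h : E) :
  0 < alpha -> (besov_seminorm mu0 alpha f <= C3%:E)%E ->
  (\int[mu0]_x (alt_diff (Num.truncn alpha).+1 h f x ^+ 2)%:E <=
   (C3 ^+ 2 * enorm h `^ (2 * alpha))%:E)%E.
Proof.
move=> a0 hC; set r := (Num.truncn alpha).+1.
have e x : alt_diff r h f x ^+ 2 = iter r (difference h) f x ^+ 2.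
  by rewrite iter_differenceE exprMn sqrr_sign mul1r.
under eq_integral do rewrite e.
(* The seminorm only involves radii t > 0, and the radius used is [enorm h]; for h = 0 both sides
   vanish. *)
have [h0|h0] := eqVneq (enorm h) 0.
  have h00 : h = 0.
    apply/rowP => i; rewrite mxE; apply/eqP; rewrite -sqrf_eq0.
    have := enorm_sqr h; rewrite h0 expr0n/= => /esym/eqP.
    rewrite psumr_eq0; last by move=> j _; exact: sqr_ge0.
    by move=> /allP/(_ i (mem_index_enum _)).
  rewrite h0 powR0 ?mulr0; last by rewrite mulf_neq0// gt_eqF.
  rewrite integral0_eq// => x _; rewrite iterS /difference h00 addr0 subrr expr0n//.
have t0 : 0 < enorm h by rewrite lt_neqAle eq_sym h0 enorm_ge0.
have ta : 0 < enorm h `^ alpha by rewrite powR_gt0.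
have : ('N[mu0]_2%:E [EFin \o iter r (difference h) f] <= (C3 * enorm h `^ alpha)%:E)%E.
  have h1 : ((enorm h `^ (- alpha))%:E *
      modulus_of_smoothness mu0 r f (enorm h) <= C3%:E)%E.
    by apply: le_trans hC; apply: ereal_sup_ubound; exists (enorm h).
  have h2 : ('N[mu0]_2%:E [EFin \o iter r (difference h) f] <=
      modulus_of_smoothness mu0 r f (enorm h))%E.
    by apply: ereal_sup_ubound; exists h => //=.
  apply: le_trans h2 _; rewrite EFinM muleC -lee_pdivrMl//.
  by rewrite -powRN.
move=> /Lnorm2_le; rewrite exprMn -(powR_mulrn 2 (powR_ge0 _ _)) -powRrM.
by rewrite (mulrC alpha).
Qed.

Lemma rat_ball (U : set E) x : open U -> U x ->
  exists (q : 'rV[rat]_d) (k : nat),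
    ball (map_mx ratr q : E) k.+1%:R^-1 x /\ ball (map_mx ratr q : E) k.+1%:R^-1 `<=` U.
Proof.
move=> oU Ux; have : nbhs x U by exact: open_nbhs_nbhs.
move=> /nbhs_ballP[e /= e0 xeU].
have [k] := ltr_add_invr (divr_gt0 e0 (ltr0Sn R 1)).
rewrite add0r => ke.
have k0 : (0 : R) < k.+1%:R^-1 by rewrite invr_gt0 ltr0n.
have qP i : {q | `|x 0 i - (ratr q : R)| < k.+1%:R^-1}.
  apply: cid; have [|q /=] := @rat_in_itvoo R (x 0 i) (x 0 i + k.+1%:R^-1).
    by rewrite ltrDl.
  rewrite in_itv/= => /andP[xq qx]; exists q.
  by rewrite distrC ger0_norm ?subr_ge0 1?ltW// ltrBlDl.
pose q : 'rV[rat]_d := \row_i sval (qP i).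
have xq : ball (map_mx ratr q : E) k.+1%:R^-1 x.
  apply: ball_sym; split=> // i j; rewrite !ord1 !mxE -ball_normE/=.
  exact: svalP (qP j).
exists q, k; split=> // y qy; apply: xeU; rewrite (splitr e).
have yq := le_ball (ltW ke) qy; have qx := le_ball (ltW ke) (ball_sym xq).
exact: (ball_triangle qx yq).
Qed.

Lemma measurable_support (P : {measure set E -> \bar R}) : measurable (measure_support P).
Proof.
apply: measurableC; apply: open_rV_measurable.
by apply: bigcup_open => U [].
Qed.

(** Every null open set is a union of null balls with rational centres and radii 1/(k+1), so the
    complement of the support is covered by countably many null sets. *)
Lemma support_full (P : probability E R) : P (measure_support P) = 1%E.
Proof.
pose B (qk : 'rV[rat]_d * nat) : set E := ball (map_mx ratr qk.1 : E) qk.2.+1%:R^-1.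
have mB qk : measurable (B qk) by apply: open_rV_measurable; exact: ball_open.
pose F n := if unpickle n is Some qk then
  (if P (B qk) == 0%E then B qk else set0) else set0.
have PF n : P.-negligible (F n).
  rewrite /F; case: unpickle => [qk|]; last exact: negligible_set0.
  case: ifPn => [/eqP h|_]; last exact: negligible_set0.
  by exists (B qk); split.
have [N [mN N0 FN]] := negligible_bigcup PF.
have sub : ~` measure_support P `<=` N.
  apply: subset_trans FN; rewrite /measure_support setCK => x [U [oU PU] Ux].
  have [q [k [qx qU]]] := rat_ball oU Ux.
  exists (pickle (q, k)) => //; rewrite /F pickleK.
  case: ifPn => // /eqP h; exfalso; apply: h.
  apply/eqP; rewrite eq_le measure_ge0 andbT -PU.
  by apply: le_measure; rewrite ?inE//; exact: open_rV_measurable.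
have mS := measurable_support P.
have : P (~` measure_support P) = 0%E.
  apply/eqP; rewrite eq_le measure_ge0 andbT -N0.
  by apply: le_measure; rewrite ?inE//; exact: measurableC.
move=> h; have := probability_setC P (measurableC mS).
by rewrite setCK => ->; rewrite h sube0.
Qed.

End problem_facts.

(** * Covering the support by flat pieces *)

Section covering.
Context (R : realType) (d : nat).
Local Notation E := 'rV[R]_d.

(** Quadratic approximation by a k-dimensional affine subspace at every point, the coordinates from
    [k] on being the normal ones. For k = d every set qualifies, so a single argument serves both
    rates. *)
Definition flat_set (k : nat) (kap : R) (S : set E) := forall x0, S x0 ->
  exists2 O : 'M[R]_d, O *m O^T = 1%:M & forall y, S y -> forall l : 'I_d, (k <= l)%N ->
    `|((y - x0) *m O^T) 0 l| <= kap * enorm (y - x0) ^+ 2.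

Lemma covering_witness (A : set E) (eps c : R) : (covering_number A eps <= c%:E)%E ->
  exists m (x : 'I_m -> E), m%:R < c + 1 /\
    A `<=` \bigcup_i [set y | `|y - x i| <= eps].
Proof.
move=> h; have : (covering_number A eps < (c + 1)%:E)%E.
  by apply: le_lt_trans h _; rewrite lte_fin ltrDl.
move=> /ereal_inf_lt[_ [m [x Ax] <-]]; rewrite lte_fin => mc.
by exists m, x.
Qed.

Lemma expR_half_le2 : expR (2^-1 : R) <= 2.
Proof.
have h := expR_ge1Dx (- (2^-1 : R)).
have -> : expR (2^-1 : R) = (expR (- 2^-1))^-1 by rewrite expRN invrK.
rewrite -[leRHS]invrK lef_pV2 ?posrE ?expR_gt0//; apply: le_trans h.
by apply: le_of_eq; field.
Qed.

Lemma ln2_ge_half : 2^-1 <= ln (2 : R).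
Proof. by rewrite -[leLHS]expRK ler_ln ?posrE ?expR_gt0// expR_half_le2. Qed.

Lemma ln_nat_ge_half n : (1 < n)%N -> 2^-1 <= ln (n%:R : R).
Proof.
move=> n1; apply: le_trans ln2_ge_half _; rewrite ler_ln ?posrE ?ltr0n//.
  by rewrite ler_nat.
exact: ltnW.
Qed.

Lemma coord_le_enorm (x : E) (O : 'M[R]_d) l : O *m O^T = 1%:M ->
  ((x *m O^T) 0 l) ^+ 2 <= enorm x ^+ 2.
Proof.
move=> OO; rewrite -(enorm_orthogonal x OO) (bigD1 l)//= lerDl.
by apply: sumr_ge0 => i _; exact: sqr_ge0.
Qed.

(** Each piece is recentred at one of its own points, which doubles the radius. By the condition on
    [eps] the piece then stays within gamma/2 of the centre, so scaled coordinates are at most 1/2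
    and normal ones at most kap gamma / 4. *)
Lemma flat_pieces (k : nat) (kap : R) (S : set E) (gamma : R) m (x : 'I_m -> E) (eps : R) :
  0 < gamma -> 0 <= kap -> flat_set k kap S -> d%:R * (2 * eps) ^+ 2 <= gamma ^+ 2 / 4 ->
  exists (c : 'I_m -> E) (O : 'I_m -> 'M[R]_d), forall i,
    flat_piece gamma (fun l : 'I_d => if (l < k)%N then 2^-1 else Num.min 2^-1 (kap ^+ 2 * gamma ^+ 2))
      (c i) (O i) (S `&` [set y | `|y - x i| <= eps]).
Proof.
move=> g0 kap0 flatS epsg.
pose q (l : 'I_d) := if (l < k)%N then 2^-1 else Num.min 2^-1 (kap ^+ 2 * gamma ^+ 2).
have key i : exists cO : E * 'M[R]_d, flat_piece gamma q cO.1 cO.2 (S `&` [set y | `|y - x i| <= eps]).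
  have [[x0 [Sx0 x0x]]|no] := pselect (exists y, S y /\ `|y - x i| <= eps); last first.
    (* An empty piece admits any centre and frame. *)
    exists (0, 1%:M); split; first by rewrite trmx1 mulmx1.
    by move=> y [Sy yx]; exfalso; apply: no; exists y.
  have [Om OO flatO] := flatS _ Sx0.
  exists (x0, Om); split=> //= y [Sy /= yx] l.
  have enx : enorm (y - x0) ^+ 2 <= gamma ^+ 2 / 4.
    apply: le_trans (enorm_le _) _; apply: le_trans epsg; rewrite ler_wpM2l//.
    rewrite lerXn2r// ?nnegrE//.
      by rewrite mulr_ge0// (le_trans _ yx).
    have -> : y - x0 = (y - x i) - (x0 - x i) by rewrite opprB addrA subrK.
    by apply: le_trans (ler_normB _ _) _; rewrite mulr_natl mulr2n lerD.
  have c1 : 2 * local_coord gamma x0 Om y l ^+ 2 <= 2^-1.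
    rewrite /local_coord expr_div_n.
    have := le_trans (coord_le_enorm (y - x0) l OO) enx.
    set u := _ ^+ 2 => hu; have : u / gamma ^+ 2 <= 4^-1.
      by rewrite ler_pdivrMr ?exprn_gt0// mulrC.
    lra.
  rewrite /q; case: ltnP => lk; first by rewrite c1 lexx.
  rewrite ge_min lexx/= andbT le_min c1/=.
  have := flatO y Sy l lk; set v := _ 0 l => hv.
  have hv2 : v ^+ 2 <= kap ^+ 2 * (gamma ^+ 2 / 4) ^+ 2.
    rewrite -exprMn -[leLHS]real_normK ?num_real// lerXn2r// ?nnegrE.
      by rewrite mulr_ge0// divr_ge0// sqr_ge0.
    by apply: le_trans hv _; rewrite ler_wpM2l.
  rewrite /local_coord -/v expr_div_n.
  have h : v ^+ 2 / gamma ^+ 2 <= kap ^+ 2 * gamma ^+ 2 / 16.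
    by rewrite ler_pdivrMr ?exprn_gt0//; apply: le_trans hv2 _; apply: le_of_eq; field.
  have : 0 <= kap ^+ 2 * gamma ^+ 2 by rewrite mulr_ge0 ?sqr_ge0.
  by move: h; set u := _ / _; set z := kap ^+ 2 * _; lra.
have /choice[cO cOP] := key.
by exists (fun i => (cO i).1), (fun i => (cO i).2).
Qed.

Lemma natr_powR (n : nat) (a : R) : (0 < n)%N -> n%:R `^ a = expR (a * ln n%:R).
Proof. by move=> n0; rewrite /powR pnatr_eq0 gtn_eqF. Qed.

Lemma trunc_succ_bounds (a : R) : 0 <= a -> a <= (Num.truncn a).+1%:R <= a + 1.
Proof.
move=> a0; have /andP[h1 h2] := truncn_itv a0.
by rewrite (ltW h2)/= -natr1 lerD2r.
Qed.

End covering.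

Section scalar_bounds.
Context (R : realFieldType).
Implicit Types u v x y z : R.

Lemma half_add2_le x : 0 <= x -> (x + 2) / 2 <= x + 2.
Proof. by move=> x0; rewrite ler_pdivrMr// ler_peMr ?addr_ge0// ler1n. Qed.

Lemma le_double_half x y : 2^-1 <= y -> 0 <= x -> x <= 2 * x * y.
Proof. by move=> y2 x0; have := mulr_ge0 x0 (_ : 0 <= y - 2^-1); rewrite subr_ge0 => /(_ y2); lra. Qed.

Lemma add1_le_double u v : 1 <= u -> u <= v -> u + 1 <= 2 * v.
Proof. by lra. Qed.

Lemma ge1_of_pos x y : 0 < x * y -> 1 <= 2 * x * y + 3.
Proof. by rewrite -mulrA; lra. Qed.

Lemma double_succ_bound u v x y z : u <= v + 1 -> v <= x * y * z -> 1 <= z ->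
  2 * u + 1 <= (2 * x * y + 3) * z.
Proof.
have -> : (2 * x * y + 3) * z = 2 * (x * y * z) + 3 * z by ring.
by lra.
Qed.

End scalar_bounds.

Section net_exists.
Context (R : realType) (d k : nat) (alpha rho b Cdim M kap : R).
Hypotheses (kd : (k <= d)%N) (d0 : (0 < d)%N) (alpha0 : 0 < alpha) (rho0 : 0 < rho).
Hypotheses (b0 : 0 <= b) (Cdim0 : 0 < Cdim) (M0 : 0 < M) (kap0 : 0 <= kap).
Local Notation E := 'rV[R]_d.

Let e : R := 2 * alpha + rho.
Let e0 : 0 < e. Proof. by rewrite addr_gt0// mulr_gt0. Qed.

(** The degree in normal directions. There [q] is of order n^(-2/e), so its [m2]-th power is below
    n^(-(b+2)) up to a constant: [b] compensates the squared radius M^2 n^b, and 2 yields squared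
    accuracy n^(-2). *)
Let m2 : nat := (Num.truncn ((b + 2) * e)).+1.
Let m2P : (b + 2) * e <= m2%:R.
Proof. by have /andP[] := trunc_succ_bounds (mulr_ge0 (addr_ge0 b0 (ler0n R 2)) (ltW e0)). Qed.

(** [Km], [Kd], [Kp] and [KL] are the constants, up to powers of n and log n, for the number of
    pieces, the truncation error, the rank on a piece and the logarithm of the number of quantised
    values. *)
Let Km : R := Cdim * (4 * d%:R) `^ rho + 1.
Let Km0 : 0 < Km. Proof. by rewrite ltr_wpDl// mulr_ge0 ?powR_ge0 ?ltW. Qed.
Let Kd : R := 2 * d%:R * (1 + kap ^+ (2 * m2)).
Let Kd1 : 1 <= Kd.
Proof.
rewrite /Kd; have h1 : 1 <= d%:R :> R by rewrite ler1n.
have h2 : 0 <= kap ^+ (2 * m2) by exact: exprn_ge0.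
nra.
Qed.
Let Kp : R := (2 * (b + 2) + 2) ^+ k * m2%:R ^+ d.
Let Kp0 : 0 < Kp.
Proof. by rewrite mulr_gt0// exprn_gt0 ?ltr0n//; move: b0; lra. Qed.
Let KL : R := 2 * ln (2 * M * Kp + 3) + (b + 2 + k%:R).
Let KL0 : 0 < KL.
Proof.
have : 0 <= ln (2 * M * Kp + 3).
  by rewrite ln_ge0// ge1_of_pos// (mulr_gt0 M0 Kp0).
by rewrite /KL; have := ler0n R k; move: b0; lra.
Qed.

Let eps_const : R := 2 * (M * Kd) + 1.

(** The log-cardinality is the product of three factors: n^(rho/e) pieces, rank of order log^k n on
    each, and log n for quantising a coefficient in a range polynomial in n. *)
Lemma net_exists : exists2 K : R, 0 < K &
  forall (mu : {measure set E -> \bar R}) (X S : set E) (n : nat)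
    (H : rkhs X (@gaussian_kernel R d (n%:R `^ (- e^-1)))),
  dimension_condition mu Cdim rho -> flat_set k kap S ->
  S `<=` X -> S `<=` measure_support mu -> (1 < n)%N ->
  exists N (f : 'I_N -> E -> R),
    [/\ N.+1%:R <= 2 * expR (K * n%:R `^ (rho / e) * ln n%:R ^+ k.+1),
        forall i, rkhs_mem H (f i) &
        forall g, rkhs_mem H g -> rkhs_inner H g g <= M ^+ 2 / n%:R `^ (- b) ->
          exists i, forall x, S x -> `|g x - f i x| <= K / n%:R].
Proof.
have KKK : 0 <= Km * Kp * KL := mulr_ge0 (mulr_ge0 (ltW Km0) (ltW Kp0)) (ltW KL0).
have Kd0 : 0 < Kd := lt_le_trans ltr01 Kd1.
have MKd : 0 < M * Kd := mulr_gt0 M0 Kd0.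
have eps0 : 0 < eps_const by rewrite /eps_const ltr_wpDl// mulr_ge0// ltW.
exists (Km * Kp * KL + eps_const); first by rewrite ltr_wpDl.
move=> mu X S n H dimS flatS SX Ssupp n1.
set gamma := n%:R `^ _ in H *.
have n0 : 0 < n%:R :> R by rewrite ltr0n; exact: ltnW.
have n0' : (0 < n)%N by exact: ltnW.
pose L : R := ln n%:R.
have L2 : 2^-1 <= L by exact: ln_nat_ge_half.
have L0 : 0 < L by apply: lt_le_trans L2; rewrite invr_gt0.
have pw a : n%:R `^ a = expR (a * L) by exact: natr_powR.
have gamma0 : 0 < gamma by rewrite powR_gt0.
have gammaE : gamma = expR (- e^-1 * L) by rewrite /gamma pw.
have gamma1 : gamma < 1.
  by rewrite gammaE -expR0 ltr_expR mulNr oppr_lt0 mulr_gt0 ?invr_gt0.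
have d1 : 1 <= d%:R :> R by rewrite ler1n.
(* Small enough for the pieces after converting maximum norm to Euclidean norm, and below 1, as
   (DIM) requires. *)
pose rr := gamma / (4 * d%:R).
have d4 : 0 < 4 * d%:R :> R by rewrite mulr_gt0// ltr0n.
have rr01 : 0 < rr < 1.
  rewrite divr_gt0//= ltr_pdivrMr// mul1r; apply: lt_le_trans gamma1 _.
  by move: d1; lra.
have [m [x [mle Sx]]] := covering_witness (dimS rr rr01).
have mK : m%:R <= Km * expR (rho / e * L).
  apply: le_trans (ltW mle) _.
  have -> : rr `^ (- rho) = (4 * d%:R) `^ rho * expR (rho / e * L).
    rewrite /rr powRM ?invr_ge0 ?(ltW gamma0) ?(ltW d4)//.
    rewrite -powR_inv1 ?(ltW d4)// -powRrM mulN1r opprK mulrC; congr (_ * _).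
    by rewrite /gamma -powRrM pw mulrNN [e^-1 * _]mulrC.
  have -> : Km * expR (rho / e * L) =
    Cdim * ((4 * d%:R) `^ rho * expR (rho / e * L)) + expR (rho / e * L).
    by rewrite /Km; ring.
  rewrite lerD2l -expR0 ler_expR; apply: mulr_ge0; last exact: ltW.
  by rewrite divr_ge0 ?ltW.
have epsg : d%:R * (2 * rr) ^+ 2 <= gamma ^+ 2 / 4.
  rewrite /rr; have -> : d%:R * (2 * (gamma / (4 * d%:R))) ^+ 2 = gamma ^+ 2 / 4 * d%:R^-1.
    by field; rewrite gt_eqF// ltr0n.
  by rewrite ler_piMr ?divr_ge0 ?sqr_ge0// invf_le1 ?ltr0n.
have [c [Om pieces]] := flat_pieces x gamma0 kap0 flatS epsg.
(* The tangential remainder 2^(-m1) must be below n^(-(b+2)); the factor 2 stems from using exp(1/2)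
   <= 2. *)
pose m1 : nat := (Num.truncn (2 * (b + 2) * L)).+1.
have m1a0 : 0 <= 2 * (b + 2) * L by rewrite !mulr_ge0 ?(ltW L0)// addr_ge0.
have /andP[m1ge m1le] := trunc_succ_bounds m1a0; rewrite -/m1 in m1ge m1le.
pose deg (l : 'I_d) := if (l < k)%N then m1 else m2.
pose q (l : 'I_d) : R := if (l < k)%N then 2^-1 else Num.min 2^-1 (kap ^+ 2 * gamma ^+ 2).
have degM l : (deg l <= m1 + m2)%N.
  by rewrite /deg; case: ifP => _; [exact: leq_addr|exact: leq_addl].
have nb2 : expR (- ((b + 2) * L)) = n%:R `^ (- b) / n%:R ^+ 2.
  rewrite pw -[n%:R in RHS](lnK (x := n%:R)) ?posrE// -/L -expRM_natr -expRN -expRD.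
  by congr expR; ring.
have qdeg l : 2 * q l ^+ deg l <= 2 * (1 + kap ^+ (2 * m2)) * expR (- ((b + 2) * L)).
  rewrite -mulrA ler_pM2l// /q /deg; case: ifP => _.
    apply: (@le_trans _ _ (1 * expR (- ((b + 2) * L)))).
      rewrite mul1r exprVn expRN lef_pV2 ?posrE ?expR_gt0 ?exprn_gt0//.
      apply: (@le_trans _ _ (expR (2^-1 * m1%:R))).
        by rewrite ler_expR; move: m1ge; lra.
      rewrite expRM_natr lerXn2r ?nnegrE ?expR_ge0//; exact: expR_half_le2.
    by rewrite ler_wpM2r ?expR_ge0// lerDl exprn_ge0.
  apply: (@le_trans _ _ ((kap ^+ 2 * gamma ^+ 2) ^+ m2)).
    rewrite lerXn2r// ?nnegrE.
    - by rewrite le_min invr_ge0 ler0n mulr_ge0 ?sqr_ge0.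
    - by rewrite mulr_ge0 ?sqr_ge0.
    - by rewrite ge_min lexx orbT.
  rewrite exprMn -!exprM; apply: ler_pM; rewrite ?exprn_ge0 ?(ltW gamma0)//.
    by rewrite lerDr.
  rewrite gammaE -expRM_natr ler_expR natrM.
  have -> : - e^-1 * L * (2 * m2%:R) = - (2 * (m2%:R / e) * L) by field; rewrite gt_eqF.
  rewrite lerN2 ler_pM2r//; have : b + 2 <= m2%:R / e by rewrite ler_pdivlMr.
  by move: b0; lra.
pose p := (\prod_l deg l)%N.
have p0 : (0 < p)%N.
  by apply: prodn_gt0 => l; rewrite /deg; case: ifP.
have cardk : #|(fun l : 'I_d => (l < k)%N)| = k.
  by rewrite -[RHS](card_ord k) -sum1_card -sum1_card (big_ord_widen d (fun=> 1%N)).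
have pK : p%:R <= Kp * L ^+ k.
  have -> : p = (m1 ^ k * m2 ^ (d - k))%N.
    rewrite /p (bigID (fun l : 'I_d => (l < k)%N))/=; congr (_ * _)%N.
      rewrite (eq_bigr (fun=> m1)) => [|l lk]; last by rewrite /deg lk.
      rewrite prod_nat_const; congr (_ ^ _)%N.
      exact: cardk.
    rewrite (eq_bigr (fun=> m2)) => [|l lk]; last by rewrite /deg (negbTE lk).
    rewrite prod_nat_const; congr (_ ^ _)%N.
    by rewrite -[d in RHS]card_ord -(cardC (fun l : 'I_d => (l < k)%N)) cardk addKn; apply: eq_card.
  rewrite natrM !natrX /Kp -mulrA [X in _ <= _ * X]mulrC mulrA -exprMn.
  apply: ler_pM; rewrite ?exprn_ge0//.
    rewrite lerXn2r ?nnegrE//; first by rewrite mulr_ge0 ?(ltW L0)//; move: b0; lra.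
    by apply: le_trans m1le _; move: L2; lra.
  by rewrite ler_weXn2l ?ler1n// leq_subr.
(* Rounding all [p] coefficients then costs 1/n in total. *)
pose eta : R := (n%:R * p%:R)^-1.
have p0' : 0 < p%:R :> R by rewrite ltr0n.
have eta0 : 0 < eta by rewrite invr_gt0 mulr_gt0.
pose B := M ^+ 2 / n%:R `^ (- b).
(* This is the square root of [B] divided by [eta]: the largest coefficient in units of the mesh. *)
pose a := M * expR ((b + 2) / 2 * L) * p%:R.
have a0 : 0 <= a by rewrite !mulr_ge0 ?expR_ge0 ?ltW.
pose Lq := (Num.truncn a).+1.
have /andP[Lqge Lqle] := trunc_succ_bounds a0; rewrite -/Lq in Lqge Lqle.
have nE : n%:R = expR L by rewrite lnK ?posrE.
have BE : B = M ^+ 2 * expR (b * L) by rewrite /B pw -expRN mulNr opprK.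
have BL : B <= (eta * Lq%:R) ^+ 2.
  have -> : B = (eta * a) ^+ 2.
    rewrite BE /eta /a; have -> : (n%:R * p%:R)^-1 * (M * expR ((b + 2) / 2 * L) * p%:R) =
      M * (expR ((b + 2) / 2 * L) * n%:R^-1) by field; rewrite !gt_eqF.
    by rewrite nE -expRN -expRD exprMn -expRM_natr; congr (_ * expR _); field.
  have h : eta * a <= eta * Lq%:R by rewrite ler_pM2l.
  have h0 : 0 <= eta * a := mulr_ge0 (ltW eta0) a0.
  by rewrite lerXn2r// nnegrE// (le_trans h0).
pose delta := M * Kd / n%:R.
have delta0 : 0 <= delta := divr_ge0 (ltW MKd) (ltW n0).
have deltaP : (\sum_l 2 * q l ^+ deg l) * B <= delta ^+ 2.
  apply: (@le_trans _ _ (Kd * expR (- ((b + 2) * L)) * B)).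
    apply: ler_wpM2r; first by rewrite BE mulr_ge0 ?sqr_ge0 ?expR_ge0.
    apply: le_trans (ler_sum _ (fun l _ => qdeg l)) _.
    by rewrite sumr_const card_ord -mulr_natl /Kd; apply: le_of_eq; ring.
  rewrite nb2 /B /delta.
  have nb0 : n%:R `^ (- b) != 0 by rewrite gt_eqF// powR_gt0.
  have -> : Kd * (n%:R `^ (- b) / n%:R ^+ 2) * (M ^+ 2 / n%:R `^ (- b)) =
    (M ^+ 2 * Kd) / n%:R ^+ 2 by field; rewrite nb0 gt_eqF.
  rewrite expr_div_n ler_pM2r ?invr_gt0 ?exprn_gt0// exprMn ler_pM2l ?exprn_gt0//.
  by rewrite expr2 ler_peMl// ltW.
have epsP : 2 * delta + p%:R * eta <= eps_const / n%:R.
  apply: le_of_eq; rewrite /delta /eta /eps_const; field; rewrite !gt_eqF//.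
have SA : S `<=` \bigcup_r (S `&` [set y | `|y - x r| <= rr]).
  by move=> y Sy; have [i _ yi] := Sx y (Ssupp y Sy); exists i.
have [N [f [NK fH fnet]]] := rkhs_net H gamma0 degM pieces SA SX eta0 delta0 deltaP BL epsP.
exists N, f; split.
- rewrite -natr1; have NK' : N%:R <= (2 * Lq).+1%:R ^+ (m * p) :> R by rewrite -natrX ler_nat.
  have Lq3 : ((2 * Lq).+1%:R : R) <= (2 * M * Kp + 3) * expR ((b + 2 + k%:R) * L).
    rewrite -natr1 natrM.
    have pn : p%:R <= Kp * expR (k%:R * L).
      apply: le_trans pK _; rewrite ler_pM2l// mulrC expRM_natr lerXn2r ?nnegrE ?expR_ge0 ?(ltW L0)//.
      by apply: le_trans (expR_ge1Dx L); rewrite lerDr.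
    have aK : a <= M * Kp * expR ((b + 2 + k%:R) * L).
      rewrite /a; apply: (@le_trans _ _ (M * expR ((b + 2) / 2 * L) * (Kp * expR (k%:R * L)))).
        by rewrite ler_wpM2l// mulr_ge0 ?expR_ge0 ?ltW.
      have -> : M * expR ((b + 2) / 2 * L) * (Kp * expR (k%:R * L)) =
         M * Kp * (expR ((b + 2) / 2 * L) * expR (k%:R * L)) by ring.
      rewrite -expRD; apply: ler_wpM2l; first exact: ltW (mulr_gt0 M0 Kp0).
      rewrite ler_expR -mulrDl.
      by rewrite ler_pM2r// lerD2r half_add2_le.
    have e1 : 1 <= expR ((b + 2 + k%:R) * L).
      by rewrite -expR0 ler_expR mulr_ge0 ?(ltW L0)// !addr_ge0.
    exact: double_succ_bound Lqle aK e1.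
  have : (2 * Lq).+1%:R ^+ (m * p) <= expR (Km * Kp * KL * n%:R `^ (rho / e) * L ^+ k.+1).
    apply: (@le_trans _ _ (expR (KL * L) ^+ (m * p))).
      rewrite lerXn2r ?nnegrE ?expR_ge0//; apply: le_trans Lq3 _.
      have A0 : 0 < 2 * M * Kp + 3 by rewrite -mulrA addr_gt0// mulr_gt0// mulr_gt0.
      have -> : 2 * M * Kp + 3 = expR (ln (2 * M * Kp + 3)) by rewrite lnK ?posrE.
      rewrite -expRD ler_expR /KL [leRHS]mulrDl lerD2r.
      have : 0 <= ln (2 * M * Kp + 3).
        by rewrite ln_ge0// ge1_of_pos// (mulr_gt0 M0 Kp0).
      exact: le_double_half.
    rewrite -expRM_natr ler_expR natrM.
    rewrite pw.
    have -> : Km * Kp * KL * expR (rho / e * L) * L ^+ k.+1 =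
      (KL * L) * ((Km * expR (rho / e * L)) * (Kp * L ^+ k)) by rewrite exprS; ring.
    rewrite ler_pM2l ?mulr_gt0//; exact: ler_pM.
  move=> h; apply: (@le_trans _ _ (expR (Km * Kp * KL * n%:R `^ (rho / e) * L ^+ k.+1) + 1)).
    by rewrite lerD2r; exact: le_trans h.
  have mono : expR (Km * Kp * KL * n%:R `^ (rho / e) * L ^+ k.+1) <=
      expR ((Km * Kp * KL + eps_const) * n%:R `^ (rho / e) * L ^+ k.+1).
    rewrite ler_expR ler_wpM2r ?exprn_ge0 ?(ltW L0)// ler_wpM2r ?powR_ge0// lerDl.
    exact: ltW.
  have one : 1 <= expR (Km * Kp * KL * n%:R `^ (rho / e) * L ^+ k.+1).
    rewrite -expR0 ler_expR; apply: mulr_ge0; last by rewrite exprn_ge0 ?ltW.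
    by apply: mulr_ge0 => //; exact: powR_ge0.
  exact: add1_le_double.
- by move=> i; have [] := fH i.
move=> g Hg gB; have [i hi] := fnet g Hg gB; exists i => y Sy.
by apply: le_trans (hi y Sy) _; rewrite ler_pM2r ?invr_gt0// lerDr.
Qed.

End net_exists.

(** For u > 1 the exponent is raised to an even integer, and the power is then bounded by a single
    term of the exponential series. *)
Lemma powR_le_expR (R : realType) (alpha : R) : 0 < alpha ->
  exists2 C : R, 0 <= C & forall u : R, 0 <= u -> u `^ (2 * alpha) <= C * expR (u ^+ 2 / 2).
Proof.
move=> a0; pose N := (Num.truncn alpha).+1.
have aN : alpha <= N%:R by have /andP[_ /ltW] := truncn_itv (ltW a0).
exists (1 + 2 ^+ N * N`!%:R).
  by apply: addr_ge0 => //; apply: mulr_ge0 => //; exact: exprn_ge0.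
move=> u u0.
have u2 : 0 <= u ^+ 2 / 2 by apply: divr_ge0 => //; exact: sqr_ge0.
have e1 : 1 <= expR (u ^+ 2 / 2) by rewrite -[leLHS]expR0 ler_expR.
have [u1|u1] := leP u 1.
  apply: (@le_trans _ _ 1); last first.
    by rewrite mulrDl mul1r ler_wpDr// mulr_ge0 ?expR_ge0// mulr_ge0// exprn_ge0.
  apply: (@le_trans _ _ (1 `^ (2 * alpha))); last by rewrite powR1.
  apply: ge0_ler_powR; rewrite ?nnegrE//; apply: mulr_ge0 => //; exact: ltW.
apply: (@le_trans _ _ (u `^ (2 * N%:R))).
  by apply: ler_powR; [exact: ltW|rewrite ler_pM2l].
rewrite powRrM -[2]/(2%:R) powR_mulrn// powR_mulrn ?sqr_ge0//.
have h : (u ^+ 2 / 2) ^+ N / N`!%:R <= expR (u ^+ 2 / 2).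
  apply: le_trans (texp_le_expR N.+1 u2).
  rewrite /texp big_ord_recr/= lerDr; apply: sumr_ge0 => i _.
  by rewrite divr_ge0// exprn_ge0.
have f0 : 0 < N`!%:R :> R by rewrite ltr0n fact_gt0.
apply: (@le_trans _ _ (2 ^+ N * N`!%:R * expR (u ^+ 2 / 2))); last first.
  by rewrite ler_wpM2r ?expR_ge0// lerDr.
have -> : (u ^+ 2) ^+ N = 2 ^+ N * N`!%:R * ((u ^+ 2 / 2) ^+ N / N`!%:R).
  by rewrite expr_div_n; field; rewrite !gt_eqF// exprn_gt0.
by rewrite ler_wpM2l// mulr_ge0// exprn_ge0.
Qed.

Section marginal.
Context (R : realType) (d : nat).
Local Notation E := 'rV[R]_d.
Local Notation Rm := (measurableTypeR R).

Lemma ge0_integral_marginal (P : probability (E * Rm)%type R) (g : E -> \bar R) :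
  measurable_fun [set: E] g -> (forall x, 0 <= g x)%E ->
  (\int[first_marginal P]_x g x = \int[P]_z g z.1)%E.
Proof.
move=> mg g0.
rewrite (eq_measure_integral (pushforward P (@fst E Rm)))//.
by rewrite ge0_integral_pushforward//; exact: measurable_fst.
Qed.

End marginal.

(** Terms lacking the logarithmic factor or [tau] acquire it from [1 <= c2 * Lk] and [1 <= tau]. *)
Lemma final_bound (R : realFieldType) (lB Ex V0 V tn Me Kq Kapp MK K w tau Lk c2 : R) :
  lB <= Kq * w -> Ex <= 4 * Kapp * w -> tn <= 2 * tau * w + K * Lk * w ->
  Me <= MK * w -> 0 <= w -> 0 <= Kq -> 0 <= Kapp -> 0 <= MK -> 0 <= K -> 0 <= V -> 0 <= V0 ->
  1 <= tau -> 1 <= c2 * Lk -> 0 <= Lk -> 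
  2 * lB + 3 * Ex + 8 * V0 * tn + 8 * V * tn + 12 * Me <=
  (c2 * (2 * Kq + 12 * Kapp + 12 * MK) + (8 * V0 + 8 * V) * (2 * c2 + K) + 1) *
  tau * w * Lk.
Proof.
move=> h1 h2 h3 h4 w0 q0 a0 m0 k0 v0 v00 t1 c1 L0.
have t0 : 0 <= tau by lra.
set A := 2 * Kq + 12 * Kapp + 12 * MK.
have A0 : 0 <= A by rewrite /A; lra.
set W := 8 * V0 + 8 * V; have W0 : 0 <= W by rewrite /W; lra.
have p1 : A * w <= A * w * (c2 * Lk) * tau.
  have Aw : 0 <= A * w by exact: mulr_ge0.
  apply: (@le_trans _ _ (A * w * (c2 * Lk))); first by rewrite ler_peMr.
  by rewrite ler_peMr// mulr_ge0// (le_trans ler01).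
have p2 : W * tn <= W * (2 * c2 + K) * tau * w * Lk.
  apply: (@le_trans _ _ (W * (2 * tau * w + K * Lk * w))); first by rewrite ler_wpM2l.
  have -> : W * (2 * c2 + K) * tau * w * Lk = W * (2 * tau * w * (c2 * Lk) + K * Lk * w * tau) by ring.
  rewrite ler_wpM2l// lerD//; first by rewrite ler_peMr// !mulr_ge0.
  by rewrite ler_peMr// !mulr_ge0.
have p3 : 0 <= tau * w * Lk by rewrite !mulr_ge0.
have -> : 2 * lB + 3 * Ex + 8 * V0 * tn + 8 * V * tn + 12 * Me =
  (2 * lB + 3 * Ex + 12 * Me) + W * tn by rewrite /W; ring.
have -> : (c2 * A + W * (2 * c2 + K) + 1) * tau * w * Lk =
  A * w * (c2 * Lk) * tau + W * (2 * c2 + K) * tau * w * Lk + tau * w * Lk by ring.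
have p4 : 2 * lB + 3 * Ex + 12 * Me <= A * w.
  have -> : A * w = 2 * (Kq * w) + 3 * (4 * Kapp * w) + 12 * (MK * w) by rewrite /A; ring.
  lra.
lra.
Qed.

(** * From the oracle inequality to the learning rate *)

Section rate.
Context (R : realType) (d k : nat) (alpha rho b : R).
Hypotheses (kd : (k <= d)%N) (d0 : (0 < d)%N) (alpha0 : 0 < alpha) (rho0 : 0 < rho).
Hypothesis hb : (2 * alpha + d%:R) / (2 * alpha + rho) <= b.
Local Notation E := 'rV[R]_d.
Local Notation Rm := (measurableTypeR R).

Lemma svm_rate (Cdim C1 C2 C3 M kap : R) : 0 < Cdim -> 0 < M -> 0 <= kap ->
  exists2 C : R, 0 < C &
  forall (X : set E) (Y : set Rm) (P : probability (E * Rm)%type R) (fstar : E -> R),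
  learning_problem alpha rho Cdim C1 C2 C3 M X Y P fstar ->
  flat_set k kap (measure_support (first_marginal P)) ->
  forall (n : nat) (tau : R), (1 < n)%N -> 1 <= tau ->
  svm_bound_with_probability least_squares P X M
    (n%:R `^ (- b)) (n%:R `^ (- (2 * alpha + rho)^-1)) n
    (C * tau * n%:R `^ (- (2 * alpha / (2 * alpha + rho))) * ln n%:R ^+ k.+1)
    (1 - expR (- tau)).
Proof.
move=> Cdim0 M0 kap0.
set e := 2 * alpha + rho; have e0 : 0 < e by rewrite addr_gt0// mulr_gt0.
have b0 : 0 <= b.
  by apply: le_trans hb; rewrite divr_ge0 ?(ltW e0)// addr_ge0// mulr_ge0// ltW.
have [K K0 net] := net_exists kd d0 alpha0 rho0 b0 Cdim0 M0 kap0.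
have [Ca Ca0 CaP] := powR_le_expR alpha0.
pose r := (Num.truncn alpha).+1.
pose Kq := r%:R * (\sum_(j < r) smooth_coef R j ^+ 2) * C1 ^+ 2.
have Kq0 : 0 <= Kq.
  apply: mulr_ge0; last exact: sqr_ge0.
  by apply: mulr_ge0 => //; apply: sumr_ge0 => j _; exact: sqr_ge0.
pose F0 := smooth_const R r * C2.
pose V := 2 * (M + 3 * M) ^+ 2.
pose V0 := 2 * (F0 + 3 * M) ^+ 2.
pose Kapp := C3 ^+ 2 * Ca * Num.sqrt 2 ^+ d.
have Kapp0 : 0 <= Kapp.
  apply: mulr_ge0; first by apply: mulr_ge0 => //; exact: sqr_ge0.
  by apply: exprn_ge0; exact: sqrtr_ge0.
(* For n > 1 only log n >= 1/2 is guaranteed; this factor lifts the power of the logarithm above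
   1. *)
pose c2 : R := 2 ^+ k.+1.
have c20 : 0 <= c2 by exact: exprn_ge0.
pose C := c2 * (2 * Kq + 12 * Kapp + 12 * (M * K)) + (8 * V0 + 8 * V) * (2 * c2 + K) + 1.
have V00 : 0 <= V0 by apply: mulr_ge0 => //; exact: sqr_ge0.
have V_0 : 0 <= V by apply: mulr_ge0 => //; exact: sqr_ge0.
have MK0 : 0 <= M * K by apply: mulr_ge0; exact: ltW.
exists C.
  rewrite /C; apply: ltr_wpDl => //; apply: addr_ge0; apply: mulr_ge0 => //.
  - by apply: addr_ge0; [apply: addr_ge0|]; apply: mulr_ge0.
  - by apply: addr_ge0; apply: mulr_ge0.
  - by apply: addr_ge0; [apply: mulr_ge0|exact: ltW].
move=> X Y P fstar [mX mY YM PXY dimP bayes hL2 hLoo hbes] flatP n tau n1 tau1 H.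
pose PX : probability E R := first_marginal P.
(* RKHS elements are controlled on [X] and coverings on the support; the intersection still has full
   measure. *)
pose S := measure_support PX `&` X.
have mS : measurable S by apply: measurableI => //; exact: measurable_support.
have PS : PX S = 1%E.
  have PX1 : PX X = 1%E.
    apply/eqP; rewrite eq_le probability_le1//= -PXY.
    rewrite /PX /first_marginal/= /pushforward; apply: le_measure; rewrite ?inE.
    - exact: measurableX.
    - by rewrite -[X in measurable X]setTI; exact: measurable_fst.
    - by move=> z [].
  apply: probability_setI1 => //; first exact: measurable_support.
  exact: support_full.
have flatS : flat_set k kap S.
  move=> x0 [Sx0 _]; have [Om OO hO] := flatP _ Sx0.
  by exists Om => // y [Sy _]; exact: hO.
set gamma := n%:R `^ _ in H *; set lambda := n%:R `^ (- b).
have n0 : 0 < n%:R :> R by rewrite ltr0n; exact: ltnW.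
have n0' : (0 < n)%N by exact: ltnW.
have gamma0 : 0 < gamma by rewrite powR_gt0.
have lambda0 : 0 < lambda by rewrite powR_gt0.
pose L : R := ln n%:R.
have L2 : 2^-1 <= L by exact: ln_nat_ge_half.
have L0 : 0 < L by apply: lt_le_trans L2; rewrite invr_gt0.
have pw a : n%:R `^ a = expR (a * L) by exact: natr_powR.
have nE : n%:R = expR L by rewrite lnK ?posrE.
pose w := n%:R `^ (- (2 * alpha / e)).
have w0 : 0 <= w by exact: powR_ge0.
have inv_n_w : n%:R^-1 <= w.
  rewrite /w pw nE -expRN ler_expR mulNr lerN2 ler_piMl ?(ltW L0)//.
  by rewrite ler_pdivrMr// mul1r /e lerDl ltW.
(* The balance behind the choice of the width: gamma^(-rho) / n equals gamma^(2 alpha). *)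
have rate_n : n%:R `^ (rho / e) / n%:R = w.
  rewrite /w pw [X in _ / X]nE -expRN -expRD pw; congr expR.
  have -> : rho = e - 2 * alpha by rewrite /e addrAC subrr add0r.
  by field; rewrite gt_eqF.
have [N [f [Nle Hf netf]]] := net PX X S n H dimP flatS (@subIsetr _ _ _) (@subIsetl _ _ _) n1.
have mfs : measurable_fun [set: E] fstar := bayes.1.
have C20 : 0 <= C2 by rewrite -lee_fin; apply: le_trans hLoo; exact: Lnorm_ge0.
have fL2 := Lnorm2_le hL2.
rewrite ge0_integral_lebesgue_row in fL2; last 2 first.
- by apply/measurable_EFinP; exact: measurable_funX.
- by move=> z; rewrite lee_fin sqr_ge0.
have fLoo := Lnormoo_le mfs hLoo.
have mZ := measurable_norm_gt C2 mfs.
have fLoo' : (\int[product_power (@lebesgue_measure R) d]_t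
    (\1_[set z | (C2 < `|fstar z|)%R] (row_of_tuple t) : R)%:E = 0)%E.
  rewrite -fLoo -(ge0_integral_lebesgue_row (F := fun z => (\1_[set z | (C2 < `|fstar z|)%R] z : R)%:E)).
  - by rewrite integral_indic// setIT.
  - by apply/measurable_EFinP; exact: measurable_indic.
  - by move=> z; rewrite lee_fin.
have fbes (h : E) := besov_difference h alpha0 hbes.
pose f0 := smoothed fstar C2 r gamma.
have r0 : (0 < r)%N by [].
have bf0 : bmeas f0 by exact: bmeas_smoothed.
have f0F x : `|f0 x| <= F0 by exact: smoothed_bound.
pose B0 := Num.sqrt ((gamma ^+ 2)^-1 / pi) ^+ d * r%:R * (\sum_(j < r) smooth_coef R j ^+ 2) * C1 ^+ 2.
have f0B m (x : 'I_m -> E) (a : 'I_m -> R) : (forall i, X (x i)) ->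
    2 * \sum_i a i * f0 (x i) <=
    \sum_i \sum_j a i * a j * gaussian_kernel gamma (x i) (x j) + B0.
  by move=> _; exact: smoothed_quad.
have ferr := smoothed_L2_error mfs C20 fLoo' gamma0 fbes CaP.
have gw : gamma `^ (2 * alpha) = w.
  rewrite /gamma /w -powRrM; congr (_ `^ _).
  by rewrite mulNr mulrC.
have lB : lambda * B0 <= Kq * w.
  have g1 : Num.sqrt ((gamma ^+ 2)^-1 / pi) <= gamma^-1.
    rewrite -[leRHS]ger0_norm ?invr_ge0 ?(ltW gamma0)// -sqrtr_sqr ler_sqrt ?sqr_ge0//.
    rewrite exprVn ler_pdivrMr ?pi_gt0// ler_peMr ?invr_ge0 ?sqr_ge0//.
    by have := @pi_ge2 R; lra.
  (* Here the lower bound on [b] enters: it says that lambda gamma^(-d) is at most gamma^(2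
     alpha). *)
  have g2 : lambda * Num.sqrt ((gamma ^+ 2)^-1 / pi) ^+ d <= w.
    apply: (@le_trans _ _ (lambda * gamma^-1 ^+ d)).
      rewrite ler_pM2l// lerXn2r// ?nnegrE ?sqrtr_ge0// invr_ge0 ltW//.
    rewrite /lambda /w /gamma !pw -expRN -expRM_natr -expRD ler_expR.
    have -> : - b * L + - (- e^-1 * L) * d%:R = - ((b - d%:R / e) * L) by field; rewrite gt_eqF.
    rewrite mulNr lerN2 ler_pM2r// lerBrDr -mulrDl; exact: hb.
  have -> : lambda * B0 = Kq * (lambda * Num.sqrt ((gamma ^+ 2)^-1 / pi) ^+ d).
    by rewrite /B0 /Kq; ring.
  by rewrite ler_wpM2l.
(* The smoothing error refers to [fstar], the excess risk to [regr]; the triangle inequality costs a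
   factor 2, and the distance between these two functions is zero. *)
have Ex : expect P (excess M fstar f0) <= 4 * Kapp * w.
  apply: le_trans (excess_le_dist2 M0 mX mY YM PXY bayes bf0) _.
  suff : dist2 P M fstar f0 <= 2 * (Kapp * w) by lra.
  have br := bmeas_regr M0 bayes.
  have bd := bounded_meas_dist2 M0 bayes bf0.
  rewrite -lee_fin -(EFin_expect P bd).
  have m1 : measurable_fun setT (fun z : E * Rm => ((fstar z.1 - f0 z.1) ^+ 2)%:E).
    apply/measurable_EFinP; apply: measurable_funX; apply: measurable_funB.
      by apply: (measurableT_comp mfs); exact: measurable_fst.
    by apply: (measurableT_comp bf0.1); exact: measurable_fst.
  have m2 : measurable_fun setT (fun z : E * Rm => ((fstar z.1 - regr M fstar z.1) ^+ 2)%:E).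
    apply/measurable_EFinP; apply: measurable_funX; apply: measurable_funB.
      by apply: (measurableT_comp mfs); exact: measurable_fst.
    by apply: (measurableT_comp br.1); exact: measurable_fst.
  apply: (@le_trans _ _ (\int[P]_z (2%:E * ((fstar z.1 - f0 z.1) ^+ 2)%:E +
      2%:E * ((fstar z.1 - regr M fstar z.1) ^+ 2)%:E))%E).
    apply: ge0_le_integral => //.
    - by move=> z _; rewrite lee_fin sqr_ge0.
    - by apply/measurable_EFinP; exact: bd.1.
    - by apply: emeasurable_funD; exact: measurable_funeM.
    move=> z _; rewrite -!EFinM -EFinD lee_fin -subr_ge0.
    set u := fstar _; set v := f0 _; set y := regr _ _ _.
    have -> : 2 * (u - v) ^+ 2 + 2 * (u - y) ^+ 2 - (v - y) ^+ 2 = (2 * u - v - y) ^+ 2 by ring.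
    exact: sqr_ge0.
  rewrite ge0_integralD//; last 4 first.
  - by move=> z _; rewrite mule_ge0// lee_fin sqr_ge0.
  - exact: measurable_funeM.
  - by move=> z _; rewrite mule_ge0// lee_fin sqr_ge0.
  - exact: measurable_funeM.
  rewrite !ge0_integralZl//; try by move=> z _; rewrite lee_fin sqr_ge0.
  rewrite (fstar_regr M0 mX mY YM PXY bayes) mule0 adde0 EFinM.
  apply: lee_wpmul2l; first by rewrite lee_fin.
  have := ferr; rewrite -/f0 gw -/Kapp
    (ge0_integral_marginal P (g := fun x => ((fstar x - f0 x) ^+ 2)%:E))//.
    by apply/measurable_EFinP; apply: measurable_funX; apply: measurable_funB => //; exact: bf0.1.
  by move=> x; rewrite lee_fin sqr_ge0.
(* The logarithm pays for the union bound over the [N.+1] bad events. *)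
pose t := tau + ln N.+1%:R.
have N0 : 0 < N.+1%:R :> R by rewrite ltr0n.
have [A [mA PA hA]] := oracle_inequality M0 mX mY YM PXY bayes gamma0 lambda0 n0'
  mS (@subIsetr _ _ _) PS Hf netf bf0 f0F f0B t.
exists A; split=> //.
  apply: le_trans PA; rewrite lee_fin lerD2l lerN2 /t opprD expRD expRN
    [X in _ * (_ * X)]expRN lnK ?posrE//.
  by rewrite mulrCA mulfV ?mulr1 ?gt_eqF.
move=> D g AD svmg; apply: le_trans (hA D g AD svmg) _; rewrite lee_fin.
have tn : t / n%:R <= 2 * tau * w + K * L ^+ k.+1 * w.
  have lnN : ln N.+1%:R <= 1 + K * n%:R `^ (rho / e) * L ^+ k.+1.
    apply: (@le_trans _ _ (ln (expR (1 + K * n%:R `^ (rho / e) * L ^+ k.+1)))); last by rewrite expRK.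
    rewrite ler_ln ?posrE ?expR_gt0//; apply: le_trans Nle _.
    rewrite expRD ler_wpM2r ?expR_ge0//; apply: le_trans (expR_ge1Dx 1).
    by apply: le_of_eq; ring.
  apply: (@le_trans _ _ ((2 * tau + K * n%:R `^ (rho / e) * L ^+ k.+1) / n%:R)).
    by rewrite ler_pM2r ?invr_gt0// /t; lra.
  rewrite mulrDl lerD//.
    by rewrite ler_wpM2l// mulr_ge0// (le_trans _ tau1).
  by apply: le_of_eq; rewrite -rate_n; ring.
have Me : M * (K / n%:R) <= M * K * w by rewrite mulrA ler_wpM2l.
have c2L : 1 <= c2 * L ^+ k.+1.
  by rewrite /c2 -exprMn exprn_ege1//; move: L2; lra.
have := final_bound lB Ex tn Me w0 Kq0 Kapp0 MK0 (ltW K0) V_0 V00 tau1 c2L (exprn_ge0 _ (ltW L0)).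
apply: le_trans; apply: le_of_eq.
rewrite -/V -/V0; ring.
Qed.

End rate.

(** * Submanifolds and curvature *)

Section strict_differentiability.
Context (R : realType) (d : nat).
Local Notation E := 'rV[R]_d.
Local Notation e_ j := (delta_mx 0 j : E).
Implicit Types (f : E -> E) (p x y v : E) (A : 'M[R]_d).

Lemma row_norm_le v (K : R) : 0 <= K -> (forall i, `|v 0 i| <= K) -> `|v| <= K.
Proof.
move=> K0 vK; rewrite [leLHS]mx_normrE; apply: bigmax_le => // -[i j] _ /=.
by rewrite (ord1 i); exact: vK.
Qed.

Lemma mulmx_norm_le v A : `|v *m A| <= d%:R * `|A| * `|v|.
Proof.
apply: row_norm_le => [|i]; first by rewrite !mulr_ge0.
rewrite mxE; apply: le_trans (ler_norm_sum _ _ _) _.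
apply: (@le_trans _ _ (\sum_(j < d) `|A| * `|v|)); last first.
  by rewrite sumr_const card_ord -[leLHS]mulr_natl mulrA.
apply: ler_sum => j _; rewrite normrM mulrC; apply: ler_pM => //.
  rewrite [leRHS]mx_normrE.
  exact: (le_bigmax 0 (fun ij : 'I_d * 'I_d => `|A ij.1 ij.2|) (j, i)).
exact: coord_le_norm.
Qed.

Lemma is_derive_line (W : normedModType R) (f : E -> W) z v (t : R) :
  derivable f (t *: v + z) v ->
  is_derive t 1 (fun s : R => f (s *: v + z)) ('D_v f (t *: v + z)).
Proof.
have e : (fun h : R => h^-1 *: (((fun s : R => f (s *: v + z)) \o shift t) (h *: 1) -
    f (t *: v + z))) =
  (fun h => h^-1 *: ((f \o shift (t *: v + z)) (h *: v) - f (t *: v + z))).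
  apply/funext => h /=; congr (_ *: (f _ - _)).
  by rewrite scalerDl addrA /GRing.scale/= mulr1.
by move=> df; split; rewrite /derivable /derive e.
Qed.

Lemma line_bound (phi dphi : R -> R) (a b K : R) :
  (forall t, Num.min a b <= t <= Num.max a b ->
    is_derive t 1 phi (dphi t) /\ `|dphi t| <= K) ->
  `|phi b - phi a| <= K * `|b - a|.
Proof.
wlog ab : a b / a <= b => [hw H|].
  have [ab|/ltW ba] := leP a b; first exact: hw.
  by rewrite distrC [`|b - a|]distrC; apply: hw => // t; rewrite minC maxC; exact: H.
rewrite min_l// max_r// => H.
have [||c cab ->] := @MVT_segment _ phi dphi a b ab.
- by move=> x; rewrite in_itv/= => /andP[/ltW ax /ltW xb]; have [] := H x; rewrite ?ax.
- apply: derivable_within_continuous => x; rewrite in_itv/= => xab.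
  by have [[]] := H _ xab.
by rewrite normrM ler_wpM2r//; have [] := H c; rewrite ?(itvP cab).
Qed.

Lemma coordinate_step f z (j : 'I_d) (s : R) (a : E) (K : R) :
  (forall t, Num.min 0 s <= t <= Num.max 0 s ->
    derivable f (t *: e_ j + z) (e_ j) /\ `|'D_(e_ j) f (t *: e_ j + z) - a| <= K) ->
  0 <= K -> `|f (s *: e_ j + z) - f z - s *: a| <= K * `|s|.
Proof.
move=> H K0; apply: row_norm_le => [|i]; first by rewrite mulr_ge0.
pose phi (t : R) : R := f (t *: e_ j + z) 0 i - t * a 0 i.
have -> : (f (s *: e_ j + z) - f z - s *: a) 0 i = phi s - phi 0.
  by rewrite /phi !mxE scale0r add0r mul0r subr0 addrAC.
rewrite -[X in K * `|X|]subr0.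
apply: (@line_bound phi (fun t => 'D_(e_ j) f (t *: e_ j + z) 0 i - a 0 i)) => t /H[df dK].
split; last by have := le_trans (coord_le_norm _ i) dK; rewrite !mxE.
have [g1 g2] := is_derive_line df.
have hi : is_derive t 1 (fun s : R => f (s *: e_ j + z) 0 i) ('D_(e_ j) f (t *: e_ j + z) 0 i).
  split; first by move/derivable_mxP : g1; apply.
  by rewrite -g2 derive_mx// mxE.
have hl : is_derive t 1 (fun s : R => s * a 0 i) (a 0 i).
  have -> : (fun s : R => s * a 0 i) = a 0 i \*: (id : R -> R).
    by apply/funext => u; rewrite mulrC.
  have := is_deriveZ (a 0 i) (is_derive_id t (1 : R)).
  by rewrite /GRing.scale/= mulr1.
exact: is_deriveB.
Qed.

(** Row [j] is the derivative along the j-th unit vector, because the matrix acts on row vectors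
    from the right. *)
Definition jacobian f p : 'M[R]_d := \matrix_(j, i) ('D_(e_ j) f p) 0 i.

Lemma row_jacobian f p j : row j (jacobian f p) = 'D_(e_ j) f p.
Proof. by apply/rowP => i; rewrite !mxE. Qed.

(* Moving from x to y one coordinate at a time only visits points whose
   distance to x is at most that of y. *)
Lemma path_bound f x y A (K : R) : 0 <= K ->
  (forall xi j, `|xi - x| <= `|y - x| ->
     derivable f xi (e_ j) /\ `|'D_(e_ j) f xi - row j A| <= K) ->
  `|f y - f x - (y - x) *m A| <= d%:R * K * `|y - x|.
Proof.
move=> K0 H; pose z (m : nat) : E := \row_i if (i < m)%N then y 0 i else x 0 i.
have z0 : z 0%N = x by apply/rowP => i; rewrite !mxE.
have zd : z d = y by apply/rowP => i; rewrite !mxE ltn_ord.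
have zS (j : 'I_d) : z j.+1 = (y - x) 0 j *: e_ j + z j.
  apply/rowP => i; rewrite !mxE/= ltnS leq_eqVlt -val_eqE/=.
  have [ij|ij] := eqVneq (i : nat) j => /=; last by rewrite mulr0 add0r.
  by rewrite (ord_inj ij) ltnn mulr1 subrK.
have -> : f y - f x - (y - x) *m A =
    \sum_(j < d) (f (z j.+1) - f (z j) - (y - x) 0 j *: row j A).
  rewrite sumrB -mulmx_sum_row; congr (_ - _).
  by rewrite -(big_mkord xpredT (fun j => f (z j.+1) - f (z j))) telescope_sumr// z0 zd.
apply: le_trans (ler_norm_sum _ _ _) _.
apply: (@le_trans _ _ (\sum_(j < d) K * `|y - x|)); last first.
  by rewrite sumr_const card_ord -[leLHS]mulr_natl mulrA.
apply: ler_sum => j _; rewrite zS.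
apply: (@le_trans _ _ (K * `|(y - x) 0 j|)); last first.
  by rewrite ler_wpM2l// coord_le_norm.
apply: coordinate_step => // t tj; apply: H.
apply: row_norm_le => // i; apply: le_trans (coord_le_norm (y - x) i).
rewrite !mxE/=; have [->|ij] := eqVneq i j.
  rewrite ltnn mulr1 addrK.
  move: tj; rewrite !mxE; set u := y 0 j - x 0 j => /andP[].
  have [u0|/ltW u0] := leP 0 u; first by move=> t0 tu; rewrite !ger0_norm.
  by move=> tu t0; rewrite !ler0_norm// lerN2.
by rewrite mulr0 add0r; case: ifP => // _; rewrite subrr normr0.
Qed.

Definition C1_at f p := (\forall x \near p, forall v, derivable f x v) /\
  forall v, {for p, continuous ('D_v f)}.

(** [path_bound] against the Jacobian at the fixed point [p]. Since both points may vary, the local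
    Lipschitz bound and the chain rule along curves follow directly. *)
Lemma strict_derivative f p (e : R) : C1_at f p -> 0 < e ->
  \forall q \near (0 : R)^'+, forall x y, `|x - p| < q -> `|y - p| < q ->
    `|f y - f x - (y - x) *m jacobian f p| <= e * `|y - x|.
Proof.
move=> [df cf] e0; pose K := e / d.+1%:R.
have K0 : 0 < K by rewrite divr_gt0.
have : \forall x \near p, forall j, derivable f x (e_ j) /\
    `|'D_(e_ j) f x - row j (jacobian f p)| <= K.
  have h : \forall x \near p, forall j, `|'D_(e_ j) f p - 'D_(e_ j) f x| <= K.
    apply: (@filter_forall E 'I_d (fun j x => `|'D_(e_ j) f p - 'D_(e_ j) f x| <= K) (nbhs p) _) => j.
    exact: ((cvgrPdist_le _ _).1 (cf (e_ j)) _ K0).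
  apply: filterS2 df h => x h1 h2 j; split; first exact: h1.
  by rewrite row_jacobian distrC.
move=> /nbhs_ballP[r /= r0 hr].
near=> q => x y xp yp.
(* Points on the path are within |y - x| of [x], hence within 3 q of [p]. *)
have q3 : q <= r / 3 by near: q; apply: nbhs_right_le; rewrite divr_gt0.
apply: le_trans (path_bound (ltW K0) _) _ => [xi j xix|].
  apply: hr; rewrite -ball_normE/= distrC.
  have -> : xi - p = (xi - x) + (x - p) by rewrite addrA subrK.
  apply: le_lt_trans (ler_normD _ _) _.
  have : `|y - x| <= `|y - p| + `|x - p|.
    by have := ler_distD p y x; rewrite [`|p - x|]distrC.
  by move: xix xp yp q3 (r0); lra.
rewrite ler_wpM2r// /K mulrCA ler_piMr ?ltW// ltr_pdivrMr// mul1r.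
by rewrite ltr_nat.
Unshelve. all: by end_near. Qed.

Lemma locally_lipschitz f p : C1_at f p -> exists2 L : R, 0 < L &
  \forall q \near (0 : R)^'+, forall x y, `|x - p| < q -> `|y - p| < q ->
    `|f y - f x| <= L * `|y - x|.
Proof.
move=> cf; exists (1 + d%:R * `|jacobian f p|).
  by rewrite ltr_wpDr// mulr_ge0.
have := strict_derivative cf ltr01; apply: filterS => q H x y xp yp.
have := H x y xp yp; set u := f y - f x => h.
have -> : u = (u - (y - x) *m jacobian f p) + (y - x) *m jacobian f p by rewrite subrK.
by apply: le_trans (ler_normD _ _) _; rewrite mulrDl lerD// mulmx_norm_le.
Qed.

Lemma derive_comp_curve f p (c : R -> E) v : C1_at f p -> c 0 = p ->
  is_derive (0 : R) 1 c v -> is_derive (0 : R) 1 (f \o c) (v *m jacobian f p).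
Proof.
move=> cf c0 [dc Dc]; set A := jacobian f p.
suff h : (fun h : R => h^-1 *: (((f \o c) \o shift 0) (h *: 1) - (f \o c) 0)) @ 0^' --> v *m A.
  by split; [apply/cvg_ex; exists (v *m A)|exact/cvg_lim].
have dc' : (fun h : R => h^-1 *: ((c \o shift 0) (h *: 1) - c 0)) @ 0^' --> v by rewrite -Dc.
have cc : {for 0, continuous c} by apply/differentiable_continuous/derivable1_diffP.
apply/cvgrPdist_le => e e0.
pose B := d%:R * `|A| + 1; have B0 : 0 < B by rewrite ltr_wpDl// mulr_ge0.
pose b := `|v| + 1; have b0 : 0 < b by rewrite ltr_wpDl.
have eB : 0 < Num.min 1 (e / 2 / B) by rewrite lt_min ltr01/= !divr_gt0.
have eb : 0 < e / 2 / b by rewrite !divr_gt0.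
have [q /= [q0 hq]] : exists q : R, 0 < q /\ forall x y, `|x - p| < q -> `|y - p| < q ->
    `|f y - f x - (y - x) *m A| <= e / 2 / b * `|y - x|.
  have := filter_ex (filterI (strict_derivative cf eb) (nbhs_right_gt 0)).
  by move=> [q [h1 h2]]; exists q.
have h1 : \forall h \near (0 : R)^', `|v - h^-1 *: (c (h *: 1 + 0) - c 0)| <= Num.min 1 (e / 2 / B).
  exact: ((cvgrPdist_le _ _).1 dc' _ eB).
have h2 : \forall h \near (0 : R)^', `|c h - p| < q.
  have hh : \forall t \near (0 : R), `|p - c t| < q.
    by rewrite -c0; exact: ((cvgrPdist_lt _ _).1 cc _ q0).
  by have := nbhs_dnbhs hh; apply: filterS => h; rewrite distrC.
have h3 : \forall h \near (0 : R)^', h != 0 by exact: nbhs_dnbhs_neq.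
apply: filterS3 h1 h2 h3 => h /=; rewrite [h *: 1]mulr1 addr0 c0.
set u := h^-1 *: (c h - p) => hu cq h0.
have ue : h *: u = c h - p by rewrite /u scalerA mulfV// scale1r.
have /andP[hu1 huB] : (`|v - u| <= 1) && (`|v - u| <= e / 2 / B) by rewrite -le_min.
have ub : `|u| <= b.
  have -> : u = v - (v - u) by rewrite opprB addrC subrK.
  by apply: le_trans (ler_normB _ _) _; rewrite /b lerD2l.
have pq : `|p - p| < q by rewrite subrr normr0.
have := hq _ _ pq cq; rewrite -ue; set w := f (c h) - f p => hw; clearbody w.
have -> : v *m A - h^-1 *: w = (v - u) *m A - h^-1 *: (w - (h *: u) *m A).
  rewrite scalerBr -scalemxAl scalerA mulVf// scale1r mulmxBl opprB addrA subrK.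
  by [].
apply: le_trans (ler_normB _ _) _; rewrite (splitr e) lerD//.
  apply: le_trans (mulmx_norm_le _ _) _.
  apply: (@le_trans _ _ (B * (e / 2 / B))); last by rewrite mulrC divfK// gt_eqF.
  by apply: ler_pM => //; rewrite ?mulr_ge0// /B lerDl.
rewrite normrZ normfV; apply: (@le_trans _ _ (`|h|^-1 * (e / 2 / b * `|h *: u|))).
  by rewrite ler_wpM2l// invr_ge0.
rewrite normrZ mulrCA mulKf ?normr_eq0//.
apply: (@le_trans _ _ (e / 2 / b * b)); first by rewrite ler_wpM2l// ltW.
by rewrite divfK// gt_eqF.
Qed.


End strict_differentiability.

Section orthogonal_triangularisation.
Context (R : rcfType).

Lemma mulmx_tr_eq0 n (u : 'rV[R]_n) : (u *m u^T) 0 0 = 0 -> u = 0.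
Proof.
rewrite mxE => h; apply/rowP => i; rewrite mxE; apply/eqP; rewrite -sqrf_eq0.
have h' : \sum_j u 0 j ^+ 2 = 0.
  by rewrite -[RHS]h; apply: eq_bigr => j _; rewrite mxE expr2.
by move/eqP: h'; rewrite psumr_eq0 => [/allP/(_ i)|j _]; [apply; exact: mem_index_enum|exact: sqr_ge0].
Qed.

(** The reflection along u = b - c, where c is the multiple of the first unit vector with the norm
    of [b]; equality of norms gives <b, u> = |u|^2 / 2, so [b] is mapped to c. If u = 0 the identity
    does. *)
Lemma householder n (b : 'rV[R]_(1 + n)) : exists H : 'M[R]_(1 + n),
  H *m H^T = 1%:M /\ rsubmx (b *m H) = 0.
Proof.
pose c : 'rV[R]_(1 + n) := row_mx (Num.sqrt ((b *m b^T) 0 0))%:M 0.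
have cc : c *m c^T = b *m b^T.
  rewrite /c tr_row_mx mul_row_col trmx0 mulmx0 addr0 tr_scalar_mx -scalar_mxM.
  rewrite -expr2 sqr_sqrtr -?mx11_scalar//.
  by rewrite mxE sumr_ge0// => j _; rewrite mxE -expr2 sqr_ge0.
pose u := b - c; pose s := (u *m u^T) 0 0.
have uu : u *m u^T = s%:M by exact: mx11_scalar.
have [s0|s0] := eqVneq s 0.
  exists 1%:M; rewrite trmx1 mulmx1 mulmx1; split=> //.
  have /eqP : u = 0 by exact: mulmx_tr_eq0.
  by rewrite subr_eq0 => /eqP ->; rewrite row_mxKr.
have bu : b *m u^T = (s / 2)%:M.
  have -> : (s / 2)%:M = 2^-1 *: (u *m u^T) by rewrite uu scale_scalar_mx mulrC.
  have e : c *m b^T = b *m c^T.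
    rewrite [RHS]mx11_scalar [LHS]mx11_scalar; congr (_%:M); rewrite !mxE.
    by apply: eq_bigr => j _; rewrite !mxE mulrC.
  have -> : u *m u^T = b *m u^T + b *m u^T.
    rewrite /u linearB/= mulmxBl !mulmxBr cc e; apply/matrixP => i j; rewrite !mxE; ring.
  by move: (b *m u^T) => w; apply/matrixP => i j; rewrite !mxE; field.
pose H := 1%:M - (2 / s) *: (u^T *m u).
have HT : H^T = H by rewrite /H linearB/= linearZ/= trmx1 trmx_mul trmxK.
exists H; rewrite HT; split.
  rewrite {2}/H mulmxBr mulmx1 -scalemxAr {1 2}/H mulmxBl mul1mx -scalemxAl.
  rewrite mulmxA -[u^T *m u *m u^T]mulmxA uu mul_mx_scalar -scalemxAl scalerA divfK//.
  apply/matrixP => i j; rewrite !mxE; set v := \sum_(_ < _) _.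
  by rewrite /v; field.
have -> : b *m H = c; last by rewrite row_mxKr.
rewrite /H mulmxBr mulmx1 -scalemxAr mulmxA bu mul_scalar_mx scalerA.
have -> : 2 / s * (s / 2) = 1 by field.
by rewrite scale1r /u opprB addrC subrK.
Qed.

(** In the frame formed by the rows of [Om], the first k rows of [B] have no coordinates from k on,
    for all k at once. This yields an orthonormal frame adapted to the span of the first k rows. *)
Lemma orthogonal_triangularisation n (B : 'M[R]_n) : exists Om : 'M[R]_n,
  Om *m Om^T = 1%:M /\ is_trig_mx (B *m Om^T).
Proof.
elim: n B => [|n IH].
  move=> B.
  by exists 1%:M; split; [apply/matrixP => -[]|apply/is_trig_mxP => -[]].
rewrite -[n.+1]/(1 + n)%N => B.
have [H [HH bH]] := householder (usubmx B).
have [Om [OO trig]] := IH (drsubmx (B *m H)).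
have H1 : H^T *m H = 1%:M by exact: mulmx1C.
exists (block_mx 1%:M 0 0 Om *m H^T).
rewrite trmx_mul trmxK tr_block_mx !trmx0 trmx1; split.
  rewrite mulmxA -[_ *m H^T *m H]mulmxA H1 mulmx1 mulmx_block.
  by rewrite !mulmx0 !mul0mx !mulmx1 !addr0 add0r OO -scalar_mx_block.
rewrite mulmxA -[B *m H]submxK mulmx_block.
rewrite !mulmx0 !mulmx1 !addr0 !add0r is_trig_block_mx// trig andbT.
have -> : ursubmx (B *m H) = 0.
  by rewrite -bH mul_usub_mx.
by rewrite mul0mx eqxx/= mx11_is_trig.
Qed.

End orthogonal_triangularisation.

(** * Charts, tangent vectors and local curvature *)

Section submanifold.
Context (R : realType) (d : nat).
Local Notation E := 'rV[R]_d.

Lemma smooth_C1_at (U : set E) f p : open U -> smooth U f -> U p -> C1_at f p.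
Proof.
move=> oU sf Up; have [h1 h2] := sf 1%N; split; last by move=> v; exact: h2.
have : nbhs p U by exact: open_nbhs_nbhs.
by apply: filterS => x Ux v; exact: h1.
Qed.

Lemma smooth_derive (U : set E) f v : smooth U f -> smooth U ('D_v f).
Proof. by move=> sf m; have [_] := sf m.+1; apply. Qed.

Lemma is_derive_affine (w q : E) : is_derive (0 : R) 1 (fun t : R => t *: w + q) w.
Proof.
have h (t : R) : derivable (id : E -> E) (t *: w + q) w by [].
have := is_derive_line (h 0); rewrite /= => -[h1 h2]; split=> //.
by rewrite h2 derive_id.
Qed.

Lemma derive_coord (c : R -> E) v i : is_derive (0 : R) 1 c v ->
  is_derive (0 : R) 1 (fun t => c t 0 i) (v 0 i).
Proof.
move=> [h1 h2]; split; first by move/derivable_mxP : h1; apply.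
by rewrite -h2 derive_mx// mxE.
Qed.

Lemma distance_to_le (A : set E) x v : A v -> distance_to A x <= enorm (x - v).
Proof.
move=> Av; apply: ge_inf; last by exists v.
by exists 0 => _ [w _ <-]; exact: enorm_ge0.
Qed.

Lemma le_distance_to (A : set E) x (r : R) : A !=set0 ->
  (forall v, A v -> r <= enorm (x - v)) -> r <= distance_to A x.
Proof.
move=> [v0 Av0] h; apply: lb_le_inf; first by exists (enorm (x - v0)), v0.
by move=> _ [v Av <-]; exact: h.
Qed.

Lemma tangent_space0 (N : set E) x : N x -> tangent_space N x 0.
Proof.
move=> Nx; have h : \forall t \near (0 : R), N (cst x t) by near=> t; exact: Nx.
by exists (cst x); split => //; exact: is_derive_cst.
Unshelve. all: by end_near. Qed.

Lemma norm_le_enorm (x : E) : `|x| <= enorm x.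
Proof.
apply: row_norm_le => [|i]; first exact: enorm_ge0.
rewrite -sqrtr_sqr /enorm ler_sqrt.
  by rewrite (bigD1 i)//= lerDl sumr_ge0// => j _; exact: sqr_ge0.
by rewrite sumr_ge0// => j _; exact: sqr_ge0.
Qed.

Section chart.
Variables (k : nat) (N U V : set E) (Phi Psi : E -> E).
Hypotheses (oU : open U) (oV : open V) (sPhi : smooth U Phi) (sPsi : smooth V Psi).
Hypotheses (PhiK : forall x, U x -> V (Phi x) /\ Psi (Phi x) = x)
  (PsiK : forall y, V y -> U (Psi y) /\ Phi (Psi y) = y).
Hypothesis chartN : forall x, U x ->
  N x <-> forall i : 'I_d, (k <= i)%N -> Phi x ord0 i = 0.

Lemma line_in (q w : E) : V q -> \forall t \near (0 : R), V (t *: w + q).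
Proof.
move=> Vq; have [dl _] := is_derive_affine w q.
have cl : {for (0 : R), continuous (fun t : R => t *: w + q)}.
  exact/differentiable_continuous/derivable1_diffP.
by apply: cl; rewrite scale0r add0r; exact: open_nbhs_nbhs.
Qed.

Lemma jacobian_inverse p : U p -> jacobian Psi (Phi p) *m jacobian Phi p = 1%:M.
Proof.
move=> Up; have [Vq qK] := PhiK Up; apply/row_matrixP => i.
rewrite row_mul row1 rowE; set w := delta_mx 0 i.
have e0 : (0 : R) *: w + Phi p = Phi p by rewrite scale0r add0r.
have h1 := derive_comp_curve (smooth_C1_at oV sPsi Vq) e0 (is_derive_affine w (Phi p)).
have h2 := derive_comp_curve (smooth_C1_at oU sPhi Up) _ h1.
have [_ <-] : is_derive (0 : R) 1 (Phi \o (Psi \o (fun t : R => t *: w + Phi p)))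
    (w *m jacobian Psi (Phi p) *m jacobian Phi p).
  by apply: h2; rewrite /= e0.
have [_ e] := is_derive_affine w (Phi p); rewrite -[RHS]e.
apply: near_eq_derive; have := line_in w Vq; apply: filterS => t Vt /=.
by have [_] := PsiK Vt.
Qed.

(** A curve in [N] has vanishing normal chart coordinates near time 0, and so do their
    derivatives. *)
Lemma tangent_coord p v (i : 'I_d) : U p -> N p -> tangent_space N p v -> (k <= i)%N ->
  (v *m jacobian Phi p) 0 i = 0.
Proof.
move=> Up Np [c [c0 Nc dc]] ki.
have [_ <-] := derive_coord i (derive_comp_curve (smooth_C1_at oU sPhi Up) c0 dc).
have cc : {for 0, continuous c} by apply/differentiable_continuous/derivable1_diffP; case: dc.
have Uc : \forall t \near (0 : R), U (c t).
  by apply: cc; rewrite c0; exact: open_nbhs_nbhs.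
rewrite (@near_eq_derive _ _ _ _ (cst 0)) ?derive_cst//.
by apply: filterS2 Nc Uc => t Nt Ut /=; exact: ((chartN Ut).1 Nt i ki).
Qed.

(** The curve is the preimage of a straight line in chart coordinates; it supplies the tangent
    vectors for upper bounds on [distance_to]. *)
Lemma tangent_curve (a w : E) : V a -> (forall i : 'I_d, (k <= i)%N -> a 0 i = 0 /\ w 0 i = 0) ->
  tangent_space N (Psi a) (w *m jacobian Psi a).
Proof.
move=> Va aw; exists (fun t : R => Psi (t *: w + a)); split.
- by rewrite scale0r add0r.
- have := line_in w Va; apply: filterS => t Vt; have [Ut tK] := PsiK Vt.
  apply/(chartN Ut) => i ki; rewrite tK !mxE.
  by have [-> ->] := aw i ki; rewrite mulr0 addr0.
- have e : (0 : R) *: w + a = a by rewrite scale0r add0r.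
  exact: (derive_comp_curve (smooth_C1_at oV sPsi Va) e (is_derive_affine w a)).
Qed.

(** A tangent vector is u times the Jacobian of [Psi], with u supported on the first k coordinates;
    after triangularisation the rows involved have no entries from k on. *)
Lemma tangent_frame p : U p -> N p -> exists Om : 'M[R]_d, Om *m Om^T = 1%:M /\
  forall v, tangent_space N p v -> forall l : 'I_d, (k <= l)%N -> (v *m Om^T) 0 l = 0.
Proof.
move=> Up Np.
have [Om [OO /is_trig_mxP trig]] := orthogonal_triangularisation (jacobian Psi (Phi p)).
exists Om; split=> // v Tv l kl; pose u := v *m jacobian Phi p.
have uv : v = u *m jacobian Psi (Phi p).
  by rewrite /u -mulmxA (mulmx1C (jacobian_inverse Up)) mulmx1.
rewrite uv -mulmxA mxE big1// => j _; have [jl|lj] := ltnP j l.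
  by rewrite trig// mulr0.
by rewrite (tangent_coord Up Np Tv (leq_trans kl lj)) mul0r.
Qed.

(** With a and b the chart images of x and y, the vector b - a pushed forward by the Jacobian of
    [Psi] at a is tangent at x. Its distance to y - x is a second-order Taylor remainder, quadratic
    uniformly near [p] because the first derivatives of [Psi] are locally Lipschitz. *)
Lemma local_curvature_bound p : U p -> N p -> exists2 C : R, 0 < C &
  \forall q \near (0 : R)^'+, forall x y, N x -> N y -> `|x - p| < q -> `|y - p| < q ->
    distance_to (tangent_space N x) (y - x) <= C * enorm (y - x) ^+ 2.
Proof.
move=> Up Np; have [Vq qK] := PhiK Up.
have [L1 L10 hPhi] := locally_lipschitz (smooth_C1_at oU sPhi Up).
pose lipschitz_der (j : 'I_d) (L q : R) := forall x y, `|x - Phi p| < q -> `|y - Phi p| < q ->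
  `|'D_(delta_mx 0 j) Psi y - 'D_(delta_mx 0 j) Psi x| <= L * `|y - x|.
have /choice[L LP] j : exists L : R, 0 < L /\ \forall q \near (0 : R)^'+, lipschitz_der j L q.
  by have [L] := locally_lipschitz (smooth_C1_at oV (smooth_derive (delta_mx 0 j) sPsi) Vq); exists L.
pose L2 := \sum_j L j.
have L2le j : L j <= L2.
  by rewrite /L2 (bigD1 j)//= lerDl sumr_ge0// => i _; apply: ltW; case: (LP i).
have L20 : 0 <= L2 by rewrite sumr_ge0// => i _; apply: ltW; case: (LP i).
have C00 : 0 <= d%:R * L2 * L1 ^+ 2 by rewrite !mulr_ge0// ltW.
exists (Num.sqrt d%:R * (d%:R * L2 * L1 ^+ 2) + 1).
  by rewrite ltr_wpDl// mulr_ge0// sqrtr_ge0.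
have [q0 [q00 hq0]] : exists q : R, 0 < q /\ forall j, lipschitz_der j (L j) q.
  have h : \forall q \near (0 : R)^'+, forall j, lipschitz_der j (L j) q.
    apply: (@filter_forall R 'I_d (fun j => lipschitz_der j (L j)) (0^'+) _) => j.
    exact: (LP j).2.
  near (0 : R)^'+ => q; exists q; split; last exact: (near h q).
  by near: q; exact: nbhs_right_gt.
have [r1 /= r10 hr1] : exists2 r : R, 0 < r & ball (Phi p) r `<=` V.
  by apply/nbhs_ballP; exact: open_nbhs_nbhs.
have [r2 /= r20 hr2] : exists2 r : R, 0 < r & ball p r `<=` U.
  by apply/nbhs_ballP; exact: open_nbhs_nbhs.
pose r := Num.min q0 r1; have r0 : 0 < r by rewrite lt_min q00.
have rq : r <= q0 by rewrite ge_min lexx.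
have rr1 : r <= r1 by rewrite ge_min lexx orbT.
near=> q => x y Nx Ny xp yp.
have qr2 : q <= r2 by near: q; exact: nbhs_right_le.
have qr : q <= r / 3 / L1 by near: q; apply: nbhs_right_le; rewrite !divr_gt0.
have q_gt0 : 0 < q by near: q; exact: nbhs_right_gt.
have lip : forall x y, `|x - p| < q -> `|y - p| < q -> `|Phi y - Phi x| <= L1 * `|y - x|.
  exact: (near hPhi q).
have Ux : U x by apply: hr2; rewrite -ball_normE/= distrC (lt_le_trans xp).
have Uy : U y by apply: hr2; rewrite -ball_normE/= distrC (lt_le_trans yp).
have [Va aK] := PhiK Ux; have [Vb bK] := PhiK Uy.
have pp : `|p - p| < q by rewrite subrr normr0.
have near3 z : `|z - p| < q -> `|Phi z - Phi p| < r / 3.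
  move=> zp; apply: le_lt_trans (lip _ _ pp zp) _.
  rewrite mulrC -ltr_pdivlMr//; exact: lt_le_trans qr.
have ap := near3 _ xp; have bp := near3 _ yp.
set a := Phi x in ap Va aK *; set b := Phi y in bp Vb bK *.
have T : tangent_space N x ((b - a) *m jacobian Psi a).
  rewrite -[in X in tangent_space N X]aK; apply: tangent_curve => // i ki.
  have ha := (chartN Ux).1 Nx i ki; have hb := (chartN Uy).1 Ny i ki.
  by rewrite /a /b !mxE ha hb subr0.
apply: le_trans (distance_to_le _ T) _.
have key : `|y - x - (b - a) *m jacobian Psi a| <= d%:R * (L2 * `|b - a|) * `|b - a|.
  rewrite -{1}aK -{1}bK; apply: path_bound => [|xi j xia]; first by rewrite mulr_ge0.
  have xip : `|xi - Phi p| < r.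
    have -> : xi - Phi p = (xi - a) + (a - Phi p) by rewrite addrA subrK.
    apply: le_lt_trans (ler_normD _ _) _.
    have : `|b - a| <= `|b - Phi p| + `|a - Phi p|.
      by have := ler_distD (Phi p) b a; rewrite [`|Phi p - a|]distrC.
    by move: xia ap bp; lra.
  have ap' : `|a - Phi p| < r by apply: lt_trans ap _; move: (r0); lra.
  split.
    have [h1 _] := sPsi 1%N; apply: h1; apply: hr1.
    by rewrite -ball_normE/= distrC (lt_le_trans xip).
  rewrite row_jacobian.
  apply: le_trans (hq0 j _ _ (lt_le_trans ap' rq) (lt_le_trans xip rq)) _.
  by apply: ler_pM => //; apply: ltW; case: (LP j).
have key2 : `|y - x - (b - a) *m jacobian Psi a| <= d%:R * L2 * L1 ^+ 2 * enorm (y - x) ^+ 2.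
  apply: le_trans key _; have -> : d%:R * (L2 * `|b - a|) * `|b - a| = d%:R * L2 * `|b - a| ^+ 2 by ring.
  rewrite -[leRHS]mulrA -exprMn ler_wpM2l ?mulr_ge0// lerXn2r ?nnegrE//.
    by rewrite mulr_ge0 ?enorm_ge0// ltW.
  by apply: le_trans (lip _ _ xp yp) _; rewrite ler_pM2l// norm_le_enorm.
set z := _ - _ *m _ in key2 *.
have zz : enorm z <= Num.sqrt d%:R * `|z|.
  rewrite -[leLHS]ger0_norm ?enorm_ge0// -sqrtr_sqr -[`|z|]ger0_norm// -sqrtr_sqr -sqrtrM//.
  by rewrite ler_sqrt ?mulr_ge0 ?sqr_ge0// enorm_le.
apply: le_trans zz _.
apply: (@le_trans _ _ (Num.sqrt d%:R * (d%:R * L2 * L1 ^+ 2 * enorm (y - x) ^+ 2))).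
  by rewrite ler_wpM2l// sqrtr_ge0.
by rewrite mulrA ler_wpM2r ?sqr_ge0// lerDl.
Unshelve. all: by end_near. Qed.

End chart.

End submanifold.

Section global.
Context (R : realType) (d k : nat).
Local Notation E := 'rV[R]_d.
Variable N : set E.
Hypothesis subN : smooth_submanifold k N.

Lemma global_curvature_lty : compact N -> (global_curvature N < +oo)%E.
Proof.
move=> /compact_near_coveringP/near_covering_withinP covN.
have : \forall C \near (+oo : set_system R), N `<=` [set x | forall y, N y ->
    distance_to (tangent_space N x) (y - x) <= C * enorm (y - x) ^+ 2].
  apply: (covN R (+oo : set_system R) (fun C x => forall y, N y ->
    distance_to (tangent_space N x) (y - x) <= C * enorm (y - x) ^+ 2)) => p Np.
  have [_ /(_ p Np)[U [V [Phi [Psi [[oU oV Up] sPhi sPsi [PhiK PsiK] chN]]]]]] := subN.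
  have [C0 C00 hq] := local_curvature_bound oU oV sPhi sPsi PhiK PsiK chN Up Np.
  have [q [h /= q0]] := filter_ex (filterI hq (nbhs_right_gt 0)).
  (* The constant 2/q serves the points y at distance at least q from p: then |y - x| >= q/2, and
     the zero tangent vector already gives the bound. *)
  exists (ball p (q / 2), [set C | Num.max C0 (2 / q) <= C]) => /=.
    split; first by apply: nbhsx_ballx; rewrite divr_gt0.
    by apply: nbhs_pinfty_ge; exact: num_real.
  move=> [x C]/= [xp]; rewrite ge_max => /andP[C0C qC] Nx y Ny.
  move: xp; rewrite -ball_normE/= distrC => xp.
  have [yp|yp] := ltP `|y - p| q.
    apply: le_trans (h x y Nx Ny _ yp) _; last by rewrite ler_wpM2r// sqr_ge0.
    by apply: lt_le_trans xp _; move: q0 => /=; lra.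
  have e0 : 0 <= enorm (y - x) by exact: enorm_ge0.
  have yx : q / 2 <= enorm (y - x).
    apply: le_trans (norm_le_enorm _).
    by have := ler_distD x y p; move: xp yp; lra.
  apply: (@le_trans _ _ (enorm (y - x))).
    by rewrite -[in leRHS](subr0 (y - x)); apply: distance_to_le; exact: tangent_space0.
  apply: (@le_trans _ _ (2 / q * enorm (y - x) ^+ 2)).
    rewrite expr2 mulrA ler_peMl//.
    by rewrite mulrAC ler_pdivlMr// mul1r; move: yx; lra.
  by rewrite ler_wpM2r// sqr_ge0.
move=> /filter_ex[C hC].
apply: (@le_lt_trans _ _ (2 * C)%:E); last exact: ltry.
apply: ge_ereal_sup => _ [x [y [Nx Ny xy ->]]]; rewrite lee_fin.
have yx0 : 0 < enorm (y - x).
  apply: lt_le_trans (norm_le_enorm _).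
  by rewrite normr_gt0 subr_eq0; apply/eqP => yx; exact: xy.
by rewrite ler_pdivrMr ?exprn_gt0// -mulrA ler_pM2l// hC.
Qed.

(** Tangent vectors have no normal coordinates, so each normal coordinate of y - p is at most the
    distance to the tangent space; the 2 in the curvature quotient gives [kap / 2]. *)
Lemma flat_set_submanifold (kap : R) : (global_curvature N <= kap%:E)%E ->
  flat_set k (kap / 2) N.
Proof.
move=> hkap p Np.
have [_ /(_ p Np)[U [V [Phi [Psi [[oU oV Up] sPhi sPsi [PhiK PsiK] chN]]]]]] := subN.
have [Om [OO hO]] := tangent_frame oU oV sPhi sPsi PhiK PsiK chN Up Np.
exists Om => // y Ny l kl; have [->|yp] := eqVneq y p.
  rewrite subrr mul0mx mxE normr0.
  have -> : enorm (0 : E) = 0.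
    by rewrite /enorm big1 ?sqrtr0// => i _; rewrite mxE expr0n.
  by rewrite expr0n/= mulr0.
have yp0 : 0 < enorm (y - p).
  by apply: lt_le_trans (norm_le_enorm _); rewrite normr_gt0 subr_eq0.
have : ((2 * distance_to (tangent_space N p) (y - p) / enorm (y - p) ^+ 2)%:E <= kap%:E)%E.
  apply: le_trans hkap; apply: ereal_sup_ubound.
  by exists p, y; split=> // py; move: yp; rewrite py eqxx.
rewrite lee_fin ler_pdivrMr ?exprn_gt0// => hd.
have : `|((y - p) *m Om^T) 0 l| <= distance_to (tangent_space N p) (y - p).
  apply: le_distance_to => [|v Tv]; first by exists 0; exact: tangent_space0.
  have -> : ((y - p) *m Om^T) 0 l = ((y - p - v) *m Om^T) 0 l.
    by rewrite (mulmxBl (y - p) v) [RHS]mxE [X in _ = _ + X]mxE (hO v Tv l kl) subr0.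
  rewrite -[leRHS]ger0_norm ?enorm_ge0// -!sqrtr_sqr ler_sqrt ?sqr_ge0//.
  exact: coord_le_enorm.
by move: hd; lra.
Qed.

End global.

Theorem corollary3p4 (R : realType) (d : nat) (alpha rho b : R)
    (hd : (0 < d)%N) (halpha : 0 < alpha) (hrho : 0 < rho)
    (hb : (2 * alpha + d%:R) / (2 * alpha + rho) <= b) :
  (forall Cdim C1 C2 C3 M : R, 0 < Cdim -> 0 < M ->
   exists2 C : R, 0 < C &
   forall (X : set 'rV[R]_d) (Y : set (measurableTypeR R))
     (P : probability ('rV[R]_d * measurableTypeR R)%type R)
     (fstar : 'rV[R]_d -> R),
   learning_problem alpha rho Cdim C1 C2 C3 M X Y P fstar ->
   forall (n : nat) (tau : R), (1 < n)%N -> 1 <= tau ->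
   svm_bound_with_probability least_squares P X M
     (n%:R `^ (- b)) (n%:R `^ (- (2 * alpha + rho)^-1)) n
     (C * tau * n%:R `^ (- (2 * alpha / (2 * alpha + rho))) * ln n%:R ^+ d.+1)
     (1 - expR (- tau)))
  /\
  (forall k : nat, rho = k%:R ->
   forall (Cdim C1 C2 C3 M : R) (kappa : \bar R), 0 < Cdim -> 0 < M ->
   exists2 C : R, 0 < C &
   forall N : set 'rV[R]_d,
   smooth_submanifold k N -> compact N -> global_curvature N = kappa ->
   forall (X : set 'rV[R]_d) (Y : set (measurableTypeR R))
     (P : probability ('rV[R]_d * measurableTypeR R)%type R)
     (fstar : 'rV[R]_d -> R),
   learning_problem alpha rho Cdim C1 C2 C3 M X Y P fstar ->
   measure_support (first_marginal P) `<=` N ->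
   forall (n : nat) (tau : R), (1 < n)%N -> 1 <= tau ->
   svm_bound_with_probability least_squares P X M
     (n%:R `^ (- b)) (n%:R `^ (- (2 * alpha + rho)^-1)) n
     (C * tau * n%:R `^ (- (2 * alpha / (2 * alpha + rho))) * ln n%:R ^+ k.+1)
     (1 - expR (- tau))).
Proof.
split=> [Cdim C1 C2 C3 M Cdim0 M0|k rhok Cdim C1 C2 C3 M kappa Cdim0 M0].
  (* With k = d there are no normal coordinates, so the support is flat with constant 0. *)
  have [C C0 hC] := svm_rate (leqnn d) hd halpha hrho hb C1 C2 C3 Cdim0 M0 (lexx 0).
  exists C => // X Y P fstar lp n tau n1 tau1; apply: hC lp _ n tau n1 tau1 => x0 _.
  exists 1%:M => [|y _ l dl]; first by rewrite trmx1 mulmx1.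
  by move: (ltn_ord l); rewrite ltnNge dl.
(* For k > d there are no such submanifolds, so any constant will do. *)
have [kd|kd] := leqP k d; last first.
  by exists 1 => // N [Nkd _]; move: kd; rewrite ltnNge Nkd.
(* [fine] sends both infinities to 0: the value +oo is excluded by compactness, and -oo, the
   supremum over no pairs when [N] has at most one point, is below 0. *)
pose kap := Num.max 0 (fine kappa).
have kap0 : 0 <= kap / 2 by rewrite divr_ge0// le_max lexx.
have [C C0 hC] := svm_rate kd hd halpha hrho hb C1 C2 C3 Cdim0 M0 kap0.
exists C => // N sN cN curvN X Y P fstar lp suppN; apply: hC lp _ => x0 Sx0.
have kapP : (global_curvature N <= kap%:E)%E.
  have := global_curvature_lty sN cN; rewrite curvN /kap.
  case: (kappa) => [r| |]//= _; last by rewrite leNye.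
  by rewrite lee_fin le_max lexx orbT.
have [Om OO hO] := flat_set_submanifold sN kapP (suppN _ Sx0).
by exists Om => // y Sy; exact: hO (suppN _ Sy).
Qed.
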